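(* Let $(e^{tA})_{t\ge0}$ be an individually eventually positive $C_0$-semigroup on a complex Banach lattice $E$. Then $s(A)=\omega_0(A)$ in any of the following cases: (i) $E$ is a Hilbert space. (ii) $E=L^1(\Omega,\Sigma,\mu)$ for an arbitrary measure space $(\Omega,\Sigma,\mu)$ with $\mu\ge0$. (iii) $E=C(K)$ for a compact Hausdorff space $K$ and $A$ is real.
   Context: A complex Banach lattice $E$ is the complexification of a real Banach lattice $E_{\mathbb{R}}$; $f\ge0$ means $f$ lies in the positive cone $E_+$ of $E_{\mathbb{R}}$. A $C_0$-semigroup $(e^{tA})_{t\ge0}$ with generator $A$ is individually eventually positive if for each $f\ge 0$ in $E$ there is $t_0\ge0$ such that $e^{tA}f\ge0$ for all $t\ge t_0$. $s(A)=\sup\{\operatorname{Re}\lambda:\lambda\in\sigma(A)\}\in[-\infty,\infty]$ is the spectral bound and $\omega_0(A)$ is the growth bound of the semigroup. An operator $A$ is real if $x+iy\in D(A)$ with $x,y\in E_{\mathbb{R}}$ implies $x,y\in D(A)$, and $A$ maps $D(A)\cap E_{\mathbb{R}}$ into $E_{\mathbb{R}}$. $C(K)$ denotes complex-valued continuous functions with the supremum norm. *)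

(* Defs.v *)
From HB Require Import structures.
From mathcomp Require Import all_boot all_order all_algebra.
From mathcomp Require Import sesquilinear.
From mathcomp Require Import complex.
From mathcomp Require Import all_classical all_reals all_analysis.

Set Implicit Arguments.
Unset Strict Implicit.
Unset Printing Implicit Defensive.

Import Order.TTheory GRing.Theory Num.Theory.
Import numFieldNormedType.Exports.

Local Open Scope classical_set_scope.
Local Open Scope complex_scope.
Local Open Scope ring_scope.

(* The order is carried by the relation [blat_le]: the hierarchy has no join of
   Order.Lattice and NormedModule below Num.RealDomain.  Only binary suprema are
   required, as inf x y = - sup (- x) (- y) in an ordered vector space. *)
HB.mixin Record isBanachLattice (R : realType) B
    & CompleteNormedModule R B := {
  blat_le : rel B ;
  blat_sup : B -> B -> B ;
  blat_le_refl : reflexive blat_le ;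
  blat_le_anti : antisymmetric blat_le ;
  blat_le_trans : transitive blat_le ;
  blat_supP : forall x y z : B,
    blat_le (blat_sup x y) z = blat_le x z && blat_le y z ;
  blat_leD2r : forall z x y : B, blat_le x y -> blat_le (x + z) (y + z) ;
  blat_scale_ge0 : forall (a : R) (x : B),
    0 <= a -> blat_le 0 x -> blat_le 0 (a *: x) ;
  blat_norm_le : forall x y : B,
    blat_le (blat_sup x (- x)) (blat_sup y (- y)) -> `|x| <= `|y|
}.

#[short(type="banachLatticeType")]
HB.structure Definition BanachLattice (R : realType) :=
  { B of CompleteNormedModule R B & isBanachLattice R B }.

Notation "x <=_B y" := (blat_le x y) (at level 70) : ring_scope.

Section ComplexBanachLattice.
Context {R : realType}.

(* [m] is the modulus |x + i y| = sup_theta (cos theta x + sin theta y), the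
   supremum being taken in the vector lattice [B]. *)
Definition is_modulus (B : banachLatticeType R) (x y m : B) : Prop :=
  (forall theta : R, cos theta *: x + sin theta *: y <=_B m) /\
  (forall u : B, (forall theta : R, cos theta *: x + sin theta *: y <=_B u) ->
    m <=_B u).

(* [E] is the complexification of [B]: every z in E is uniquely
   [iota x + i iota y], and its norm is the norm in [B] of its modulus. *)
Record complexification (B : banachLatticeType R)
    (E : completeNormedModType R[i]) (iota : B -> E) : Prop := {
  cplx_linear : forall (a : R) (x y : B),
    iota (a *: x + y) = a%:C *: iota x + iota y ;
  cplx_bij : bijective (fun p : B * B => iota p.1 + 'i%C *: iota p.2) ;
  cplx_norm : forall x y : B,
    exists2 m : B, is_modulus x y m & `|iota x + 'i%C *: iota y| = `|m|%:C
}.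

Definition positive_cone (B : banachLatticeType R)
    (E : completeNormedModType R[i]) (iota : B -> E) : set E :=
  [set iota f | f in [set f : B | 0 <=_B f]].

End ComplexBanachLattice.

Section Semigroups.
Context {R : realType} {E : completeNormedModType R[i]}.

(* The values of [op_fun] outside [op_dom] are irrelevant. *)
Record operator := Operator { op_dom : set E ; op_fun : E -> E }.

Definition resolvent_set (A : operator) : set R[i] :=
  [set lambda | exists S : {linear E -> E},
    [/\ continuous S,
        forall y, op_dom A (S y) /\ lambda *: S y - op_fun A (S y) = y
      & forall x, op_dom A x -> S (lambda *: x - op_fun A x) = x] ].

Definition spectrum (A : operator) : set R[i] := ~` resolvent_set A.

Definition spectral_bound (A : operator) : \bar R :=
  ereal_sup [set (complex.Re lambda)%:E | lambda in spectrum A].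

(* Only the values [T t] with 0 <= t matter. *)
Record C0_semigroup (T : R -> {linear E -> E}) : Prop := {
  C0_bounded : forall t, 0 <= t -> continuous (T t) ;
  C0_zero : forall x, T 0 x = x ;
  C0_add : forall s t x, 0 <= s -> 0 <= t -> T (s + t) x = T s (T t x) ;
  C0_strong : forall x, T t x @[t --> 0^'+] --> x
}.

Definition diff_quotient (T : R -> {linear E -> E}) (x : E) (h : R) : E :=
  (h^-1)%:C *: (T h x - x).

Definition generator (T : R -> {linear E -> E}) : operator :=
  Operator [set x | cvg (diff_quotient T x h @[h --> 0^'+])]
           (fun x => lim (diff_quotient T x h @[h --> 0^'+])).

(* The inequality says that the operator norm of [T t] is at most
   [M * expR (w * t)]. *)
Definition growth_bound (T : R -> {linear E -> E}) : \bar R :=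
  ereal_inf [set w%:E | w in [set w : R | exists M : R,
    forall t x, 0 <= t -> `|T t x| <= (M * expR (w * t))%:C * `|x|] ].

Definition individually_eventually_positive (B : banachLatticeType R)
    (iota : B -> E) (T : R -> {linear E -> E}) : Prop :=
  forall f, positive_cone iota f ->
    exists2 t0 : R, 0 <= t0 &
      forall t, t0 <= t -> positive_cone iota (T t f).

Definition real_operator (B : banachLatticeType R) (iota : B -> E)
    (A : operator) : Prop :=
  (forall x y : B, op_dom A (iota x + 'i%C *: iota y) ->
     op_dom A (iota x) /\ op_dom A (iota y)) /\
  (forall x : B, op_dom A (iota x) -> range iota (op_fun A (iota x))).

End Semigroups.
Arguments operator {R} E.

Definition is_hilbert (R : realType) (E : completeNormedModType R[i]) : Prop :=
  exists dot : {dot E for (@Num.conj R[i])},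
    forall x : E, `|x| ^+ 2 = dot x x.

Section FunctionSpaces.
Context {R : realType}.

Definition cintegrable d (T : measurableType d) (mu : {measure set T -> \bar R})
    (f : T -> R[i]) : Prop :=
  mu.-integrable setT (fun x => (complex.Re (f x))%:E) /\
  mu.-integrable setT (fun x => (complex.Im (f x))%:E).

(* [E] is (isometrically and as a Banach lattice) the complex space L^1(mu);
   [cls] sends an integrable function to its class.  That two functions have the
   same class iff they are equal almost everywhere is contained in [L1_norm];
   values of [cls] on non-integrable functions are irrelevant. *)
Record is_L1 (B : banachLatticeType R) (E : completeNormedModType R[i])
    (iota : B -> E) d (T : measurableType d) (mu : {measure set T -> \bar R})
    (cls : (T -> R[i]) -> E) : Prop := {
  L1_linear : forall (a : R[i]) (f g : T -> R[i]),
    cintegrable mu f -> cintegrable mu g ->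
    cls (fun x => a * f x + g x) = a *: cls f + cls g ;
  L1_surj : forall z : E, exists2 f, cintegrable mu f & cls f = z ;
  L1_norm : forall f, cintegrable mu f ->
    (complex.Re `|cls f|)%:E = (\int[mu]_x (complex.Re `|f x|)%:E)%E ;
  L1_pos : forall f, cintegrable mu f ->
    positive_cone iota (cls f) <-> {ae mu, forall x, 0 <= f x}
}.

(* [E] is (isometrically and as a Banach lattice) the complex space C(K);
   [ev z] is the continuous function which [z] is.  For empty [K] the norm is
   [sup set0 = 0]. *)
Record is_CK (B : banachLatticeType R) (E : completeNormedModType R[i])
    (iota : B -> E) (K : topologicalType) (ev : E -> K -> R[i]^o) : Prop := {
  CK_linear : forall (a : R[i]) (y z : E) (k : K),
    ev (a *: y + z) k = a * ev y k + ev z k ;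
  CK_range : range ev = [set f | continuous f] ;
  CK_norm : forall z : E,
    `|z| = (sup (range (fun k => complex.Re `|ev z k|)))%:C ;
  CK_pos : forall z : E,
    positive_cone iota z <-> forall k, 0 <= ev z k
}.

End FunctionSpaces.

(* Main.v *)
(* The Laplace transform gives s(A) <= w0(A). For the converse fix m > s(A); by uniform
   boundedness it suffices to bound e^{-mt} T(t) f in t for each f >= 0. If T(t) g >= 0
   for all t >= t0, then also T(t) R(a, A) g >= 0 for t >= t0: this is clear for large a
   and descends to every real a > s(A) by the Neumann series. Hence e^{-at} T(t) R(a, A) f
   is eventually positive and decreasing in t, and orbits starting in D(A) are bounded.

   In L^1 the norm is additive on the cone, so the norm of an orbit is controlled by the
   norm of its integral over a unit interval, which is an increment of the previous
   function. In C(K) a real element of D(A) close to 1 dominates a multiple of every f.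

   In a Hilbert space, order domination shows that R(., A) is bounded on Re >= m. Suppose
   w0 > m, let w0 < a <= a' and u(t) = e^{-at} T(t) f >= 0. By the resolvent identity the
   sum over j, l < n of |R(a + i(j - l), A) f|^2 is at most a constant times the same sum
   for a', hence O(n). It is also the double integral of F_n(t - s) <u(t), u(s)>, with
   F_n >= 0 the Fejer kernel and <u(t), u(s)> >= 0 by positivity. Keeping only the part
   near the diagonal bounds the integral of |u|^2 uniformly in a > w0, and Datko's
   argument contradicts the minimality of w0. *)

Require Import Defs.
From HB Require Import structures.
From mathcomp Require Import all_boot all_order all_algebra.
From mathcomp Require Import sesquilinear.
From mathcomp Require Import complex.
From mathcomp Require Import all_classical all_reals all_analysis.
From mathcomp Require Import measurable_realfun.
From mathcomp Require Import ring lra.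

Set Implicit Arguments.
Unset Strict Implicit.
Unset Printing Implicit Defensive.

Import Order.TTheory GRing.Theory Num.Theory.
Import numFieldNormedType.Exports.

Local Open Scope classical_set_scope.
Local Open Scope complex_scope.
Local Open Scope ring_scope.

(** The time at which positivity sets in depends on the vector, so no estimate is uniform at first.
    Each bound is proved for a single positive [f], extended to [E] by writing a vector as a
    combination of four positive ones, and made uniform by the uniform boundedness principle,
    indexed by the time, by a half-plane, or by pairs (rate, time).

    Integrals enter only as increments of functions with a prescribed right derivative. For an orbit
    such a function is explicit, [- e^{-lt} T(t) R(l, A) f]. Inequalities between integrals thus
    become mean value inequalities, and double integrals become mixed differences over rectangles.

    In the Hilbert case, integer frequencies and a double sum stand in for Plancherel's theorem: the
    kernel has size [n^2] on a strip of width [1 / n], which turns a bound of order [n] into a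
    bound, independent of [n], on a discrete square integral. The rescaled semigroup need not be
    bounded at the rate w0 itself, so all constants are kept uniform on an interval of rates just
    above w0; one time at which every norm is at most 1/2 then leads below w0. *)

Local Notation normc := ComplexField.Normc.normc.

(** * Uniform boundedness *)

Section RealNorm.
Context {R : realType} {E : completeNormedModType R[i]}.

Definition nrm (x : E) : R := complex.Re `|x|.

Lemma nrmE (x : E) : `|x| = (nrm x)%:C.
Proof. by rewrite /nrm RRe_real // ger0_real. Qed.

Lemma nrm_ge0 (x : E) : 0 <= nrm x.
Proof. by have := normr_ge0 x; rewrite nrmE ler0c. Qed.

Lemma nrm0 : nrm 0 = 0.
Proof. by rewrite /nrm normr0. Qed.

Lemma nrm0_eq0 (x : E) : nrm x = 0 -> x = 0.
Proof. by move=> h; apply/eqP; rewrite -normr_eq0 nrmE h. Qed.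

Lemma nrmN (x : E) : nrm (- x) = nrm x.
Proof. by rewrite /nrm normrN. Qed.

Lemma nrmB (x y : E) : nrm (x - y) = nrm (y - x).
Proof. by rewrite /nrm distrC. Qed.

Lemma nrmD (x y : E) : nrm (x + y) <= nrm x + nrm y.
Proof. by rewrite -lecR rmorphD /= -!nrmE ler_normD. Qed.

Lemma nrmDB (x y z : E) : nrm (x - z) <= nrm (x - y) + nrm (y - z).
Proof. by have := nrmD (x - y) (y - z); rewrite addrA subrK. Qed.

Lemma nrmBD (x y : E) : nrm x <= nrm (x - y) + nrm y.
Proof. by have := nrmD (x - y) y; rewrite subrK. Qed.

Lemma nrmZ (c : R[i]) (x : E) : nrm (c *: x) = ComplexField.Normc.normc c * nrm x.
Proof. by apply: complexI; rewrite -nrmE normrZ nrmE rmorphM. Qed.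

Lemma nrmZr (a : R) (x : E) : nrm (a%:C *: x) = `|a| * nrm x.
Proof. by rewrite nrmZ /= expr0n /= addr0 sqrtr_sqr. Qed.

Lemma nrm_sum (I : Type) (r : seq I) (P : pred I) (F : I -> E) :
  nrm (\sum_(i <- r | P i) F i) <= \sum_(i <- r | P i) nrm (F i).
Proof.
elim/big_ind2 : _ => [|x1 x2 y1 y2 h1 h2|//]; first by rewrite nrm0.
exact: le_trans (nrmD _ _) (lerD h1 h2).
Qed.

Lemma nrm_le0_eq0 (x : E) : (forall e : R, 0 < e -> nrm x <= e) -> x = 0.
Proof.
move=> h; apply: nrm0_eq0; apply/eqP; rewrite eq_le nrm_ge0 andbT.
by apply/ler_addgt0Pr => e e0; rewrite add0r h.
Qed.

Lemma posC_gt0 (e : R[i]) : 0 < e -> exists2 e' : R, e = e'%:C & 0 < e'.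
Proof.
move=> e0; exists (complex.Re e); first by rewrite RRe_real // gtr0_real.
by move: e0; rewrite ltcE => /andP[].
Qed.

Lemma cauchy_nrm (u : nat -> E) :
  (forall e : R, 0 < e -> exists N, forall m n, (N <= m)%N -> (N <= n)%N ->
     nrm (u m - u n) < e) ->
  exists l, forall e : R, 0 < e -> exists N, forall n, (N <= n)%N ->
     nrm (u n - l) < e.
Proof.
move=> cu.
have uc : cvg (u @ \oo).
  apply/cauchy_cvgP/cauchy_ballP => _ /posC_gt0[e -> e0].
  have [N hN] := cu e e0; rewrite /cauchy_ball /=.
  exists (u @` [set n | (N <= n)%N], u @` [set n | (N <= n)%N]) => /=.
    by split; exists N => // n /= Nn; exists n.
  move=> [x y] /= [[m Nm <-] [n Nn <-]].
  by rewrite -ball_normE /= nrmE ltcR hN.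
exists (lim (u @ \oo)) => e e0.
have /cvgrPdist_lt/(_ e%:C) := uc; rewrite ltcR => /(_ e0) [N _ hN].
by exists N => n /hN; rewrite /= nrmE ltcR nrmB.
Qed.

(* Sokal's gliding hump argument. *)
Lemma uniform_boundedness (I : Type) (p : I -> E -> R) :
  (forall i x y, p i (x + y) <= p i x + p i y) ->
  (forall i (a : R) x, p i (a%:C *: x) = `|a| * p i x) ->
  (forall i, exists C, forall x, p i x <= C * nrm x) ->
  (forall x, exists C, forall i, p i x <= C) ->
  exists2 C, 0 <= C & forall i x, p i x <= C * nrm x.
Proof.
move=> pD pZ pb px.
have pN i x : p i (- x) = p i x.
  have := pZ i (-1) x; rewrite normrN normr1 mul1r => <-.
  by rewrite rmorphN rmorph1 scaleN1r.
have p0 i x : 0 <= p i x.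
  have p00 : p i 0 = 0 by have := pZ i 0 0; rewrite scaler0 normr0 mul0r.
  by have := pD i x (- x); rewrite subrr p00 pN -mulr2n pmulrn_lge0.
apply: contrapT => nb.
(* A unit vector at which [p i] reaches 9/10 of its supremum over the unit sphere, for an [i] that
   makes the value exceed [K]. *)
have {nb} big (K : R) : 0 <= K -> exists ix : I * E, [/\ nrm ix.2 = 1,
    K < p ix.1 ix.2 & forall y, p ix.1 y <= (10 / 9 * p ix.1 ix.2) * nrm y].
  move=> K0; apply: contrapT => nK; apply: nb; exists K => // i.
  have p1 x : x != 0 -> exists2 e, nrm e = 1 & p i x = p i e * nrm x.
    move=> x0; have nx0 : 0 < nrm x.
      by rewrite lt_neqAle nrm_ge0 andbT; apply: contra_neq x0 => /esym/nrm0_eq0.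
    exists (((nrm x)^-1)%:C *: x); rewrite ?nrmZr ?pZ ger0_norm ?invr_ge0 ?nrm_ge0 //.
      by rewrite mulVf ?gt_eqF.
    by rewrite mulrC mulVKf ?gt_eqF.
  have p00 : p i 0 = 0 by have := pZ i 0 0; rewrite scaler0 normr0 mul0r.
  have [e0K|neK] := pselect (forall e, nrm e = 1 -> p i e <= K).
    move=> x; have [->|/p1[e e1 ->]] := eqVneq x 0; first by rewrite p00 nrm0 mulr0.
    by rewrite ler_wpM2r ?nrm_ge0 ?e0K.
  have [e [e1 Ke]] : exists e, nrm e = 1 /\ K < p i e.
    apply: contrapT => h; apply: neK => e e1; rewrite leNgt; apply/negP => Ke.
    by apply: h; exists e.
  pose S := [set p i e | e in [set e | nrm e = 1]].
  have [C hC] := pb i.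
  have Sub : ubound S C by move=> _ [y /= y1 <-]; rewrite (le_trans (hC y)) // y1 mulr1.
  have hS : has_sup S by split; [exists (p i e), e | exists C].
  have Se : p i e <= sup S by apply: ub_le_sup; [exists C|exists e].
  have S0 : 0 < sup S by lra.
  have [_ [f /= f1 <-] hf] := sup_adherent (eps := sup S / 10) ltac:(lra) hS.
  have [g [g1 Kg Sg]] : exists g, [/\ nrm g = 1, K < p i g & 9 / 10 * sup S <= p i g].
    have [h|h] := lerP (p i e) (p i f); [exists f|exists e]; split=> //; lra.
  exfalso; apply: nK; exists (i, g); split => //= y.
  have [->|/p1[y' y1 ->]] := eqVneq y 0; first by rewrite p00 nrm0 mulr0.
  rewrite ler_wpM2r ?nrm_ge0 //.
  have : p i y' <= sup S by apply: ub_le_sup; [exists C|exists y'].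
  lra.
(* With ratio 1/3 the steps after the [n]-th move the point by at most [r n / 2]. This costs at most
   10/9 * 1/2 = 5/9 of the value gained at step [n], so 4/9 of it survives in the limit. *)
pose r (n : nat) : R := (3^-1) ^+ n.
have r_gt0 n : 0 < r n by rewrite exprn_gt0 // invr_gt0.
have rS n : r n.+1 = r n / 3 by rewrite /r exprSr.
have /boolp.choice[ix hix] : forall n : nat, exists ix : I * E,
    [/\ nrm ix.2 = 1, n%:R * (6 / r n) < p ix.1 ix.2 &
     forall y, p ix.1 y <= (10 / 9 * p ix.1 ix.2) * nrm y].
  by move=> n; apply: big; rewrite mulr_ge0 // divr_ge0 // ltW.
(* One of [x + z] and [x - z] will do: [2 z = (x + z) + (z - x)], so the seminorm of one of them is
   at least that of [z]. *)
have step (n : nat) (x : E) : exists y : E, nrm (y - x) <= r n /\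
    r n * p (ix n).1 (ix n).2 <= p (ix n).1 y.
  have [h1 _ _] := hix n; set z := (r n)%:C *: (ix n).2.
  have nz : nrm z = r n by rewrite nrmZr h1 mulr1 gtr0_norm.
  have <- : p (ix n).1 z = r n * p (ix n).1 (ix n).2 by rewrite pZ gtr0_norm.
  have h := pD (ix n).1 (x + z) (z - x).
  have e1 : x + z + (z - x) = (2:R)%:C *: z.
    by rewrite rmorphMn rmorph1 scaler_nat mulr2n addrC addrA subrK.
  rewrite e1 pZ ger0_norm // -(pN _ (z - x)) opprB in h.
  have [le1|le2] := lerP (p (ix n).1 z) (p (ix n).1 (x + z)).
    by exists (x + z); rewrite addrAC subrr add0r nz.
  exists (x - z); rewrite addrAC subrr add0r nrmN nz; split=> //; lra.
have /boolp.choice[nx hnx] : forall q : nat * E, exists y,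
    nrm (y - q.2) <= r q.1 /\ r q.1 * p (ix q.1).1 (ix q.1).2 <= p (ix q.1).1 y.
  by move=> [n x] /=; exact: step.
pose x := fix x n : E := if n is m.+1 then nx (m, x m) else 0.
have xS n : nrm (x n.+1 - x n) <= r n /\
    r n * p (ix n).1 (ix n).2 <= p (ix n).1 (x n.+1) by exact: (hnx (n, x n)).
have xd n k : nrm (x (n + k)%N - x n) <= r n * (3/2) - r (n + k)%N * (3/2).
  elim: k => [|k IH]; first by rewrite addn0 !subrr nrm0.
  rewrite addnS; apply: le_trans (nrmDB _ (x (n + k)%N) _) _.
  have [h _] := xS (n + k)%N; rewrite rS; lra.
have rcv (e : R) : 0 < e -> exists N, r N < e.
  move=> e0; have h : (3^-1 : R) ^+ n @[n --> \oo] --> (0 : R).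
    by apply: cvg_expr; rewrite ger0_norm ?invr_ge0 // invf_lt1 // ltr1n.
  have /cvgrPdist_lt/(_ e e0)[N _ hN] := h.
  by exists N; have := hN N (leqnn _); rewrite /= sub0r normrN ger0_norm.
have [l hl] : exists l, forall e : R, 0 < e -> exists N, forall n, (N <= n)%N ->
     nrm (x n - l) < e.
  apply: cauchy_nrm => e e0.
  have [N hN] := rcv (e / 3) ltac:(by rewrite divr_gt0).
  exists N => m n /subnKC <- /subnKC <-.
  apply: le_lt_trans (nrmDB _ (x N) _) _.
  have h1 := xd N (m - N)%N; have h2 := xd N (n - N)%N.
  rewrite (nrmB (x N)).
  have := r_gt0 (N + (m - N))%N; have := r_gt0 (N + (n - N))%N; lra.
have lx n : nrm (x n - l) <= r n * (3/2).
  apply/ler_addgt0Pr => e e0; have [N hN] := hl e e0.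
  have /hN h : (N <= n + N)%N by rewrite leq_addl.
  apply: le_trans (nrmDB _ (x (n + N)%N) _) _; rewrite nrmB.
  have := xd n N; have := r_gt0 (n + N)%N; lra.
have [C hC] := px l.
have [n nC] : exists n : nat, C < n%:R.
  by exists (Num.bound `|C|); apply: le_lt_trans (ler_norm _) (archi_boundP _).
have [_ h1] := xS n; have [_ h2 h3] := hix n.
have h4 := pD (ix n).1 l (x n.+1 - l); rewrite addrC subrK in h4.
have := h3 (x n.+1 - l); have := lx n.+1; rewrite rS => h5 h6.
have {}h6 : p (ix n).1 (x n.+1 - l) <= 10 / 9 * p (ix n).1 (ix n).2 * (r n / 2).
  apply: le_trans h6 _; rewrite ler_wpM2l //; last by lra.
  by rewrite mulr_ge0 // p0.
have h7 : n%:R * 6 <= r n * p (ix n).1 (ix n).2.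
  have -> : n%:R * 6 = r n * (n%:R * (6 / r n)).
    by rewrite mulrCA (mulrC 6) mulVKf // gt_eqF.
  by rewrite ler_pM2l // ltW.
have := hC (ix n).1; have : (0 : R) <= n%:R by []; lra.
Qed.

End RealNorm.

(** * One-sided derivatives and mean value inequalities *)

Section RightDerivatives.
Context {R : realType}.

(** Supremum argument: the left condition preserves the estimate of slope [K + e] at the last point
    reached, and the right condition carries it further. Only right derivatives enter, the ones that
    an orbit starting in the domain visibly has. *)
Lemma dini_le (psi : R -> R) (a b K : R) : a <= b ->
  (forall t, a <= t < b -> forall e, 0 < e -> exists2 d, 0 < d &
     forall h, 0 < h < d -> psi (t + h) <= psi t + (K + e) * h) ->
  (forall t, a < t <= b -> forall e, 0 < e -> exists2 d, 0 < d &
     forall h, 0 < h < d -> psi t <= psi (t - h) + e) ->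
  psi b <= psi a + K * (b - a).
Proof.
move=> ab hr hl.
have [->|neab] := eqVneq a b; first by rewrite subrr mulr0 addr0.
have {neab} ltab : a < b by rewrite lt_neqAle neab.
suff main e : 0 < e -> psi b <= psi a + (K + e) * (b - a).
  apply/ler_addgt0Pr => e e0.
  have := main (e / (b - a)) ltac:(by rewrite divr_gt0 // subr_gt0).
  have ba : b - a != 0 by rewrite subr_eq0 gt_eqF.
  by rewrite mulrDl divfK // addrA.
move=> e0.
pose S := [set t | a <= t <= b /\
  forall s, a <= s <= t -> psi s <= psi a + (K + e) * (s - a)].
have Sa : S a.
  split; first by rewrite lexx.
  by move=> s; rewrite -eq_le => /eqP <-; rewrite subrr mulr0 addr0.
have Sb : ubound S b by move=> t [/andP[]].
have hS : has_sup S by split; [exists a|exists b].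
set c := sup S.
have ac : a <= c by apply: ub_le_sup => //; exists b.
have cb : c <= b by apply: ge_sup => //; exists a.
have Sc s : a <= s < c -> psi s <= psi a + (K + e) * (s - a).
  move=> /andP[sa sc].
  have [t [tab ht] st] := sup_adherent (eps := c - s) ltac:(lra) hS.
  apply: ht; rewrite sa /= -/c in st *; lra.
have Scc : psi c <= psi a + (K + e) * (c - a).
  have [ac'|ac'] := ltrP a c; last first.
    by have -> : c = a by [apply/le_anti; rewrite ac ac']; rewrite subrr mulr0 addr0.
  apply/ler_addgt0Pr => e1 e10.
  have [d d0 hd] := hl c ltac:(lra) (e1 / 2) ltac:(lra).
  pose m := `|K + e| + 1.
  have m0 : 0 < m by rewrite ltr_wpDl.
  have [h [h0 hd1 hd2 hd3]] : exists h, [/\ 0 < h, h < d, h < c - a & m * h <= e1 / 2].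
    pose h := Num.min (d / 2) (Num.min ((c - a) / 2) (e1 / 2 / m)).
    exists h; rewrite /h !lt_min !gt_min; split.
    - by rewrite !divr_gt0 // subr_gt0.
    - by rewrite ltr_pdivrMr // mulr_natr mulr2n ltrDl d0.
    - have -> : (c - a) / 2 < c - a by lra.
      by rewrite orbT.
    - by rewrite mulrC -ler_pdivlMr // !ge_min lexx !orbT.
  have h1 := hd h ltac:(lra).
  have h2 := Sc (c - h) ltac:(lra).
  have h3 : - (m * h) <= (K + e) * h.
    have := ler_norm (- (K + e)); rewrite normrN => h3.
    rewrite -mulNr ler_pM2r // /m; lra.
  lra.
have [cb'|cb'] := ltrP c b; last by have -> : b = c by apply/le_anti; rewrite cb cb'.
have [d d0 hd] := hr c ltac:(lra) e e0.
pose h := Num.min (d / 2) (b - c).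
have h0 : 0 < h by rewrite /h lt_min divr_gt0 //= subr_gt0.
have hd2 : h < d by rewrite /h gt_min; apply/orP; left; lra.
have hb : h <= b - c by rewrite /h ge_min lexx orbT.
suff : S (c + h) by move=> /(ub_le_sup (ex_intro _ b Sb)); rewrite -/c; lra.
split; first lra.
move=> s /andP[as_ sch].
have [sc|sc] := ltrP s c; first by apply: Sc; rewrite as_.
have [->|nsc] := eqVneq s c; first by [].
have lsc : c < s by rewrite lt_neqAle eq_sym nsc.
have := hd (s - c) ltac:(lra); rewrite addrCA subrr addr0; lra.
Qed.

(* [rdR], [rdE]: right derivative; [lcR], [lcE]: continuity from the left. *)
Definition rdR (f : R -> R) (t d : R) := forall e, 0 < e -> exists2 r, 0 < r &
  forall h, 0 < h < r -> `|f (t + h) - f t - h * d| <= e * h.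

Definition lcR (f : R -> R) (t : R) := forall e, 0 < e -> exists2 r, 0 < r &
  forall h, 0 < h < r -> `|f (t - h) - f t| < e.

Lemma right_germ_and (P Q : R -> Prop) :
  (exists2 r, 0 < r & forall h, 0 < h < r -> P h) ->
  (exists2 r, 0 < r & forall h, 0 < h < r -> Q h) ->
  exists2 r, 0 < r & forall h, 0 < h < r -> P h /\ Q h.
Proof.
move=> [r r0 hP] [s s0 hQ]; exists (Num.min r s); first by rewrite lt_min r0.
move=> h /andP[h0]; rewrite lt_min => /andP[hr hs].
by split; [apply: hP|apply: hQ]; rewrite h0.
Qed.

Lemma rdR_nondecreasing (f d : R -> R) (a b : R) : a <= b ->
  (forall t, a <= t < b -> rdR f t (d t)) ->
  (forall t, a <= t < b -> 0 <= d t) ->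
  (forall t, a < t <= b -> lcR f t) -> f a <= f b.
Proof.
move=> ab hd d0 hl.
have := @dini_le (fun t => - f t) a b 0 ab; rewrite mul0r addr0 lerN2; apply.
- move=> t tab e e0; have [r r0 hr] := hd t tab e e0; exists r => // h hh.
  have := hr h hh; rewrite ler_norml => /andP[h1 _].
  have : 0 <= h * d t by rewrite mulr_ge0 ?d0 // ltW //; case/andP: hh.
  lra.
- move=> t tab e e0; have [r r0 hr] := hl t tab e e0; exists r => // h hh.
  have := hr h hh; rewrite ltr_norml => /andP[]; lra.
Qed.

Lemma is_derive_rdR (f : R -> R) (t d : R) : is_derive t 1 f d -> rdR f t d.
Proof.
move=> [df fd] e e0.
have := df; rewrite /derivable => /cvg_ex [l hl].
have ld : l = d by rewrite -fd; symmetry; apply: cvg_lim => //; exact: hl.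
move: hl; rewrite ld => /cvgrPdist_le/(_ e e0) [r /= r0 hr].
exists r => // h /andP[h0 hr'].
have := hr h; rewrite /ball /= sub0r normrN gtr0_norm // => /(_ hr').
rewrite gt_eqF // => /(_ isT).
rewrite scaler1 [_ *: _]/(_ * _) => hh.
have -> : f (t + h) - f t - h * d = - (d - h^-1 * (f (h + t) - f t)) * h.
  by rewrite (addrC h); field; rewrite gt_eqF.
by rewrite normrM normrN (gtr0_norm h0) ler_pM2r.
Qed.

Lemma derivable_lcR (f : R -> R) (t : R) : derivable f t 1 -> lcR f t.
Proof.
move=> /derivable1_diffP/differentiable_continuous/cvgrPdist_lt hc e e0.
have [r /= r0 hr] := hc e e0; exists r => // h /andP[h0 h1].
rewrite distrC; apply: hr; rewrite /ball /= opprB addrCA subrr addr0.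
by rewrite gtr0_norm.
Qed.

End RightDerivatives.

Section RightDerivativesR.
Context {R : realType}.

Lemma rdR_lin (a b : R) (f g : R -> R) (t d1 d2 : R) :
  rdR f t d1 -> rdR g t d2 ->
  rdR (fun t => a * f t + b * g t) t (a * d1 + b * d2).
Proof.
move=> h1 h2 e e0; pose m := `|a| + `|b| + 1.
have m0 : 0 < m by rewrite ltr_wpDl.
have em : 0 < e / m by rewrite divr_gt0.
have [r r0 hr] := right_germ_and (h1 _ em) (h2 _ em).
exists r => // h hh; have [{}h1 {}h2] := hr h hh.
have -> : a * f (t + h) + b * g (t + h) - (a * f t + b * g t) - h * (a * d1 + b * d2)
  = a * (f (t + h) - f t - h * d1) + b * (g (t + h) - g t - h * d2) by ring.
apply: le_trans (ler_normD _ _) _; rewrite !normrM.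
have h0 : 0 <= e / m * h by rewrite mulr_ge0 ?ltW //; case/andP: hh.
have -> : e * h = m * (e / m * h) by field; rewrite gt_eqF.
apply: (@le_trans _ _ (`|a| * (e / m * h) + `|b| * (e / m * h))).
  by rewrite lerD // ler_wpM2l.
by rewrite -mulrDl ler_wpM2r // /m lerDl.
Qed.

Lemma lcR_lin (a b : R) (f g : R -> R) (t : R) :
  lcR f t -> lcR g t -> lcR (fun t => a * f t + b * g t) t.
Proof.
move=> h1 h2 e e0; pose m := `|a| + `|b| + 1.
have m0 : 0 < m by rewrite ltr_wpDl.
have em : 0 < e / m by rewrite divr_gt0.
have [r r0 hr] := right_germ_and (h1 _ em) (h2 _ em).
exists r => // h hh; have [{}h1 {}h2] := hr h hh.
have -> : a * f (t - h) + b * g (t - h) - (a * f t + b * g t)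
  = a * (f (t - h) - f t) + b * (g (t - h) - g t) by ring.
apply: le_lt_trans (ler_normD _ _) _; rewrite !normrM.
have -> : e = m * (e / m) by field; rewrite gt_eqF.
apply: (@le_lt_trans _ _ (`|a| * (e / m) + `|b| * (e / m))).
  by rewrite lerD // ler_wpM2l // ltW.
by rewrite -mulrDl ltr_pM2r // /m ltrDl.
Qed.

Lemma rdR_ext (f g : R -> R) t d : f =1 g -> rdR f t d -> rdR g t d.
Proof. by move=> /funext ->. Qed.

Lemma lcR_ext (f g : R -> R) t : f =1 g -> lcR f t -> lcR g t.
Proof. by move=> /funext ->. Qed.

Lemma rdR0 t : rdR (fun=> 0 : R) t 0.
Proof.
move=> e e0; exists 1 => // h /andP[h0 _].
by rewrite subr0 mulr0 subr0 normr0 mulr_ge0 // ltW.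
Qed.

Lemma lcR0 (t : R) : lcR (fun=> 0 : R) t.
Proof. by move=> e e0; exists 1 => // h _; rewrite subr0 normr0. Qed.

Lemma rdR_sum (I : Type) (r : seq I) (f : I -> R -> R) (t : R) (d : I -> R) :
  (forall i, rdR (f i) t (d i)) ->
  rdR (fun t => \sum_(i <- r) f i t) t (\sum_(i <- r) d i).
Proof.
move=> h; elim: r => [|i r IH].
  by rewrite big_nil; apply: rdR_ext (rdR0 t) => s; rewrite big_nil.
rewrite big_cons; have := rdR_lin 1 1 (h i) IH; rewrite !mul1r.
by apply: rdR_ext => s; rewrite big_cons !mul1r.
Qed.

Lemma lcR_sum (I : Type) (r : seq I) (f : I -> R -> R) (t : R) :
  (forall i, lcR (f i) t) -> lcR (fun t => \sum_(i <- r) f i t) t.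
Proof.
move=> h; elim: r => [|i r IH].
  by apply: lcR_ext (lcR0 t) => s; rewrite big_nil.
have := lcR_lin 1 1 (h i) IH.
by apply: lcR_ext => s; rewrite big_cons !mul1r.
Qed.

(** The mixed difference plays the role of the double integral of [phi12]. Monotonicity of [phi1 t]
    in [s] makes the right derivative of [phi t d - phi t c] in [t] nonnegative. *)
Lemma rectangle_ge0 (phi phi1 phi12 : R -> R -> R) (a b c d : R) :
  a <= b -> c <= d ->
  (forall s t, c <= s <= d -> a <= t < b -> rdR (phi^~ s) t (phi1 t s)) ->
  (forall s t, c <= s <= d -> a < t <= b -> lcR (phi^~ s) t) ->
  (forall s t, c <= s < d -> a <= t < b -> rdR (phi1 t) s (phi12 t s)) ->
  (forall s t, c < s <= d -> a <= t < b -> lcR (phi1 t) s) ->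
  (forall s t, c <= s < d -> a <= t < b -> 0 <= phi12 t s) ->
  0 <= phi b d - phi b c - phi a d + phi a c.
Proof.
move=> ab cd d1 c1 d2 c2 pos.
suff : phi a d - phi a c <= phi b d - phi b c by lra.
have cc : c <= c <= d by rewrite lexx.
have dd : c <= d <= d by rewrite lexx cd.
have E1 (f : R -> R -> R) t : f t d - f t c = 1 * f t d + (-1) * f t c by ring.
apply: (@rdR_nondecreasing _ (fun t => phi t d - phi t c)
  (fun t => phi1 t d - phi1 t c)) => // t tab.
- rewrite E1; apply: (rdR_ext (fun t => esym (E1 phi t))).
  by apply: rdR_lin; apply: d1.
- rewrite subr_ge0.
  apply: (@rdR_nondecreasing _ (phi1 t) (phi12 t)) => // s sab.
  + exact: d2.
  + exact: pos.
  + exact: c2.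
- apply: (lcR_ext (fun t => esym (E1 phi t))).
  by apply: lcR_lin; apply: c1.
Qed.

End RightDerivativesR.

Section RightDerivativesE.
Context {R : realType} {E : completeNormedModType R[i]}.
Implicit Types F G : R -> E.

Definition rdE F (t : R) (D : E) := forall e : R, 0 < e -> exists2 r : R, 0 < r &
  forall h, 0 < h < r -> nrm (F (t + h) - F t - h%:C *: D) <= e * h.

Definition lcE F (t : R) := forall e : R, 0 < e -> exists2 r : R, 0 < r &
  forall h, 0 < h < r -> nrm (F (t - h) - F t) < e.

(** This is [dini_le] for [t -> p (F t - F a) - g t]. Two choices of [p] matter: the norm, and a
    functional that is at most 0 exactly on the cone, which with [g = 0] gives positivity of
    increments. The latter is not symmetric, hence homogeneity for [0 <= c] only. *)
Lemma mean_value_sublinear (p : E -> R) (C : R) F (D : R -> E) (g g' : R -> R)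
    (a b : R) :
  (forall x y, p (x + y) <= p x + p y) ->
  (forall (c : R) x, 0 <= c -> p (c%:C *: x) = c * p x) ->
  (forall x, p x <= C * nrm x) -> a <= b ->
  (forall t, a <= t < b -> rdE F t (D t)) ->
  (forall t, a <= t < b -> rdR g t (g' t)) ->
  (forall t, a <= t < b -> p (D t) <= g' t) ->
  (forall t, a < t <= b -> lcE F t) ->
  (forall t, a < t <= b -> lcR g t) ->
  p (F b - F a) <= g b - g a.
Proof.
move=> pD pZ pC ab hd hg hK hl hlg.
pose C1 := Num.max C 1.
have C10 : 0 < C1 by rewrite lt_max ltr01 orbT.
have {}pC x : p x <= C1 * nrm x.
  by apply: le_trans (pC x) _; rewrite ler_wpM2r ?nrm_ge0 // le_max lexx.
have p00 : p 0 = 0 by have := pZ 0 0 (lexx _); rewrite scaler0 mul0r.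
suff : p (F b - F a) - g b <= p (F a - F a) - g a + 0 * (b - a).
  by rewrite subrr p00; lra.
apply: (@dini_le _ (fun t => p (F t - F a) - g t)) => // t tab e e0.
- have e20 : 0 < e / 2 by lra.
  have := hd t tab (e / 2 / C1) ltac:(by rewrite divr_gt0) => h1.
  have [r r0 hr] := right_germ_and h1 (hg t tab (e / 2) e20).
  exists r => // h hh; have [{}h1 hg1] := hr h hh.
  have h0 : 0 < h by case/andP: hh.
  have -> : F (t + h) - F a = (F t - F a) +
      (h%:C *: D t + (F (t + h) - F t - h%:C *: D t)).
    by rewrite (addrC (h%:C *: D t)) subrK [RHS]addrC addrA subrK.
  have := pD (F t - F a) (h%:C *: D t + (F (t + h) - F t - h%:C *: D t)).
  have := pD (h%:C *: D t) (F (t + h) - F t - h%:C *: D t).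
  rewrite (pZ _ _ (ltW h0)) => h2 h3.
  have h4 := pC (F (t + h) - F t - h%:C *: D t).
  have h5 : C1 * nrm (F (t + h) - F t - h%:C *: D t) <= e / 2 * h.
    have -> : e / 2 * h = C1 * (e / 2 / C1 * h) by field; rewrite gt_eqF.
    by rewrite ler_pM2l.
  have h6 : h * p (D t) <= h * g' t by rewrite ler_pM2l // hK.
  move: hg1; rewrite ler_norml => /andP[hg1 _].
  rewrite add0r; lra.
- have e20 : 0 < e / 2 by lra.
  have h1 := hl t tab (e / 2 / C1) ltac:(by rewrite divr_gt0).
  have [r r0 hr] := right_germ_and h1 (hlg t tab (e / 2) e20).
  exists r => // h hh; have [{}h1 hg1] := hr h hh.
  have := pD (F (t - h) - F a) (F t - F (t - h)); rewrite addrC addrA subrK => h2.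
  have h3 := pC (F t - F (t - h)).
  have h4 : C1 * nrm (F t - F (t - h)) <= e / 2.
    by rewrite mulrC -ler_pdivlMr // nrmB ltW.
  move: hg1; rewrite ltr_norml => /andP[_ hg1].
  lra.
Qed.

Lemma mean_value_nrm F (D : R -> E) (g g' : R -> R) (a b : R) : a <= b ->
  (forall t, a <= t < b -> rdE F t (D t)) ->
  (forall t, a <= t < b -> rdR g t (g' t)) ->
  (forall t, a <= t < b -> nrm (D t) <= g' t) ->
  (forall t, a < t <= b -> lcE F t) ->
  (forall t, a < t <= b -> lcR g t) ->
  nrm (F b - F a) <= g b - g a.
Proof.
apply: (mean_value_sublinear (C := 1)).
- exact: nrmD.
- by move=> c x c0; rewrite nrmZr ger0_norm.
- by move=> x; rewrite mul1r.
Qed.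

Lemma rdR_linear (K t : R) : rdR ( *%R K) t K.
Proof.
move=> e e0; exists 1 => // h /andP[h0 _].
by rewrite (_ : _ - _ = 0) ?normr0 ?mulr_ge0 ?ltW //; ring.
Qed.

Lemma lcR_linear (K t : R) : lcR ( *%R K) t.
Proof.
have m0 : 0 < `|K| + 1 by rewrite ltr_wpDl.
move=> e e0; exists (e / (`|K| + 1)) => [|h]; first by rewrite divr_gt0.
move=> /andP[h0]; rewrite ltr_pdivlMr // => h1.
rewrite -mulrBr addrAC subrr add0r mulrN normrN normrM (gtr0_norm h0).
lra.
Qed.

Lemma mean_value F (D : R -> E) (a b K : R) : a <= b ->
  (forall t, a <= t < b -> rdE F t (D t)) ->
  (forall t, a <= t < b -> nrm (D t) <= K) ->
  (forall t, a < t <= b -> lcE F t) ->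
  nrm (F b - F a) <= K * (b - a).
Proof.
move=> ab hd hK hl; rewrite mulrBr.
apply: (@mean_value_nrm F D _ (fun=> K)) => // t _; first exact: rdR_linear.
exact: lcR_linear.
Qed.

Lemma rdE_ext F G t D : F =1 G -> rdE F t D -> rdE G t D.
Proof. by move=> /funext ->. Qed.

Lemma lcE_ext F G t : F =1 G -> lcE F t -> lcE G t.
Proof. by move=> /funext ->. Qed.

Lemma rdE_comp (L : E -> E) (C : R) F t D :
  (forall x y, L (x + y) = L x + L y) -> (forall (c : R) x, L (c%:C *: x) = c%:C *: L x) ->
  (forall x, nrm (L x) <= C * nrm x) ->
  rdE F t D -> rdE (fun t => L (F t)) t (L D).
Proof.
move=> LD LZ LC hF e e0; pose m := `|C| + 1.
have m0 : 0 < m by rewrite ltr_wpDl.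
have Lm x : nrm (L x) <= m * nrm x.
  apply: le_trans (LC x) _; rewrite ler_wpM2r ?nrm_ge0 //.
  by apply: le_trans (ler_norm _) _; rewrite lerDl.
have LB x y : L (x - y) = L x - L y.
  by rewrite LD -scaleN1r -(rmorph1 (real_complex R)) -rmorphN LZ rmorphN rmorph1 scaleN1r.
have [r r0 hr] := hF (e / m) ltac:(by rewrite divr_gt0).
exists r => // h hh; rewrite -LZ -!LB; apply: le_trans (Lm _) _.
have -> : e * h = m * (e / m * h) by field; rewrite gt_eqF.
by rewrite ler_pM2l // hr.
Qed.

Lemma lcE_comp (L : E -> E) (C : R) F t :
  (forall x y, L (x - y) = L x - L y) ->
  (forall x, nrm (L x) <= C * nrm x) ->
  lcE F t -> lcE (fun t => L (F t)) t.
Proof.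
move=> LB LC hF e e0; pose m := `|C| + 1.
have m0 : 0 < m by rewrite ltr_wpDl.
have [r r0 hr] := hF (e / m) ltac:(by rewrite divr_gt0).
exists r => // h hh; rewrite -!LB; apply: le_lt_trans (LC _) _.
apply: (@le_lt_trans _ _ (m * nrm (F (t - h) - F t))).
  rewrite ler_wpM2r ?nrm_ge0 //.
  by apply: le_trans (ler_norm _) _; rewrite lerDl.
by rewrite mulrC -ltr_pdivlMr // hr.
Qed.

Lemma rdR_comp (L : E -> R) (C : R) F t D :
  (forall x y, L (x - y) = L x - L y) -> (forall (c : R) x, L (c%:C *: x) = c * L x) ->
  (forall x, `|L x| <= C * nrm x) ->
  rdE F t D -> rdR (fun t => L (F t)) t (L D).
Proof.
move=> LB LZ LC hF e e0; pose m := `|C| + 1.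
have m0 : 0 < m by rewrite ltr_wpDl.
have [r r0 hr] := hF (e / m) ltac:(by rewrite divr_gt0).
exists r => // h hh; rewrite -LZ -!LB; apply: le_trans (LC _) _.
apply: (@le_trans _ _ (m * nrm (F (t + h) - F t - h%:C *: D))).
  rewrite ler_wpM2r ?nrm_ge0 //.
  by apply: le_trans (ler_norm _) _; rewrite lerDl.
have -> : e * h = m * (e / m * h) by field; rewrite gt_eqF.
by rewrite ler_pM2l // hr.
Qed.

Lemma lcR_comp (L : E -> R) (C : R) F t :
  (forall x y, L (x - y) = L x - L y) -> (forall x, `|L x| <= C * nrm x) ->
  lcE F t -> lcR (fun t => L (F t)) t.
Proof.
move=> LB LC hF e e0; pose m := `|C| + 1.
have m0 : 0 < m by rewrite ltr_wpDl.
have [r r0 hr] := hF (e / m) ltac:(by rewrite divr_gt0).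
exists r => // h hh; rewrite -!LB; apply: le_lt_trans (LC _) _.
apply: (@le_lt_trans _ _ (m * nrm (F (t - h) - F t))).
  rewrite ler_wpM2r ?nrm_ge0 //.
  by apply: le_trans (ler_norm _) _; rewrite lerDl.
by rewrite mulrC -ltr_pdivlMr // hr.
Qed.

Lemma rdE_lin (c d : R[i]) F G t D1 D2 : rdE F t D1 -> rdE G t D2 ->
  rdE (fun t => c *: F t + d *: G t) t (c *: D1 + d *: D2).
Proof.
move=> h1 h2 e e0; pose m := normc c + normc d + 1.
have n0 (x : R[i]) : 0 <= normc x by have := normr_ge0 x; rewrite ler0c.
have m0 : 0 < m by rewrite ltr_wpDl // addr_ge0.
have em : 0 < e / m by rewrite divr_gt0.
have [r r0 hr] := right_germ_and (h1 _ em) (h2 _ em).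
exists r => // h hh; have [{}h1 {}h2] := hr h hh.
have -> : c *: F (t + h) + d *: G (t + h) - (c *: F t + d *: G t) -
    h%:C *: (c *: D1 + d *: D2)
  = c *: (F (t + h) - F t - h%:C *: D1) + d *: (G (t + h) - G t - h%:C *: D2).
  rewrite !scalerBr scalerDr !scalerA ![h%:C * _]mulrC.
  by rewrite !opprD [X in X + _ = _]addrACA [LHS]addrACA.
apply: le_trans (nrmD _ _) _; rewrite !nrmZ.
have h0 : 0 <= e / m * h by rewrite mulr_ge0 ?ltW //; case/andP: hh.
have -> : e * h = m * (e / m * h) by field; rewrite gt_eqF.
apply: (@le_trans _ _ (normc c * (e / m * h) + normc d * (e / m * h))).
  by rewrite lerD // ler_wpM2l.
by rewrite -mulrDl ler_wpM2r // /m lerDl.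
Qed.

Lemma lcE_lin (c d : R[i]) F G t : lcE F t -> lcE G t ->
  lcE (fun t => c *: F t + d *: G t) t.
Proof.
move=> h1 h2 e e0; pose m := normc c + normc d + 1.
have n0 (x : R[i]) : 0 <= normc x by have := normr_ge0 x; rewrite ler0c.
have m0 : 0 < m by rewrite ltr_wpDl // addr_ge0.
have em : 0 < e / m by rewrite divr_gt0.
have [r r0 hr] := right_germ_and (h1 _ em) (h2 _ em).
exists r => // h hh; have [{}h1 {}h2] := hr h hh.
have -> : c *: F (t - h) + d *: G (t - h) - (c *: F t + d *: G t)
  = c *: (F (t - h) - F t) + d *: (G (t - h) - G t).
  by rewrite !scalerBr opprD addrACA.
apply: le_lt_trans (nrmD _ _) _; rewrite !nrmZ.
have -> : e = m * (e / m) by field; rewrite gt_eqF.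
apply: (@le_lt_trans _ _ (normc c * (e / m) + normc d * (e / m))).
  by rewrite lerD // ler_wpM2l // ltW.
by rewrite -mulrDl ltr_pM2r // /m ltrDl.
Qed.

Lemma lcE_const x t : lcE (fun=> x) t.
Proof. by move=> e e0; exists 1 => // h _; rewrite subrr nrm0. Qed.

Lemma rdE_const x t : rdE (fun=> x) t 0.
Proof.
move=> e e0; exists 1 => // h /andP[h0 _].
by rewrite subrr scaler0 subr0 nrm0 mulr_ge0 // ltW.
Qed.

Lemma lcE_sum (I : Type) (r : seq I) (f : I -> R -> E) (t : R) :
  (forall i, lcE (f i) t) -> lcE (fun t => \sum_(i <- r) f i t) t.
Proof.
move=> h; elim: r => [|i r IH].
  by apply: lcE_ext (lcE_const 0 t) => s; rewrite big_nil.
have := lcE_lin 1 1 (h i) IH.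
by apply: lcE_ext => s; rewrite big_cons !scale1r.
Qed.

Lemma rdE_sum (I : Type) (r : seq I) (f : I -> R -> E) (t : R) (D : I -> E) :
  (forall i, rdE (f i) t (D i)) ->
  rdE (fun t => \sum_(i <- r) f i t) t (\sum_(i <- r) D i).
Proof.
move=> h; elim: r => [|i r IH].
  by rewrite big_nil; apply: rdE_ext (rdE_const 0 t) => s; rewrite big_nil.
rewrite big_cons; have := rdE_lin 1 1 (h i) IH; rewrite !scale1r.
by apply: rdE_ext => s; rewrite big_cons !scale1r.
Qed.

End RightDerivativesE.

(** * Primitives of continuous functions on the half-line *)

Section Primitives.
Context {R : realType} {E : completeNormedModType R[i]}.

Definition unif_cont (u : R -> E) := forall L e : R, 0 < e -> exists2 d : R, 0 < d &
  forall s t, 0 <= s <= L -> 0 <= t <= L -> `|s - t| < d -> nrm (u s - u t) <= e.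

Lemma rdE_scale (f : R -> R) t d (v : E) :
  rdR f t d -> rdE (fun t => (f t)%:C *: v) t (d%:C *: v).
Proof.
move=> hf e e0; pose m := nrm v + 1.
have m0 : 0 < m by rewrite ltr_wpDl ?nrm_ge0.
have [r r0 hr] := hf (e / m) ltac:(by rewrite divr_gt0).
exists r => // h hh; have {}hr := hr h hh.
rewrite scalerA -!scalerBl -!rmorphM -!rmorphB nrmZr.
have -> : e * h = (e / m * h) * m by field; rewrite gt_eqF.
by apply: ler_pM; rewrite ?nrm_ge0 // lerDl.
Qed.

Lemma lcE_scale (f : R -> R) t (v : E) :
  lcR f t -> lcE (fun t => (f t)%:C *: v) t.
Proof.
move=> hf e e0; pose m := nrm v + 1.
have m0 : 0 < m by rewrite ltr_wpDl ?nrm_ge0.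
have [r r0 hr] := hf (e / m) ltac:(by rewrite divr_gt0).
exists r => // h hh; have {}hr := hr h hh.
rewrite -scalerBl -rmorphB nrmZr.
apply: (@le_lt_trans _ _ (`|f (t - h) - f t| * m)).
  by rewrite ler_wpM2l // lerDl.
by rewrite -ltr_pdivlMr.
Qed.

Let ramp (a t : R) : R := Num.max (t - a) 0.

Let rdR_ramp a t : rdR (ramp a) t (a <= t)%R%:R.
Proof.
move=> e e0; have [ta|at_] := leP a t.
  exists 1 => // h /andP[h0 _]; rewrite /ramp !max_l; try lra.
  by rewrite (_ : _ - _ = 0) ?normr0 ?mulr_ge0 ?ltW //=; ring.
exists (a - t); first lra; move=> h /andP[h0 h1]; rewrite /ramp !max_r; try lra.
by rewrite mulr0 !subr0 normr0 mulr_ge0 // ltW.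
Qed.

Let lcR_ramp a t : lcR (ramp a) t.
Proof.
move=> e e0; exists e => // h /andP[h0 h1]; rewrite /ramp ltr_norml.
by case: (lerP (t - h - a) 0) => ?; case: (lerP (t - a) 0) => ?; apply/andP; split; lra.
Qed.

Lemma mean_value_eq0 (F G : R -> E) (u : R -> E) (a b : R) : 0 <= a -> a <= b ->
  (forall t, 0 <= t -> rdE F t (u t)) -> (forall t, 0 < t -> lcE F t) ->
  (forall t, 0 <= t -> rdE G t (u t)) -> (forall t, 0 < t -> lcE G t) ->
  F b - F a = G b - G a.
Proof.
move=> a0 ab F1 F2 G1 G2; apply/eqP; rewrite -subr_eq0; apply/eqP/nrm_le0_eq0 => e e0.
have := @mean_value _ _ (fun t => 1 *: F t + (-1) *: G t)
  (fun t => 1 *: u t + (-1) *: u t) a b 0 ab.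
rewrite mul0r => h; apply: le_trans (ltW e0); apply: le_trans (h _ _ _).
- by rewrite !scale1r !scaleN1r !opprD !opprK addrACA.
- move=> t tab; apply: rdE_lin; [apply: F1|apply: G1]; lra.
- by move=> t _; rewrite scale1r scaleN1r subrr nrm0.
- move=> t tab; apply: lcE_lin; [apply: F2|apply: G2]; lra.
Qed.

(* The step functions equal to [u (k / n)] on [k / n, (k + 1) / n[ have explicit
   primitives, which converge. *)
Lemma primitive (u : R -> E) : unif_cont u ->
  exists U : R -> E, [/\ U 0 = 0, forall t, 0 <= t -> rdE U t (u t) &
    forall t, 0 < t -> lcE U t].
Proof.
move=> uu.
(* [I n k] is the indicator of the [k]-th cell of a grid of mesh [1 / n.+1], and [J n k] is its
   primitive. The [n.+1 * n.+1] cells fill [[0, n.+1[], hence any bounded interval once [n] is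
   large. *)
pose g (n k : nat) : R := k%:R / n.+1%:R.
pose I n k t : R := 1 * (g n k <= t)%R%:R + (-1) * (g n k.+1 <= t)%R%:R.
pose J n k t : R := 1 * ramp (g n k) t + (-1) * ramp (g n k.+1) t.
pose V n t : E := \sum_(k < n.+1 * n.+1) (J n k t)%:C *: u (g n k).
pose W n t : E := \sum_(k < n.+1 * n.+1) (I n k t)%:C *: u (g n k).
have rdV n t : rdE (V n) t (W n t).
  by apply: rdE_sum => k; apply: rdE_scale; apply: rdR_lin; apply: rdR_ramp.
have lcV n t : lcE (V n) t.
  by apply: lcE_sum => k; apply: lcE_scale; apply: lcR_lin; apply: lcR_ramp.
have V0 n : V n 0 = 0.
  rewrite /V big1 // => k _; rewrite /J /ramp !sub0r !max_r ?oppr_le0 ?divr_ge0 //.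
  by rewrite !mulr0 addr0 scale0r.
have gS n k : g n k.+1 = g n k + n.+1%:R^-1.
  by rewrite /g -natr1 mulrDl mul1r.
have I01 n k t : 0 <= I n k t.
  rewrite /I gS; have : 0 < n.+1%:R^-1 :> R by rewrite invr_gt0.
  move: (n.+1%:R^-1) (g n k) => d x d0.
  by case: (lerP x t) => ?; case: (lerP (x + d) t) => ? /=; lra.
have sI n (t : R) : 0 <= t < n.+1%:R -> \sum_(k < n.+1 * n.+1) I n k t = 1.
  move=> /andP[t0 tn].
  rewrite -(big_mkord xpredT (fun k => I n k t)).
  rewrite (eq_bigr (fun k => - (g n k.+1 <= t)%R%:R - - (g n k <= t)%R%:R)); last first.
    by move=> k _; rewrite /I; ring.
  rewrite telescope_sumr // /g mul0r t0 natrM mulfK ?pnatr_eq0 //.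
  by rewrite leNgt tn /=; ring.
have gn e : 0 < e -> exists N, forall n, (N <= n)%N -> n.+1%:R^-1 < e :> R.
  move=> e0; exists (Num.bound e^-1) => n hn.
  rewrite -[e]invrK ltf_pV2 ?posrE ?invr_gt0 //.
  have := archi_boundP (ltW (x := 0) (y := e^-1) ltac:(by rewrite invr_gt0)).
  by move/lt_le_trans; apply; rewrite ler_nat leqW.
have WU L e : 0 < e -> exists N, forall n t, (N <= n)%N -> 0 <= t <= L ->
    nrm (W n t - u t) <= e.
  move=> e0; have [d d0 hd] := uu L e e0; have [N hN] := gn d d0.
  exists (maxn N (Num.bound `|L|)) => n t; rewrite geq_max => /andP[/hN Nn Ln] tL.
  have tn : 0 <= t < n.+1%:R.
    have h1 := archi_boundP (normr_ge0 L); have h2 := ler_norm L.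
    have : (Num.bound `|L|)%:R <= n.+1%:R :> R by rewrite ler_nat leqW.
    lra.
  have -> : W n t - u t = \sum_(k < n.+1 * n.+1) (I n k t)%:C *: (u (g n k) - u t).
    rewrite (eq_bigr (fun k : 'I_ _ => (I n k t)%:C *: u (g n k) - (I n k t)%:C *: u t)).
      by rewrite sumrB -scaler_suml -rmorph_sum sI // scale1r.
    by move=> k _; rewrite scalerBr.
  apply: le_trans (nrm_sum _ _ _) _.
  have -> : e = \sum_(k < n.+1 * n.+1) I n k t * e by rewrite -mulr_suml sI // mul1r.
  apply: ler_sum => k _; rewrite nrmZr ger0_norm //.
  have g0 : 0 <= g n k by rewrite divr_ge0.
  have := gS n k; have := I01 n k t; rewrite /I => I0 gSn.
  case: (lerP (g n k) t) I0 => h1; case: (lerP (g n k.+1) t) => h2 /= I0.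
  - by rewrite mulr1 mulr1 subrr !mul0r.
  - rewrite ler_wpM2l // hd //; first lra.
    move: gSn Nn; rewrite ltr_norml; move: (n.+1%:R^-1) => x gSn Nn.
    clear -gSn Nn h1 h2; apply/andP; split; lra.
  - lra.
  - by rewrite !mulr0 addr0 !mul0r.
(* The radius [d] does not depend on [n], so the expansion survives the limit from [V n] to [U]; in
   the form [key] it yields both the right derivative and the left continuity of [U]. *)
have main L e : 0 < e -> exists N d, 0 < d /\ forall n a b, (N <= n)%N ->
    0 <= a -> a <= b -> b <= L -> b - a < d ->
    nrm (V n b - V n a - (b - a)%:C *: u a) <= e * (b - a).
  move=> e0; have [N hN] := WU L (e / 2) ltac:(lra).
  have [d d0 hd] := uu L (e / 2) ltac:(lra).
  exists N, d; split => // n a b Nn a0 ab bL bad.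
  have := @mean_value _ _ (fun t => 1 *: V n t + (-1) *: (t%:C *: u a))
    (fun t => 1 *: W n t + (-1) *: (1%:C *: u a)) a b e ab.
  move=> h; apply: le_trans (h _ _ _).
  - by rewrite !scale1r !scaleN1r rmorphB scalerBl !opprD !opprK addrACA.
  - move=> t tab; apply: rdE_lin => //; apply: rdE_scale.
    move=> e1 e10; exists 1 => // k /andP[k0 _].
    by rewrite (_ : _ - _ = 0) ?normr0 ?mulr_ge0 ?ltW //; ring.
  - move=> t tab; rewrite !scale1r scaleN1r.
    apply: le_trans (nrmDB _ (u t) _) _.
    have := hN n t Nn ltac:(lra).
    have : nrm (u t - u a) <= e / 2.
      by apply: hd; rewrite ?ger0_norm //; lra.
    lra.
  - move=> t tab; apply: lcE_lin => //; apply: lcE_scale.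
    move=> e1 e10; exists e1 => // k /andP[k0 k1].
    by rewrite addrAC subrr add0r normrN gtr0_norm.
have cauV t : 0 <= t -> forall e, 0 < e -> exists N, forall m n, (N <= m)%N -> (N <= n)%N ->
     nrm (V m t - V n t) < e.
  move=> t0 e e0; pose e1 := e / (2 * t + 1).
  have t10 : 0 < 2 * t + 1 by lra.
  have e10 : 0 < e1 by rewrite divr_gt0.
  have [N hN] := WU t e1 e10; exists N => m n Nm Nn.
  have := @mean_value _ _ (fun t => 1 *: V m t + (-1) *: V n t)
    (fun t => 1 *: W m t + (-1) *: W n t) 0 t (2 * e1) t0.
  rewrite !V0 !scaler0 addr0 !subr0 !scale1r !scaleN1r => h.
  apply: le_lt_trans (h _ _ _) _.
  - by move=> s _; apply: rdE_lin.
  - move=> s st; rewrite scale1r scaleN1r; apply: le_trans (nrmDB _ (u s) _) _.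
    have := hN m s Nm ltac:(lra); have := hN n s Nn ltac:(lra).
    by rewrite (nrmB (u s)); lra.
  - by move=> s _; apply: lcE_lin.
  - have -> : e = e1 * (2 * t + 1) by rewrite /e1 divfK // gt_eqF.
    lra.
have /boolp.choice[U hU] : forall t, exists l, 0 <= t -> forall e : R, 0 < e ->
    exists N, forall n, (N <= n)%N -> nrm (V n t - l) < e.
  move=> t; have [t0|] := boolP (0 <= t); last by move=> _; exists 0.
  by have [l hl] := cauchy_nrm (cauV t t0); exists l.
have key L e : 0 < e -> exists2 d, 0 < d & forall a b,
    0 <= a -> a <= b -> b <= L -> b - a < d ->
    nrm (U b - U a - (b - a)%:C *: u a) <= e * (b - a).
  move=> /(main L)[N [d [d0 hd]]]; exists d => // a b a0 ab bL bad.
  apply/ler_addgt0Pr => e1 e10.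
  have [N1 h1] := hU a a0 (e1 / 2) ltac:(lra).
  have [N2 h2] := hU b ltac:(lra) (e1 / 2) ltac:(lra).
  pose n := maxn N (maxn N1 N2).
  have := hd n a b (leq_maxl _ _) a0 ab bL bad.
  have := h1 n ltac:(by rewrite /n maxnCA leq_maxl).
  have := h2 n ltac:(by rewrite /n maxnA leq_maxr).
  have := nrmBD (U b - U a - (b - a)%:C *: u a) (V n b - V n a - (b - a)%:C *: u a).
  have -> : U b - U a - (b - a)%:C *: u a - (V n b - V n a - (b - a)%:C *: u a) =
     (V n a - U a) - (V n b - U b).
    rewrite [- (_ - _%:C *: _)]opprB addrA subrK !opprB.
    by rewrite [LHS]addrACA [RHS]addrACA (addrC (V n a)).
  have := nrmD (V n a - U a) (- (V n b - U b)); rewrite nrmN; lra.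
exists U; split.
- apply: nrm_le0_eq0 => e e0; have [N hN] := hU 0 (lexx _) e e0.
  by have := hN N (leqnn _); rewrite V0 sub0r nrmN => /ltW.
- move=> t t0 e e0; have [d d0 hd] := key (t + 1) e e0.
  exists (Num.min d 1); first by rewrite lt_min d0 /=.
  move=> h /andP[h0]; rewrite lt_min => /andP[h1 h2].
  have := hd t (t + h) t0; rewrite addrAC subrr add0r; apply; lra.
- move=> t t0 e e0.
  have [d d0 hd] := key t 1 ltac:(lra).
  have [d1 d10 hd1] := uu t 1 ltac:(lra).
  pose m := nrm (u t) + 2 + 1.
  have m0 : 0 < m by have := nrm_ge0 (u t); rewrite /m; lra.
  exists (Num.min (Num.min d d1) (Num.min t (e / m))).
    by rewrite !lt_min d0 d10 t0 divr_gt0.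
  move=> h /andP[h0]; rewrite !lt_min => /andP[/andP[hd2 hd3] /andP[ht he]].
  have := hd (t - h) t; rewrite opprB addrCA subrr addr0 mul1r => /(_ _ _ _ _)h1.
  have {}h1 : nrm (U t - U (t - h) - h%:C *: u (t - h)) <= h by apply: h1; lra.
  have := hd1 (t - h) t; rewrite addrAC subrr add0r normrN gtr0_norm // => h2.
  have {}h2 : nrm (u (t - h) - u t) <= 1 by apply: h2; lra.
  have h3 := nrmBD (u (t - h)) (u t).
  have h4 := nrmBD (U t - U (t - h)) (h%:C *: u (t - h)).
  rewrite nrmZr gtr0_norm // in h4.
  have h5 : h * nrm (u (t - h)) <= h * (nrm (u t) + 1) by rewrite ler_pM2l //; lra.
  rewrite nrmB; rewrite ltr_pdivlMr // in he.
  rewrite /m in he; lra.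
Qed.

End Primitives.

(** * Semigroups and resolvents *)

Section ComplexExponential.
Context {R : realType}.
Implicit Types (l m : R[i]) (t s : R).

(* exp (- l t); the minus sign makes [twist l] correspond to the generator A - l. *)
Definition cexp l t : R[i] := (expR (- (complex.Re l * t)))%:C *
  (cos (complex.Im l * t) -i* sin (complex.Im l * t)).

Lemma cexp0 l : cexp l 0 = 1.
Proof.
rewrite /cexp !mulr0 oppr0 expR0 sin0 cos0; apply/eqP; rewrite eq_complex /=.
by apply/andP; split; apply/eqP; ring.
Qed.

Lemma cexpD l s t : cexp l (s + t) = cexp l s * cexp l t.
Proof.
rewrite /cexp !mulrDr opprD expRD cosD sinD.
by apply/eqP; rewrite eq_complex /=; apply/andP; split; apply/eqP; ring.
Qed.

Lemma cexpDl l m t : cexp (l + m) t = cexp l t * cexp m t.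
Proof.
case: l m => [a b] [c d]; rewrite /cexp /= !mulrDl opprD expRD cosD sinD.
by apply/eqP; rewrite eq_complex /=; apply/andP; split; apply/eqP; ring.
Qed.

Lemma cexpl0 t : cexp 0 t = 1.
Proof.
rewrite /cexp /= !mul0r oppr0 expR0 sin0 cos0; apply/eqP; rewrite eq_complex /=.
by apply/andP; split; apply/eqP; ring.
Qed.

Lemma cexp_real (a t : R) : cexp a%:C t = (expR (- (a * t)))%:C.
Proof.
rewrite /cexp /= mul0r sin0 cos0; apply/eqP; rewrite eq_complex /=.
by apply/andP; split; apply/eqP; ring.
Qed.

Lemma normc_cexp l t : normc (cexp l t) = expR (- (complex.Re l * t)).
Proof.
rewrite /cexp /=.
have -> : forall e c s : R, (e * c - 0 * - s) ^+ 2 + (e * - s + 0 * c) ^+ 2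
   = e ^+ 2 * (c ^+ 2 + s ^+ 2) by move=> *; ring.
by rewrite cos2Dsin2 mulr1 sqrtr_sqr ger0_norm // expR_ge0.
Qed.

Lemma normc_ReIm (z : R[i]) : normc z <= `|complex.Re z| + `|complex.Im z|.
Proof.
case: z => a b /=; rewrite -(ger0_norm (addr_ge0 (normr_ge0 a) (normr_ge0 b))).
rewrite -sqrtr_sqr ler_wsqrtr // sqrrD !real_normK ?num_real //.
by rewrite lerD2r lerDl mulrn_wge0 // mulr_ge0.
Qed.

Lemma cexp_rd l (e : R) : 0 < e -> exists2 r, 0 < r &
  forall h, 0 < h < r -> normc (cexp l h - 1 + h%:C * l) <= e * h.
Proof.
case: l => a b e0.
have h1 : rdR (fun t => expR (- (a * t)) * cos (b * t)) 0 (- a).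
  apply: is_derive_rdR; apply: is_derive_eq.
  by rewrite /GRing.scale /= !mulr0 oppr0 expR0 sin0 cos0; ring.
have h2 : rdR (fun t => expR (- (a * t)) * sin (b * t)) 0 b.
  apply: is_derive_rdR; apply: is_derive_eq.
  by rewrite /GRing.scale /= !mulr0 oppr0 expR0 sin0 cos0; ring.
have e20 : 0 < e / 2 by lra.
have [r r0 hr] := right_germ_and (h1 _ e20) (h2 _ e20).
exists r => // h /hr[]; rewrite !add0r !mulr0 oppr0 expR0 sin0 cos0 mulr0 mulr1 subr0.
move=> {}h1 {}h2.
apply: le_trans (normc_ReIm _) _ => /=.
set x := expR _ * cos _ in h1 *; set y := expR _ * sin _ in h2 *.
have -> : x - 0 * - sin (b * h) - 1 + (h * a - 0 * b) = x - 1 - h * - a by ring.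
have -> : expR (- (a * h)) * - sin (b * h) + 0 * cos (b * h) - 0 + (h * b + 0 * a)
   = - (y - h * b) by rewrite /y; ring.
rewrite normrN; lra.
Qed.

Lemma exp_small (K d e : R) : 0 < d -> 0 < e ->
  exists2 t, 0 <= t & K * expR (- (d * t)) <= e.
Proof.
move=> d0 e0; have k0 := normr_ge0 K; exists (`|K| / e / d).
  by rewrite !divr_ge0 // ltW.
have -> : d * (`|K| / e / d) = `|K| / e by field; rewrite !gt_eqF.
rewrite expRN -ler_pdivlMr ?invr_gt0 ?expR_gt0 // invrK.
apply: (@le_trans _ _ (e * (1 + `|K| / e))); last by rewrite ler_pM2l // expR_ge1Dx.
have -> : e * (1 + `|K| / e) = e + `|K| by field; rewrite gt_eqF.
by apply: le_trans (ler_norm _) _; rewrite lerDr ltW.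
Qed.

End ComplexExponential.

Section AbstractSemigroups.
Context {R : realType} {E : completeNormedModType R[i]}.
Implicit Types (Q : R -> E -> E) (S : E -> E).

(** Bare functions are used so that rescaling by an exponential stays within the notion. The local
    bound is a field because it is derived once, from uniform boundedness, and then transported to
    all the twists. *)
Record semigroup Q : Prop := Semigroup {
  sg_lin : forall t c x y, Q t (c *: x + y) = c *: Q t x + Q t y ;
  sg0 : forall x, Q 0 x = x ;
  sgD : forall s t x, 0 <= s -> 0 <= t -> Q (s + t) x = Q s (Q t x) ;
  sg_bd : forall L, exists2 M : R, 0 < M & forall t x, 0 <= t <= L ->
    nrm (Q t x) <= M * nrm x ;
  sg_cont : forall x (e : R), 0 < e -> exists2 d : R, 0 < d &
    forall h, 0 <= h < d -> nrm (Q h x - x) <= e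
}.

(* [S] inverts minus the generator of [Q]. *)
Definition inverts Q S : Prop :=
  [/\ forall c x y, S (c *: x + y) = c *: S x + S y,
      exists2 C : R, 0 <= C & forall x, nrm (S x) <= C * nrm x,
      forall y, rdE (Q^~ (S y)) 0 (- y) &
      forall x D, rdE (Q^~ x) 0 D -> S D = - x].

(** [inverts (twist l Q) S] says that [S = R(l, A)], where [A] generates [Q]; every statement about
    resolvents below has this form. *)
Definition twist (l : R[i]) Q : R -> E -> E := fun t x => cexp l t *: Q t x.

Lemma twist0 Q : twist 0 Q = Q.
Proof. by apply/funext => t; apply/funext => x; rewrite /twist cexpl0 scale1r. Qed.

Lemma twistD l m Q : twist l (twist m Q) = twist (l + m) Q.
Proof.
by apply/funext => t; apply/funext => x; rewrite /twist scalerA cexpDl.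
Qed.

Section Linearity.
Variable f : E -> E.
Hypothesis lf : forall c x y, f (c *: x + y) = c *: f x + f y.

Lemma lin0 : f 0 = 0.
Proof.
have := lf (-1) 0 0; rewrite scaler0 addr0 scaleN1r addNr => h; exact: h.
Qed.

Lemma linZ c x : f (c *: x) = c *: f x.
Proof. by have := lf c x 0; rewrite lin0 !addr0. Qed.

Lemma linD x y : f (x + y) = f x + f y.
Proof. by have := lf 1 x y; rewrite !scale1r. Qed.

Lemma linN x : f (- x) = - f x.
Proof. by rewrite -scaleN1r linZ scaleN1r. Qed.

Lemma linB x y : f (x - y) = f x - f y.
Proof. by rewrite linD linN. Qed.
End Linearity.

Section OneSemigroup.
Variables (Q : R -> E -> E) (sQ : semigroup Q).

Lemma sg_unif x : unif_cont (Q^~ x).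
Proof.
move=> L e e0; have [M M0 hM] := sg_bd sQ L.
have [d d0 hd] := sg_cont sQ x (e := e / M) ltac:(by rewrite divr_gt0).
exists d => // s t.
wlog st : s t / s <= t.
  move=> hw sL tL std; have [/hw->//|/ltW/hw h] := lerP s t.
  by rewrite nrmB h // distrC.
move=> sL tL; rewrite distrC ger0_norm ?subr_ge0 // => std.
have -> : Q t x = Q s (Q (t - s) x) by rewrite -sgD ?subrK; [congr (Q _ x); ring| |lra|lra].
rewrite nrmB -(linB (sg_lin sQ s)); apply: le_trans (hM _ _ sL) _.
by rewrite mulrC -ler_pdivlMr // hd //; lra.
Qed.

Lemma sg_lc x t : 0 < t -> lcE (Q^~ x) t.
Proof.
move=> t0 e e0; have [d d0 hd] := sg_unif x t (e := e / 2) ltac:(lra).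
exists (Num.min d t); first by rewrite lt_min d0.
move=> h /andP[h0]; rewrite lt_min => /andP[h1 h2].
apply: (@le_lt_trans _ _ (e / 2)); last lra.
apply: hd; try lra.
by rewrite addrAC subrr add0r normrN gtr0_norm.
Qed.

Lemma sg_rd x D t : 0 <= t -> rdE (Q^~ x) 0 D -> rdE (Q^~ x) t (Q t D).
Proof.
move=> t0 hx e e0; have [M M0 hM] := sg_bd sQ t.
have [r r0 hr] := hx (e / M) ltac:(by rewrite divr_gt0).
exists r => // h hh; have := hr h hh; rewrite add0r sg0 // => h1.
rewrite (sgD sQ) //; last by case/andP: hh => /ltW.
rewrite -(linZ (sg_lin sQ t)) -!(linB (sg_lin sQ t)).
apply: le_trans (hM _ _ _) _; first by rewrite t0 lexx.
have -> : e * h = M * (e / M * h) by field; rewrite gt_eqF.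
by rewrite ler_pM2l.
Qed.

Lemma normc_ge0 (z : R[i]) : 0 <= normc z.
Proof. by have := normr_ge0 z; rewrite ler0c. Qed.

Lemma normcMr (a : R) (z : R[i]) : normc (a%:C * z) = `|a| * normc z.
Proof. by rewrite ComplexField.Normc.normcM /= expr0n addr0 sqrtr_sqr. Qed.

Lemma twist_rd l x D : rdE (Q^~ x) 0 D -> rdE (twist l Q ^~ x) 0 (D - l *: x).
Proof.
move=> hx e e0; pose e1 := e / 3.
have e10 : 0 < e1 by rewrite /e1; lra.
pose n := nrm x + 1; have n0 : 0 < n by rewrite /n; have := nrm_ge0 x; lra.
pose m := normc l + 1; have m0 : 0 < m by rewrite /m; have := normc_ge0 l; lra.
pose k := nrm D + 1; have k0 : 0 < k by rewrite /k; have := nrm_ge0 D; lra.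
have [r1 r10 hr1] := right_germ_and (hx (e1 / 2) ltac:(lra))
   (cexp_rd l (e := e1 / n) ltac:(by rewrite divr_gt0)).
have [r2 r20 hr2] := cexp_rd l (e := 1) ltac:(lra).
exists (Num.min (Num.min r1 r2) (Num.min (e1 / m / k) m^-1)).
  by rewrite !lt_min r10 r20 !divr_gt0 // invr_gt0.
move=> h /andP[h0]; rewrite !lt_min => /andP[/andP[h1 h2] /andP[h3 h4]].
have [{}hr1 hr3] := hr1 h ltac:(lra); have {}hr2 := hr2 h ltac:(lra).
rewrite add0r sg0 // in hr1.
rewrite add0r {2}/twist sg0 // cexp0 scale1r /twist.
have hc1 : normc (cexp l h - 1) <= m * h.
  have -> : cexp l h - 1 = (cexp l h - 1 + h%:C * l) + - (h%:C * l) by ring.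
  apply: le_trans (le_normcD _ _) _.
  rewrite normcN normcMr gtr0_norm // /m; lra.
have hc2 : normc (cexp l h) <= 2.
  have -> : cexp l h = (cexp l h - 1) + 1 by ring.
  apply: le_trans (le_normcD _ _) _; rewrite ComplexField.Normc.normc1.
  have : m * h <= 1 by rewrite -(mulfV (x := m)) ?gt_eqF // ler_pM2l // ltW.
  lra.
(* Product rule with three errors: the expansion of the orbit, the variation of the exponential
   against [D], and the expansion of the exponential. Each is at most a third of [e * h]. *)
have -> : cexp l h *: Q h x - x - h%:C *: (D - l *: x) =
  cexp l h *: (Q h x - x - h%:C *: D) + ((h%:C * (cexp l h - 1)) *: D +
    (cexp l h - 1 + h%:C * l) *: x).
  rewrite !scalerBr !scalerDl !scalerA !scaleN1r mulrBr mulr1 scalerBl.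
  rewrite (mulrC h%:C (cexp l h)) opprB.
  set a := cexp l h *: Q h x; set b := (cexp l h * h%:C) *: D.
  set c := cexp l h *: x; set d := h%:C *: D; set f := (h%:C * l) *: x.
  rewrite [RHS]addrA (addrA (a - c - b)) subrK (addrAC a (- c)) !addrA subrK.
  by rewrite (addrAC _ (- d) (- x)) [RHS]addrAC.
apply: le_trans (nrmD _ _) _; rewrite nrmZ.
have := nrmD ((h%:C * (cexp l h - 1)) *: D) ((cexp l h - 1 + h%:C * l) *: x).
rewrite !nrmZ normcMr gtr0_norm // => g.
have g1 : normc (cexp l h) * nrm (Q h x - x - h%:C *: D) <= 2 * (e1 / 2 * h).
  by apply: ler_pM; rewrite ?normc_ge0 ?nrm_ge0.
have g2 : normc (cexp l h - 1 + h%:C * l) * nrm x <= e1 / n * h * n.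
  by apply: ler_pM; rewrite ?normc_ge0 ?nrm_ge0 // /n lerDl.
have {}g2 : normc (cexp l h - 1 + h%:C * l) * nrm x <= e1 * h.
  by apply: le_trans g2 _; rewrite mulrAC divfK // gt_eqF.
have g3 : h * normc (cexp l h - 1) * nrm D <= h * (m * h) * k.
  apply: ler_pM; rewrite ?nrm_ge0 //.
  - by rewrite mulr_ge0 ?normc_ge0 // ltW.
  - by rewrite ler_pM2l.
  - by rewrite /k lerDl.
have g4 : h * (m * h) * k <= h * e1.
  rewrite -mulrA ler_pM2l // mulrAC mulrC -ler_pdivlMr ?mulr_gt0 //.
  by rewrite invfM mulrA ltW.
rewrite /e1 in g1 g2 g3 g4; lra.
Qed.

Lemma twist_sg l : semigroup (twist l Q).
Proof.
split.
- by move=> t c x y; rewrite /twist sg_lin // scalerDr !scalerA mulrC.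
- by move=> x; rewrite /twist sg0 // cexp0 scale1r.
- move=> s t x s0 t0; rewrite /twist (sgD sQ) // (linZ (sg_lin sQ s)) scalerA.
  by rewrite cexpD.
- move=> L; have [M M0 hM] := sg_bd sQ L.
  exists (expR (`|complex.Re l| * `|L|) * M); first by rewrite mulr_gt0 // expR_gt0.
  move=> t x tL; rewrite /twist nrmZ normc_cexp -mulrA.
  apply: ler_pM; rewrite ?expR_ge0 ?nrm_ge0 ?hM // ler_expR.
  apply: le_trans (ler_norm _) _; rewrite normrN normrM ler_wpM2l //.
  by have := ler_norm L; rewrite ger0_norm; lra.
- move=> x e e0.
  pose n := nrm x + 1; have n0 : 0 < n by rewrite /n; have := nrm_ge0 x; lra.
  pose m := normc l + 1; have m0 : 0 < m by rewrite /m; have := normc_ge0 l; lra.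
  pose k := m + 1; have k0 : 0 < k by rewrite /k; lra.
  have [r1 r10 hr1] := cexp_rd l (e := 1) ltac:(lra).
  have [r2 r20 hr2] := sg_cont sQ x (e := e / 4) ltac:(lra).
  exists (Num.min (Num.min r1 r2) (Num.min (e / 2 / n / k) k^-1)).
    by rewrite !lt_min r10 r20 !divr_gt0 // invr_gt0.
  move=> h /andP[h0]; rewrite !lt_min => /andP[/andP[h1 h2] /andP[h3 h4]].
  have [->|hn0] := eqVneq h 0.
    by rewrite /twist sg0 // cexp0 scale1r subrr nrm0 ltW.
  have {}h0 : 0 < h by rewrite lt_neqAle eq_sym hn0.
  have hr3 := hr1 h ltac:(lra); have {}hr2 := hr2 h ltac:(lra).
  have hc1 : normc (cexp l h - 1) <= m * h.
    have -> : cexp l h - 1 = (cexp l h - 1 + h%:C * l) + - (h%:C * l) by ring.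
    apply: le_trans (le_normcD _ _) _.
    rewrite normcN normcMr gtr0_norm // /m; lra.
  have kh : k * h <= 1 by rewrite -(mulfV (x := k)) ?gt_eqF // ler_pM2l // ltW.
  have hc2 : normc (cexp l h) <= 2.
    have -> : cexp l h = (cexp l h - 1) + 1 by ring.
    apply: le_trans (le_normcD _ _) _; rewrite ComplexField.Normc.normc1 /k in kh *; lra.
  have -> : twist l Q h x - x = cexp l h *: (Q h x - x) + (cexp l h - 1) *: x.
    by rewrite scalerBr scalerBl scale1r addrA subrK.
  apply: le_trans (nrmD _ _) _; rewrite !nrmZ.
  have g1 : normc (cexp l h) * nrm (Q h x - x) <= 2 * (e / 4).
    by apply: ler_pM; rewrite ?normc_ge0 ?nrm_ge0.
  have g2 : normc (cexp l h - 1) * nrm x <= (m * h) * n.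
    by apply: ler_pM; rewrite ?normc_ge0 ?nrm_ge0 // /n lerDl.
  have g3 : (k * h) * n <= e / 2.
    by rewrite -ler_pdivlMr // mulrC -ler_pdivlMr // ltW.
  have g4 : (m * h) * n <= (k * h) * n.
    by rewrite ler_pM2r // ler_pM2r // /k; lra.
  lra.
Qed.

End OneSemigroup.
End AbstractSemigroups.

(** * Integrals of orbits and the Laplace transform *)

Section Integrals.
Context {R : realType} {E : completeNormedModType R[i]}.
Variables (Q : R -> E -> E) (sQ : semigroup Q).

(** [U y t] stands for the integral of [Q s y] over [[0, t]], which these conditions determine for
    [0 <= t]. *)
Definition integrals (U : E -> R -> E) := forall y, [/\ U y 0 = 0,
  forall t : R, 0 <= t -> rdE (U y) t (Q t y) & forall t, 0 < t -> lcE (U y) t].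

Lemma integrals_ex : exists U, integrals U.
Proof.
have /boolp.choice[U hU] : forall y, exists V : R -> E, [/\ V 0 = 0,
    forall t : R, 0 <= t -> rdE V t (Q t y) & forall t, 0 < t -> lcE V t].
  by move=> y; have [V hV] := primitive (sg_unif sQ y); exists V.
by exists U.
Qed.

Variables (U : E -> R -> E) (iU : integrals U).

Lemma integrals0 y : U y 0 = 0. Proof. by case: (iU y). Qed.

Lemma integrals_uniq y F t : F 0 = 0 -> 0 <= t ->
  (forall s, 0 <= s -> rdE F s (Q s y)) -> (forall s, 0 < s -> lcE F s) -> F t = U y t.
Proof.
move=> F0 t0 h1 h2; have [_ h3 h4] := iU y.
by have := mean_value_eq0 (lexx 0) t0 h1 h2 h3 h4; rewrite F0 integrals0 !subr0.
Qed.

Lemma rdE_shift F (h t : R) (D : E) : rdE F (t + h) D -> rdE (fun t => F (t + h)) t D.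
Proof.
move=> hF e e0; have [r r0 hr] := hF e e0; exists r => // k /hr.
by rewrite (addrAC t).
Qed.

Lemma lcE_shift (F : R -> E) (h t : R) : lcE F (t + h) -> lcE (fun t => F (t + h)) t.
Proof.
move=> hF e e0; have [r r0 hr] := hF e e0; exists r => // k /hr.
by rewrite (addrAC t).
Qed.

(** Both sides vanish at [t = 0] and have the right derivative [Q (t + h) y]. *)
Lemma integrals_shift y h t : 0 <= h -> 0 <= t -> Q h (U y t) = U y (t + h) - U y h.
Proof.
move=> h0 t0; have [U0 U1 U2] := iU y; have [M M0 hM] := sg_bd sQ h.
have hb x : nrm (Q h x) <= M * nrm x by rewrite hM // h0 lexx.
have l := sg_lin sQ h.
have := @mean_value_eq0 _ _ (fun t => Q h (U y t)) (fun t => U y (t + h))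
  (fun t => Q (t + h) y) 0 t (lexx _) t0.
rewrite U0 (lin0 l) subr0 add0r; apply=> s s0.
- rewrite addrC (sgD sQ) //; apply: (rdE_comp (linD l)) (U1 s s0); last exact: hb.
  by move=> c x; apply: linZ.
- by apply: (lcE_comp (linB l)) (U2 s s0); exact: hb.
- by apply: rdE_shift; apply: U1; apply: addr_ge0.
- by apply: lcE_shift; apply: U2; rewrite ltr_wpDr.
Qed.

(** The witness is the mean of the orbit of [x] over a short interval [[0, h]]. Applying [Q k]
    shifts the window, so the derivative at 0 is the difference quotient [(Q h x - x) / h]. *)
Lemma integrals_dense x (e : R) : 0 < e ->
  exists y D, rdE (Q^~ y) 0 D /\ nrm (y - x) <= e.
Proof.
move=> e0; have [U0 U1 U2] := iU x.
have := U1 0 (lexx _) e e0; rewrite sg0 // => -[r r0 hr].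
pose h := r / 2; have h0 : 0 < h by rewrite /h; lra.
exists ((h^-1)%:C *: U x h), ((h^-1)%:C *: (Q h x - Q 0 x)); split.
  have : rdE (fun t => 1 *: U x (t + h) + (-1) *: U x t) 0
      (1 *: Q h x + (-1) *: Q 0 x).
    apply: rdE_lin; last exact: U1.
    by apply: rdE_shift; rewrite add0r; apply: U1; apply: ltW.
  rewrite scale1r scaleN1r => /(rdE_comp (L := fun z => (h^-1)%:C *: z)) hh.
  have {}hh : rdE (fun t => (h^-1)%:C *: (1 *: U x (t + h) + (-1) *: U x t)) 0
    ((h^-1)%:C *: (Q h x - Q 0 x)).
    apply: (hh `|h^-1|).
    - by move=> u v; rewrite scalerDr.
    - by move=> c u; rewrite !scalerA mulrC.
    - by move=> u; rewrite nrmZr.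
  move=> e1 e10; have [s s0 hs] := hh e1 e10; exists s => // k /andP[k0 ks].
  have := hs k; rewrite k0 ks => /(_ isT).
  rewrite !add0r U0 scaler0 addr0 !scale1r scaleN1r sg0 //.
  rewrite (linZ (sg_lin sQ k)) integrals_shift //; try exact: ltW.
  by rewrite (sg0 sQ (_ *: _)) (addrC h).
have := hr h; rewrite add0r U0 subr0 => hh.
have -> : (h^-1)%:C *: U x h - x = (h^-1)%:C *: (U x h - h%:C *: x).
  by rewrite scalerBr scalerA -rmorphM mulVf ?gt_eqF // scale1r.
rewrite nrmZr gtr0_norm ?invr_gt0 // ler_pdivrMl // mulrC hh // h0 /h; lra.
Qed.

(** Laplace transform at 0: [U y t] converges to [S y] as [t] grows, and [C = M1 / d] is the
    integral of [M1 * expR (- (d * t))] over the half-line, so the tail is explicit. *)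
Lemma inverts_decay (M d : R) : 0 < d ->
  (forall t x, 0 <= t -> nrm (Q t x) <= M * expR (- (d * t)) * nrm x) ->
  exists S, inverts Q S.
Proof.
move=> d0 hM.
have M0 : 0 <= `|M| by [].
have {}hM (t : R) x : 0 <= t -> nrm (Q t x) <= `|M| * expR (- (d * t)) * nrm x.
  move=> t0; apply: le_trans (hM t x t0) _; rewrite ler_wpM2r ?nrm_ge0 //.
  by rewrite ler_wpM2r ?expR_ge0 ?ler_norm.
move: `|M| M0 hM => M1 M0 hM; pose C : R := M1 / d.
have C0 : 0 <= C by rewrite divr_ge0 // ltW.
have incr y (a b : R) : 0 <= a -> a <= b ->
    nrm (U y b - U y a) <= C * expR (- (d * a)) * nrm y.
  move=> a0 ab; have [U0 U1 U2] := iU y.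
  pose g (t : R) : R := - (C * nrm y) * expR (- (d * t)).
  have dg (t : R) : is_derive t 1 g (M1 * expR (- (d * t)) * nrm y).
    apply: is_derive_eq; rewrite /GRing.scale /= /C.
    by field; rewrite gt_eqF.
  apply: (@le_trans _ _ (g b - g a)).
    apply: (mean_value_nrm ab (D := Q^~ y)
      (g' := fun t => M1 * expR (- (d * t)) * nrm y)).
    - by move=> t tab; apply: U1; lra.
    - by move=> t tab; apply: is_derive_rdR.
    - by move=> t tab; apply: hM; lra.
    - by move=> t tab; apply: U2; lra.
    - by move=> t tab; apply: derivable_lcR; case: (dg t).
  rewrite /g; have : 0 <= C * nrm y * expR (- (d * b)).
    by apply: mulr_ge0; [apply: mulr_ge0 => //; apply: nrm_ge0|apply: expR_ge0].
  lra.
have /boolp.choice[S hS] : forall y, exists l, forall t : R, 0 <= t ->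
    nrm (U y t - l) <= C * expR (- (d * t)) * nrm y.
  move=> y.
  have [|l hl] := @cauchy_nrm _ _ (fun n => U y n%:R).
    move=> e e0.
    have [T T0 hT] := exp_small (C * nrm y) d0 (e := e / 3) ltac:(lra).
    exists (Num.bound T) => m n Nm Nn.
    have hk k : (Num.bound T <= k)%N -> nrm (U y k%:R - U y T) <= e / 3.
      move=> kk; apply: le_trans (incr y T _ T0 _) _.
        apply: le_trans (ltW (archi_boundP T0)) _; by rewrite ler_nat.
      by rewrite mulrAC.
    apply: le_lt_trans (nrmDB _ (U y T) _) _.
    have := hk m Nm; have := hk n Nn; rewrite (nrmB (U y T)); lra.
  exists l => t t0; apply/ler_addgt0Pr => e e0.
  have [N hN] := hl e e0; pose n := maxn N (Num.bound t).
  apply: le_trans (nrmDB _ (U y n%:R) _) _; apply: lerD.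
    rewrite nrmB; apply: incr => //; apply: le_trans (ltW (archi_boundP t0)) _.
    by rewrite ler_nat leq_maxr.
  by apply: ltW; apply: hN; rewrite leq_maxl.
(* A vector approached by [U y] at this exponential rate must be [S y]; this identifies [S] both for
   linearity and for the left inverse property. *)
have Su y z K : (forall t : R, 0 <= t -> nrm (U y t - z) <= K * expR (- (d * t))) -> S y = z.
  move=> hz; apply/eqP; rewrite -subr_eq0; apply/eqP/nrm_le0_eq0 => e e0.
  have [t t0 ht] := exp_small (C * nrm y + K) d0 e0.
  apply: le_trans (nrmDB _ (U y t) _) _; rewrite (nrmB (S y)).
  have := hS y t t0; have := hz t t0; lra.
exists S; split.
- move=> c x y; apply: (Su _ _ (C * (normc c * nrm x) + C * nrm y)) => t t0.
  have <- : c *: U x t + U y t = U (c *: x + y) t.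
    have [x0 x1 x2] := iU x; have [y0 y1 y2] := iU y.
    apply: (integrals_uniq (F := fun t => c *: U x t + U y t)) => //.
    - by rewrite x0 y0 scaler0 addr0.
    - move=> s s0; rewrite (sg_lin sQ).
      have := rdE_lin c 1 (x1 s s0) (y1 s s0); rewrite scale1r.
      by apply: rdE_ext => r; rewrite scale1r.
    - move=> s s0; have := lcE_lin c 1 (x2 s s0) (y2 s s0).
      by apply: lcE_ext => r; rewrite scale1r.
  rewrite opprD addrACA -scalerBr; apply: le_trans (nrmD _ _) _; rewrite nrmZ.
  have h1 : normc c * nrm (U x t - S x) <= normc c * (C * expR (- (d * t)) * nrm x).
    by rewrite ler_wpM2l ?normc_ge0 ?hS.
  have := hS y t t0; lra.
- exists C => // x; have := hS x 0 (lexx _).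
  by rewrite integrals0 sub0r nrmN mulr0 oppr0 expR0 mulr1.
- move=> y; have [U0 U1 U2] := iU y.
  have QS h : 0 <= h -> Q h (S y) = S y - U y h.
    move=> h0; have [L L0 hL] := sg_bd sQ h.
    apply/eqP; rewrite -subr_eq0; apply/eqP/nrm_le0_eq0 => e e0.
    have [t t0 ht] := exp_small (L * C * nrm y + C * nrm y) d0 e0.
    apply: le_trans (nrmDB _ (Q h (U y t)) _) _.
    rewrite -(linB (sg_lin sQ h)) integrals_shift // opprB addrA subrK.
    have := hL h (S y - U y t); rewrite h0 lexx => /(_ isT).
    rewrite (nrmB (S y)) => h1.
    have h2 : L * nrm (U y t - S y) <= L * (C * expR (- (d * t)) * nrm y).
      by rewrite ler_pM2l // hS.
    have h3 := hS y (t + h) ltac:(lra).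
    have h4 : C * expR (- (d * (t + h))) * nrm y <= C * expR (- (d * t)) * nrm y.
      rewrite ler_wpM2r ?nrm_ge0 // ler_wpM2l // ler_expR lerN2 ler_pM2l //.
      by rewrite lerDl.
    lra.
  move=> e e0; have [r r0 hr] := U1 0 (lexx _) e e0; exists r => // h hh.
  have := hr h hh; rewrite !add0r !sg0 // QS; last by case/andP: hh => /ltW.
  rewrite U0 subr0 => h1.
  rewrite (addrAC (S y)) subrr add0r scalerN opprK -nrmN opprD opprK.
  exact: h1.
- move=> x D hx; apply: (Su _ _ (M1 * nrm x)) => t t0.
  have -> : U D t = Q t x - x.
    symmetry; apply: (integrals_uniq (F := fun t => Q t x - x)) => //.
    - by rewrite sg0 // subrr.
    - move=> s s0; have := rdE_lin 1 (-1) (sg_rd sQ s0 hx) (rdE_const x s).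
      rewrite scale1r scaler0 addr0; apply: rdE_ext => r.
      by rewrite scale1r scaleN1r.
    - move=> s s0; have := lcE_lin 1 (-1) (sg_lc sQ x s0) (lcE_const x s).
      by apply: lcE_ext => r; rewrite scale1r scaleN1r.
  rewrite opprK subrK; have := hM t x t0; lra.
Qed.

End Integrals.

(** * Exponential growth and bounded orbits *)

Section GrowthBounds.
Context {R : realType} {E : completeNormedModType R[i]}.

Definition bounded_sg (Q : R -> E -> E) := exists M : R, forall t x, 0 <= t ->
  nrm (Q t x) <= M * nrm x.

Lemma nrm_twist_real (Q : R -> E -> E) (a t : R) x :
  nrm (twist a%:C Q t x) = expR (- (a * t)) * nrm (Q t x).
Proof. by rewrite /twist nrmZ normc_cexp. Qed.

Lemma bounded_twistP (Q : R -> E -> E) (w : R) : bounded_sg (twist w%:C Q) <->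
  exists M : R, forall t x, 0 <= t -> nrm (Q t x) <= M * expR (w * t) * nrm x.
Proof.
have e0 (t : R) : 0 < expR (w * t) by rewrite expR_gt0.
split=> -[M hM]; exists M => t x t0.
  have := hM t x t0; rewrite nrm_twist_real expRN => h.
  rewrite mulrAC -ler_pdivrMr // mulrC; exact: h.
rewrite nrm_twist_real expRN mulrC ler_pdivrMr // mulrAC; exact: hM.
Qed.

(** If [M >= 1] bounds the operators on [[0, 1]], the semigroup law bounds them at [t] by [M] to the
    power [truncn t + 1], hence by [M * expR (ln M * t)]. *)
Lemma growth_ex (Q : R -> E -> E) : semigroup Q ->
  exists w : R, bounded_sg (twist w%:C Q).
Proof.
move=> sQ; have [M0 M00 hM0] := sg_bd sQ 1.
pose M := Num.max M0 1.
have M1 : 1 <= M by rewrite le_max lexx orbT.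
have Mp : 0 < M by lra.
have hM t x : 0 <= t <= 1 -> nrm (Q t x) <= M * nrm x.
  move=> t1; apply: le_trans (hM0 t x t1) _.
  by rewrite ler_wpM2r ?nrm_ge0 // le_max lexx.
exists (ln M); apply/bounded_twistP; exists M => t x t0.
have hn n : forall t x, 0 <= t <= n%:R -> nrm (Q t x) <= M ^+ n * nrm x.
  elim: n => [|n IH] {t0}t {}x t0.
    have -> : t = 0 by apply/le_anti; rewrite andbC.
    by rewrite sg0 // expr0 mul1r.
  have [t1|t1] := lerP t 1.
    apply: le_trans (hM t x _) _; first by case/andP: t0 => ->.
    by rewrite ler_wpM2r ?nrm_ge0 // ler_eXnr.
  have -> : t = 1 + (t - 1) by ring.
  rewrite (sgD sQ); [|lra|lra].
  apply: le_trans (hM 1 _ _) _; first by rewrite ler01 lexx.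
  rewrite exprS -mulrA ler_pM2l //; apply: IH.
  move: t0; rewrite -natr1; lra.
have /andP[tr1 tr2] := Num.Theory.truncn_itv t0.
apply: le_trans (hn (Num.truncn t).+1 t x _) _; first by rewrite t0 ltW.
rewrite ler_wpM2r ?nrm_ge0 // exprS ler_pM2l //.
rewrite -{1}(lnK (x := M)) ?posrE // -expRM_natl ler_expR mulrC.
by rewrite ler_wpM2l // ln_ge0.
Qed.

Lemma uniform_boundedness_linear (I : Type) (f : I -> E -> E) :
  (forall i c x y, f i (c *: x + y) = c *: f i x + f i y) ->
  (forall i, exists C, forall x, nrm (f i x) <= C * nrm x) ->
  (forall x, exists C, forall i, nrm (f i x) <= C) ->
  exists2 C, 0 <= C & forall i x, nrm (f i x) <= C * nrm x.
Proof.
move=> lf bf pf; apply: (uniform_boundedness (p := fun i x => nrm (f i x))) => //.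
- by move=> i x y; rewrite (linD (lf i)) nrmD.
- by move=> i a x; rewrite (linZ (lf i)) nrmZr.
Qed.

Lemma bounded_orbits (Q : R -> E -> E) : semigroup Q ->
  (forall x, exists C, forall t : R, 0 <= t -> nrm (Q t x) <= C) -> bounded_sg Q.
Proof.
move=> sQ hx.
(* The index [t] runs over all reals and acts through its absolute value, which covers exactly the
   nonnegative times. *)
have [||x|C C0 hC] := @uniform_boundedness_linear R (fun t x => Q `|t| x).
- by move=> t c x y; rewrite sg_lin.
- move=> t; have [M _ hM] := sg_bd sQ `|t|.
  by exists M => x; rewrite hM // normr_ge0 lexx.
- by have [C hC] := hx x; exists C => t; apply: hC.
- by exists C => t x t0; have := hC t x; rewrite ger0_norm.
Qed.

End GrowthBounds.

(** * Generator, resolvent set and spectral bound *)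

Section Generators.
Context {R : realType} {E : completeNormedModType R[i]}.
Variables (T : R -> {linear E -> E}) (hT : C0_semigroup T).

Let Q (t : R) (x : E) := T t x.

Lemma continuous_nrm (f : {linear E -> E}) : continuous f <->
  exists2 C : R, 0 <= C & forall x, nrm (f x) <= C * nrm x.
Proof.
split=> [cf|[C C0 hC]].
  have /linear_boundedP[M [Mreal hM]] := continuous_linear_bounded 0 (cf 0).
  have [m Mm] : exists m : R, M = m%:C by exact/complex_realP.
  exists (`|m| + 1) => [|x]; first by rewrite addr_ge0.
  have := hM (`|m| + 1)%:C; rewrite Mm ltcR => /(_ _ x); rewrite !nrmE -rmorphM lecR.
  by apply; apply: le_lt_trans (ler_norm _) _; rewrite ltrDl.
apply: bounded_linear_continuous; apply/linear_boundedP.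
exists C%:C; split; first by apply/complex_realP; exists C.
move=> r Cr x; apply: (@le_trans _ _ (C%:C * `|x|)).
  by rewrite !nrmE -rmorphM lecR.
by rewrite ler_wpM2r // ltW.
Qed.

Lemma at_right0P (P : R -> Prop) : (\forall h \near 0^'+, P h) <->
  exists2 r : R, 0 < r & forall h, 0 < h < r -> P h.
Proof.
split=> [[r /= r0 hr]|[r r0 hr]].
  exists r => // h /andP[h0 h1]; apply: hr => //=.
  by rewrite /ball /= sub0r normrN gtr0_norm.
exists r => //= h; rewrite /ball /= sub0r normrN => h1 h0.
by apply: hr; rewrite h0 -[h]gtr0_norm.
Qed.

Lemma C0_strong_nrm x (e : R) : 0 < e -> exists2 d : R, 0 < d &
  forall h, 0 <= h < d -> nrm (T h x - x) <= e.
Proof.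
move=> e0; have := C0_strong hT (x := x) => /cvgrPdist_le/(_ e%:C).
rewrite ltcR => /(_ e0)/at_right0P[r r0 hr]; exists r => // h /andP[h0 h1].
have [->|hn0] := eqVneq h 0; first by rewrite (C0_zero hT) subrr nrm0 ltW.
have := hr h; rewrite lt_neqAle eq_sym hn0 h0 h1 => /(_ isT).
by rewrite nrmE lecR nrmB.
Qed.

(** Otherwise some operators [T t_n] with [t_n <= 1 / n.+1] have norm above [n.+1], although every
    [T t_n x] tends to [x]; this contradicts uniform boundedness. *)
Lemma C0_locally_bounded : exists d M : R, [/\ 0 < d, 1 <= M &
  forall t x, 0 <= t <= d -> nrm (T t x) <= M * nrm x].
Proof.
apply: contrapT => nb.
have /boolp.choice[tx htx] : forall n : nat, exists tx : R * E,
    0 <= tx.1 <= n.+1%:R^-1 /\ n.+1%:R * nrm tx.2 < nrm (T tx.1 tx.2).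
  move=> n; apply: contrapT => hn; apply: nb; exists n.+1%:R^-1, n.+1%:R.
  rewrite invr_gt0 ltr0n ler1n; split => // t x tn; rewrite leNgt; apply/negP => h.
  by apply: hn; exists (t, x).
have [||x|C C0 hC] := @uniform_boundedness_linear _ _ nat (fun n x => T (tx n).1 x).
- by move=> n c x y; rewrite linearP.
- move=> n; have [/andP[t0 _] _] := htx n.
  have /continuous_nrm[C _ hC] := C0_bounded hT t0.
  by exists C.
- have [d d0 hd] := C0_strong_nrm x ltr01.
  pose N := Num.bound d^-1.
  (* The sum covers the finitely many early [n], for which [t_n] may not yet be below [d]. *)
  exists (\sum_(i < N) nrm (T (tx i).1 x) + (nrm x + 1)) => n.
  have S0 : 0 <= \sum_(i < N) nrm (T (tx i).1 x).
    by apply: sumr_ge0 => i _; apply: nrm_ge0.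
  have := nrm_ge0 x; have [nN|nN] := ltnP n N.
    rewrite (bigD1 (Ordinal nN)) //=.
    have : 0 <= \sum_(i < N | i != Ordinal nN) nrm (T (tx i).1 x).
      by apply: sumr_ge0 => i _; apply: nrm_ge0.
    lra.
  have [/andP[t0 tn] _] := htx n.
  have := hd (tx n).1; rewrite t0 /= => h.
  have {}h : nrm (T (tx n).1 x - x) <= 1.
    apply: h; apply: le_lt_trans tn _.
    rewrite -[d]invrK ltf_pV2 ?posrE ?invr_gt0 //.
    have := archi_boundP (ltW (x := 0) (y := d^-1) ltac:(by rewrite invr_gt0)).
    by move/lt_le_trans; apply; rewrite ler_nat leqW.
  have := nrmBD (T (tx n).1 x) x; lra.
- have [_ h] := htx (Num.bound C).
  have := lt_le_trans h (hC _ _); rewrite ltNge ler_wpM2r ?nrm_ge0 //.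
  apply: le_trans (ltW (archi_boundP C0)) _; by rewrite ler_nat.
Qed.

Lemma C0_sg : semigroup Q.
Proof.
split.
- by move=> t c x y; rewrite /Q linearP.
- by move=> x; exact: (C0_zero hT).
- by move=> s t x s0 t0; exact: (C0_add hT).
- move=> L; have [d [M [d0 M1 hM]]] := C0_locally_bounded.
  have Mp : 0 < M by lra.
  have hn n : forall t x, 0 <= t <= n%:R * d -> nrm (T t x) <= M ^+ n * nrm x.
    elim: n => [|n IH] t x t0.
      have -> : t = 0.
        by move: t0; rewrite mulr0n mul0r => /andP[h1 h2]; apply/le_anti; rewrite h1 h2.
      by rewrite (C0_zero hT) expr0 mul1r.
    have [t1|t1] := lerP t d.
      apply: le_trans (hM t x _) _; first by case/andP: t0 => ->.
      by rewrite ler_wpM2r ?nrm_ge0 // ler_eXnr.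
    have -> : t = d + (t - d) by ring.
    rewrite (C0_add hT); [|lra|lra].
    apply: le_trans (hM d _ _) _; first by rewrite ltW //= lexx.
    rewrite exprS -mulrA ler_pM2l //; apply: IH.
    move: t0; rewrite -natr1; lra.
  pose n := Num.bound (`|L| / d); exists (M ^+ n) => [|t x tL]; first exact: exprn_gt0.
  apply: hn; have := archi_boundP (x := `|L| / d) ltac:(by rewrite divr_ge0 // ltW).
  rewrite -/n ltr_pdivrMr // => h; have := ler_norm L; lra.
- exact: C0_strong_nrm.
Qed.

Lemma generator_dom x : op_dom (generator T) x ->
  rdE (Q^~ x) 0 (op_fun (generator T) x).
Proof.
rewrite /= => /cvgrPdist_le h e e0; have := h e%:C; rewrite ltcR => /(_ e0).
move=> /at_right0P[r r0 hr]; exists r => // k hk; have := hr k hk.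
have k0 : 0 < k by case/andP: hk.
set D := lim _; rewrite /diff_quotient nrmE lecR add0r /Q (C0_zero hT) => hh.
have -> : T k x - x - k%:C *: D = (- k%:C) *: (D - (k^-1)%:C *: (T k x - x)).
  move: (T k x - x) => v; rewrite scalerBr !scaleNr opprK scalerA -rmorphM divff ?gt_eqF // scale1r.
  by rewrite addrC.
by rewrite -rmorphN nrmZr normrN gtr0_norm // mulrC ler_pM2r.
Qed.

Lemma generator_rd x D : rdE (Q^~ x) 0 D ->
  op_dom (generator T) x /\ op_fun (generator T) x = D.
Proof.
move=> h; suff c : diff_quotient T x h @[h --> 0^'+] --> D.
  split; first by apply/cvg_ex; exists D.
  by apply: cvg_lim.
apply/cvgrPdist_le => _ /posC_gt0[e -> e0].
have [r r0 hr] := h e e0; apply/at_right0P; exists r => // k hk.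
have k0 : 0 < k by case/andP: hk.
have := hr k hk; rewrite /diff_quotient nrmE lecR add0r /Q (C0_zero hT) => hh.
have -> : D - (k^-1)%:C *: (T k x - x) = (- k^-1)%:C *: (T k x - x - k%:C *: D).
  move: (T k x - x) => v; rewrite scalerBr scalerA -rmorphM mulNr mulVf ?gt_eqF // !rmorphN rmorph1.
  by rewrite scaleN1r opprK scaleNr addrC.
by rewrite nrmZr normrN gtr0_norm ?invr_gt0 // ler_pdivrMl // mulrC.
Qed.

(** [l - A] is minus the generator of [twist l Q], and twisting back by [- l] recovers the generator
    of [Q]. *)
Lemma resolvent_setP l : resolvent_set (generator T) l <->
  exists S, inverts (twist l Q) S.
Proof.
have sQ := C0_sg.
have untw x D : rdE (twist l Q ^~ x) 0 D -> rdE (Q^~ x) 0 (D + l *: x).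
  move=> /(twist_rd (twist_sg sQ l) (- l)); rewrite twistD addNr twist0.
  by rewrite scaleNr opprK.
split=> [[S [cS h1 h2]]|[S [lS bS h1 h2]]].
  exists S; split.
  - by move=> c x y; rewrite linearP.
  - exact/continuous_nrm.
  - move=> y; have [d1 d2] := h1 y.
    have := twist_rd sQ l (generator_dom d1).
    by rewrite -opprB d2.
  - move=> x D /untw/generator_rd[d1 d2]; have := h2 x d1; rewrite d2.
    by rewrite opprD addrCA subrr addr0 linearN => <-; rewrite opprK.
pose S' := HB.pack_for {linear E -> E} S (GRing.isLinear.Build _ _ _ _ S lS).
exists S'; split.
- exact/continuous_nrm.
- move=> y; have [d1 d2] := generator_rd (untw _ _ (h1 y)).
  by split => //; rewrite d2 opprD opprK addrCA subrr addr0.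
- move=> x /generator_dom/(twist_rd sQ l)/h2 h.
  rewrite -opprB [LHS](linN lS) h opprK //.
Qed.

Lemma spectral_bound_le_growth_bound :
  (spectral_bound (generator T) <= growth_bound T)%E.
Proof.
have sQ := C0_sg.
apply: ge_ereal_sup => _ [l sl <-]; apply: le_ereal_inf_tmp => _ [w [M hM] <-].
rewrite lee_fin leNgt; apply/negP => wl; apply: sl; apply/resolvent_setP.
have [U iU] := integrals_ex (twist_sg sQ l).
apply: (inverts_decay (twist_sg sQ l) iU (M := M) (d := complex.Re l - w)).
  by rewrite subr_gt0.
move=> t x t0; have := hM t x t0; rewrite !nrmE -rmorphM lecR => h.
rewrite /twist nrmZ normc_cexp mulrBl opprB expRD.
have -> : M * (expR (w * t) * expR (- (complex.Re l * t))) * nrm x =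
  expR (- (complex.Re l * t)) * (M * expR (w * t) * nrm x) by ring.
by rewrite ler_wpM2l ?expR_ge0.
Qed.

Lemma growth_bound_le_bounded w : bounded_sg (twist w%:C Q) ->
  (growth_bound T <= w%:E)%E.
Proof.
move=> /bounded_twistP[M hM]; apply: ereal_inf_lbound; exists w => //.
by exists M => t x t0; rewrite !nrmE -rmorphM lecR hM.
Qed.

Lemma growth_bound_le_spectral_bound :
  (forall v m : R, v < m ->
     (forall l, v <= complex.Re l -> exists S, inverts (twist l Q) S) ->
     bounded_sg (twist m%:C Q)) ->
  (growth_bound T <= spectral_bound (generator T))%E.
Proof.
move=> h.
have {}h m : (spectral_bound (generator T) < m%:E)%E -> (growth_bound T <= m%:E)%E.
  move=> sm; apply: growth_bound_le_bounded.
  have [v [sv vm]] : exists v, (spectral_bound (generator T) <= v%:E)%E /\ v < m.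
    case: (spectral_bound _) sm => [r||] //=.
      by rewrite lte_fin => rm; exists r; rewrite lexx.
    by move=> _; exists (m - 1); rewrite leNye; split => //; rewrite ltrBlDr ltrDl.
  (* A spectral bound at most [v] puts only the open half-plane [Re l > v] in the resolvent set;
     moving to the midpoint gives a closed half-plane and still leaves a gap below [m]. *)
  apply: (h ((v + m) / 2)); first lra.
  move=> l vl; apply/resolvent_setP; apply: contrapT => sl.
  have : ((complex.Re l)%:E <= spectral_bound (generator T))%E.
    by apply: ereal_sup_ubound; exists l.
  move=> /le_trans/(_ sv); rewrite lee_fin; lra.
case: (spectral_bound (generator T)) h => [r||] h.
- apply/lee_addgt0Pr => e e0; rewrite -EFinD; apply: h; rewrite lte_fin; lra.
- by rewrite leey.
- case: (growth_bound T) h => [g||] h //.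
    by have := h (g - 1) (ltNyr _); rewrite lee_fin lerBrDr gerDl ler10.
  by have := h 0 (ltNyr _).
Qed.

End Generators.

(** * Complex Banach lattices *)

Section BanachLattices.
Context {R : realType} {B : banachLatticeType R}.
Implicit Types (x y z u v : B) (a c : R).

Lemma ble_add x y u v : x <=_B y -> u <=_B v -> (x + u) <=_B (y + v).
Proof.
move=> xy uv; apply: (@blat_le_trans _ _ (y + u)); first exact: blat_leD2r.
by rewrite ![y + _]addrC; exact: blat_leD2r.
Qed.

Lemma ble_subr x y : (0 <=_B (y - x)) = (x <=_B y).
Proof.
apply/idP/idP => h; first by have := blat_leD2r x _ _ h; rewrite add0r subrK.
by have := blat_leD2r (- x) _ _ h; rewrite subrr.
Qed.

Lemma ble_opp x y : x <=_B y -> (- y) <=_B (- x).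
Proof. by move=> h; rewrite -ble_subr opprK addrC ble_subr. Qed.

Lemma ble_scale a x y : 0 <= a -> x <=_B y -> (a *: x) <=_B (a *: y).
Proof. by move=> a0 h; rewrite -ble_subr -scalerBr blat_scale_ge0 // ble_subr. Qed.

Lemma ble_sup1 x y : x <=_B (blat_sup x y).
Proof. by have := blat_le_refl (blat_sup x y); rewrite blat_supP => /andP[]. Qed.

Lemma ble_sup2 x y : y <=_B (blat_sup x y).
Proof. by have := blat_le_refl (blat_sup x y); rewrite blat_supP => /andP[]. Qed.

Lemma babs_ge0 x : 0 <=_B (blat_sup x (- x)).
Proof.
set s := blat_sup _ _.
have : 0 <=_B (s + s) by rewrite -(subrr x) ble_add // ?ble_sup1 ?ble_sup2.
have -> : s + s = (2 : R) *: s by rewrite scaler_nat mulr2n.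
move=> h; have := blat_scale_ge0 2^-1 _ _ h; rewrite invr_ge0 ler0n => /(_ isT).
by rewrite scalerA mulVf ?pnatr_eq0 // scale1r.
Qed.

Lemma bnorm_le x y : x <=_B y -> (- x) <=_B y -> `|x| <= `|y|.
Proof.
move=> h1 h2; apply: blat_norm_le; apply: (@blat_le_trans _ _ y); last exact: ble_sup1.
by rewrite blat_supP h1.
Qed.

Lemma bnorm_mono x y : 0 <=_B x -> x <=_B y -> `|x| <= `|y|.
Proof.
move=> x0 xy; apply: bnorm_le => //; apply: (@blat_le_trans _ _ x) => //.
by apply: (@blat_le_trans _ _ 0) => //; have := ble_opp x0; rewrite oppr0.
Qed.

Definition bneg x := blat_sup (- x) 0.
Definition bpos x := blat_sup x 0.

Lemma bneg_ge0 x : 0 <=_B (bneg x). Proof. exact: ble_sup2. Qed.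

Lemma bnegD x y : (bneg (x + y)) <=_B (bneg x + bneg y).
Proof.
rewrite blat_supP opprD ble_add ?ble_sup1 //=.
by rewrite -[0]addr0 ble_add ?bneg_ge0.
Qed.

Lemma bnegZ a x : 0 <= a -> bneg (a *: x) = a *: bneg x.
Proof.
have le b y : 0 <= b -> (bneg (b *: y)) <=_B (b *: bneg y).
  move=> b0; rewrite blat_supP blat_scale_ge0 ?bneg_ge0 // andbT.
  by rewrite -scalerN ble_scale ?ble_sup1.
rewrite le_eqVlt => /predU1P[<-|a0].
  rewrite !scale0r; apply: blat_le_anti; rewrite bneg_ge0 andbT.
  by rewrite blat_supP oppr0 blat_le_refl.
apply: blat_le_anti; rewrite le ?ltW //=.
have := le a^-1 (a *: x); rewrite invr_ge0 ltW // => /(_ isT).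
rewrite scalerA mulVf ?gt_eqF // scale1r => /(ble_scale (ltW a0)).
by rewrite scalerA mulfV ?gt_eqF // scale1r.
Qed.

Lemma norm_bneg x : `|bneg x| <= `|x|.
Proof.
apply: blat_norm_le; rewrite blat_supP; apply/andP; split.
  by rewrite blat_supP ble_sup2 babs_ge0.
apply: (@blat_le_trans _ _ 0); last exact: babs_ge0.
by have := ble_opp (bneg_ge0 x); rewrite oppr0.
Qed.

Lemma bneg_eq0 x : bneg x = 0 <-> 0 <=_B x.
Proof.
split=> [h|h]; first by have := ble_opp (ble_sup1 (- x) 0); rewrite -/(bneg x) h opprK oppr0.
apply: blat_le_anti; rewrite bneg_ge0 andbT blat_supP blat_le_refl andbT.
by have := ble_opp h; rewrite oppr0.
Qed.

Lemma bpos_neg x : x = bpos x - bneg x.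
Proof.
apply/eqP; rewrite eq_sym subr_eq; apply/eqP; apply: blat_le_anti; apply/andP; split.
  rewrite blat_supP; apply/andP; split.
    by have := ble_add (blat_le_refl x) (bneg_ge0 x); rewrite addr0.
  by have := ble_add (blat_le_refl x) (ble_sup1 (- x) 0); rewrite subrr.
have := ble_add (blat_le_refl (- x)) (ble_sup2 x 0); rewrite addr0 => h1.
have h2 := ble_add (blat_le_refl (- x)) (ble_sup1 x 0); rewrite addNr in h2.
have : (bneg x) <=_B (- x + bpos x) by rewrite blat_supP h1.
by move=> /(ble_add (blat_le_refl x)); rewrite addrA subrr add0r.
Qed.

End BanachLattices.

(** * Norm and positive cone of a complexification *)

Section Complexifications.
Context {R : realType} {B : banachLatticeType R} {E : completeNormedModType R[i]}.
Variables (iota : B -> E) (hc : complexification iota).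
Local Notation cone := (positive_cone iota).

Lemma ciota0 : iota 0 = 0.
Proof.
have := cplx_linear hc (-1) 0 0; rewrite scaler0 addr0 rmorphN rmorph1 scaleN1r.
by rewrite addNr.
Qed.

Lemma ciotaZ (a : R) x : iota (a *: x) = a%:C *: iota x.
Proof. by have := cplx_linear hc a x 0; rewrite ciota0 !addr0. Qed.

Lemma ciotaD x y : iota (x + y) = iota x + iota y.
Proof. by have := cplx_linear hc 1 x y; rewrite rmorph1 !scale1r. Qed.

Lemma ciotaN x : iota (- x) = - iota x.
Proof. by rewrite -scaleN1r ciotaZ rmorphN rmorph1 scaleN1r. Qed.

Lemma ciotaB x y : iota (x - y) = iota x - iota y.
Proof. by rewrite ciotaD ciotaN. Qed.

(** The modulus of [x + i 0] is [blat_sup x (- x)]: each [cos t *: x] is a convex combination of [x]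
    and [- x], with weights [(1 + cos t) / 2] and [(1 - cos t) / 2]. *)
Lemma nrm_iota x : nrm (iota x) = `|x|.
Proof.
have [m [m1 m2]] := cplx_norm hc x 0.
rewrite ciota0 scaler0 addr0 nrmE => -[->].
have xm : x <=_B m by have := m1 0; rewrite cos0 sin0 scale1r scale0r addr0.
have nxm : (- x) <=_B m by have := m1 pi; rewrite cospi sinpi scaleN1r scale0r addr0.
have mx : m <=_B (blat_sup x (- x)).
  apply: m2 => t; rewrite scaler0 addr0.
  have -> : cos t *: x = ((1 + cos t) / 2) *: x + ((1 - cos t) / 2) *: (- x).
    by rewrite scalerN -scalerBl; congr (_ *: _); field.
  have -> : blat_sup x (- x) = ((1 + cos t) / 2) *: blat_sup x (- x) +
      ((1 - cos t) / 2) *: blat_sup x (- x).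
    by rewrite -scalerDl (_ : _ + _ = 1) ?scale1r //; field.
  have := cos_geN1 t; have := cos_le1 t => h1 h2.
  by apply: ble_add; apply: ble_scale; rewrite ?ble_sup1 ?ble_sup2 //; lra.
apply/le_anti/andP; split; last exact: bnorm_le.
apply: blat_norm_le; rewrite blat_supP mx /=.
apply: (@blat_le_trans _ _ 0); last exact: babs_ge0.
have : 0 <=_B m by have := babs_ge0 x; move/blat_le_trans; apply; rewrite blat_supP xm.
by move=> /ble_opp; rewrite oppr0.
Qed.

Lemma iota_inj x y : iota x = iota y -> x = y.
Proof.
move=> xy; apply/eqP; rewrite -subr_eq0 -normr_eq0 -nrm_iota ciotaB xy subrr.
by rewrite nrm0.
Qed.

Lemma cplx_parts : exists re im : E -> B,
  [/\ forall z, z = iota (re z) + 'i%C *: iota (im z),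
      forall x y, re (iota x + 'i%C *: iota y) = x &
      forall x y, im (iota x + 'i%C *: iota y) = y].
Proof.
have [g g1 g2] := cplx_bij hc.
exists (fun z => (g z).1), (fun z => (g z).2); split.
- by move=> z; have := g2 z => /= ->.
- by move=> x y; rewrite (g1 (x, y)).
- by move=> x y; rewrite (g1 (x, y)).
Qed.

Lemma nrm_re_le x y : `|x| <= nrm (iota x + 'i%C *: iota y).
Proof.
have [m [m1 m2]] := cplx_norm hc x y; rewrite nrmE => -[->].
apply: bnorm_le.
  by have := m1 0; rewrite cos0 sin0 scale1r scale0r addr0.
by have := m1 pi; rewrite cospi sinpi scaleN1r scale0r addr0.
Qed.

Lemma nrm_im_le x y : `|y| <= nrm (iota x + 'i%C *: iota y).
Proof.
have [m [m1 m2]] := cplx_norm hc x y; rewrite nrmE => -[->].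
apply: bnorm_le.
  by have := m1 (pi / 2); rewrite cos_pihalf sin_pihalf scale1r scale0r add0r.
by have := m1 (- (pi / 2)); rewrite cosN sinN cos_pihalf sin_pihalf scaleN1r scale0r add0r.
Qed.

Lemma cone0 : cone 0.
Proof. by exists 0; rewrite ?ciota0 //=; exact: blat_le_refl. Qed.

Lemma coneD x y : cone x -> cone y -> cone (x + y).
Proof.
move=> [f /= f0 <-] [g /= g0 <-]; exists (f + g); last by rewrite ciotaD.
by rewrite /= -[0]addr0 ble_add.
Qed.

Lemma coneZ (a : R) x : 0 <= a -> cone x -> cone (a%:C *: x).
Proof.
move=> a0 [f /= f0 <-]; exists (a *: f); last by rewrite ciotaZ.
exact: blat_scale_ge0.
Qed.

Lemma cone_sum (I : Type) (r : seq I) (F : I -> E) :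
  (forall i, cone (F i)) -> cone (\sum_(i <- r) F i).
Proof.
by move=> h; elim/big_ind: _ => // [|x y]; [exact: cone0|exact: coneD].
Qed.

Lemma cone_nrm_le x y : cone x -> cone (y - x) -> nrm x <= nrm y.
Proof.
move=> [f /= f0 <-] [g /= g0 gE].
have -> : y = iota (f + g) by rewrite ciotaD gE addrC subrK.
rewrite !nrm_iota; apply: bnorm_mono => //.
by have := ble_add (blat_le_refl f) g0; rewrite addr0.
Qed.

Lemma cone_span z : exists p1 p2 p3 p4 : E, [/\ cone p1, cone p2, cone p3, cone p4 &
  z = (p1 - p2) + 'i%C *: (p3 - p4)].
Proof.
have [re [im [h _ _]]] := cplx_parts.
exists (iota (bpos (re z))), (iota (bneg (re z))),
  (iota (bpos (im z))), (iota (bneg (im z))); split.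
- by exists (bpos (re z)) => //=; exact: ble_sup2.
- by exists (bneg (re z)) => //=; exact: ble_sup2.
- by exists (bpos (im z)) => //=; exact: ble_sup2.
- by exists (bneg (im z)) => //=; exact: ble_sup2.
- by rewrite -!ciotaB -!bpos_neg.
Qed.

(** Lets the hypothesis of uniform boundedness be checked on positive vectors, the ones about which
    eventual positivity speaks. *)
Lemma pointwise_bounded_cone (I : Type) (f : I -> E -> E) :
  (forall i c x y, f i (c *: x + y) = c *: f i x + f i y) ->
  (forall x, cone x -> exists C, forall i, nrm (f i x) <= C) ->
  forall x, exists C, forall i, nrm (f i x) <= C.
Proof.
move=> lf h x; have [p1 [p2 [p3 [p4 [/h[C1 h1] /h[C2 h2] /h[C3 h3] /h[C4 h4] ->]]]]] :=
  cone_span x.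
exists (C1 + C2 + (C3 + C4)) => i.
rewrite (linD (lf i)) (linZ (lf i)) !(linB (lf i)).
have := h1 i; have := h2 i; have := h3 i; have := h4 i.
have := nrmD (f i p1 - f i p2) ('i%C *: (f i p3 - f i p4)).
rewrite nrmZ /= expr0n expr1n add0r sqrtr1 mul1r.
have := nrmD (f i p1) (- f i p2); have := nrmD (f i p3) (- f i p4).
rewrite !nrmN; lra.
Qed.

Lemma re_im_add (re im : E -> B) :
  (forall z, z = iota (re z) + 'i%C *: iota (im z)) ->
  (forall x y, re (iota x + 'i%C *: iota y) = x) ->
  (forall x y, im (iota x + 'i%C *: iota y) = y) ->
  [/\ forall z w, re (z + w) = re z + re w, forall z w, im (z + w) = im z + im w,
      forall (a : R) z, re (a%:C *: z) = a *: re z &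
      forall (a : R) z, im (a%:C *: z) = a *: im z].
Proof.
move=> h1 h2 h3.
have hD z w : z + w = iota (re z + re w) + 'i%C *: iota (im z + im w).
  by rewrite {1}(h1 z) {1}(h1 w) !ciotaD scalerDr addrACA.
have hZ (a : R) z : a%:C *: z = iota (a *: re z) + 'i%C *: iota (a *: im z).
  by rewrite {1}(h1 z) !ciotaZ scalerDr !scalerA mulrC.
split=> [z w|z w|a z|a z].
- by rewrite hD h2.
- by rewrite hD h3.
- by rewrite hZ h2.
- by rewrite hZ h3.
Qed.

(* The functional is |x^-| + |y| at x + i y. *)
Lemma cone_functional : exists p : E -> R,
  [/\ forall x y, p (x + y) <= p x + p y,
      forall (c : R) x, 0 <= c -> p (c%:C *: x) = c * p x,
      forall x, p x <= 2 * nrm x &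
      forall x, p x <= 0 <-> cone x].
Proof.
have [re [im [h1 h2 h3]]] := cplx_parts.
have [reD imD reZ imZ] := re_im_add h1 h2 h3.
exists (fun z => `|bneg (re z)| + `|im z|); split.
- move=> x y; rewrite reD imD.
  have := ler_normD (im x) (im y).
  have := bnorm_mono (bneg_ge0 _) (bnegD (re x) (re y)).
  have := ler_normD (bneg (re x)) (bneg (re y)); lra.
- by move=> c x c0; rewrite reZ imZ bnegZ // !normrZ ger0_norm // mulrDr.
- move=> z; have := nrm_re_le (re z) (im z); have := nrm_im_le (re z) (im z).
  rewrite -h1; have := norm_bneg (re z); lra.
- move=> z; split=> [h|[f /= f0 <-]].
    have a1 := normr_ge0 (bneg (re z)); have a2 := normr_ge0 (im z).
    have r0 : bneg (re z) = 0 by apply/eqP; rewrite -normr_eq0; apply/eqP/le_anti/andP; split; lra.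
    have i0 : im z = 0 by apply/eqP; rewrite -normr_eq0; apply/eqP/le_anti/andP; split; lra.
    exists (re z); first exact/bneg_eq0.
    by rewrite [RHS]h1 i0 ciota0 scaler0 addr0.
  have e : iota f = iota f + 'i%C *: iota 0 by rewrite ciota0 scaler0 addr0.
  by rewrite e h2 h3 (_ : bneg f = 0) ?normr0 ?addr0 //; apply/bneg_eq0.
Qed.

Lemma cone_closed x : (forall e : R, 0 < e -> exists2 y, cone y & nrm (x - y) <= e) -> cone x.
Proof.
have [p [p1 p2 p3 p4]] := cone_functional.
move=> h; apply/p4/ler_addgt0Pr => e e0; rewrite add0r.
have [y /p4 y0 xy] := h (e / 2) ltac:(lra).
have := p1 (x - y) y; rewrite subrK; have := p3 (x - y); lra.
Qed.

Lemma cone_increment (F : R -> E) (D : R -> E) (a b : R) : a <= b ->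
  (forall t, a <= t < b -> rdE F t (D t)) ->
  (forall t, a <= t < b -> cone (D t)) ->
  (forall t, a < t <= b -> lcE F t) -> cone (F b - F a).
Proof.
have [p [p1 p2 p3 p4]] := cone_functional.
move=> ab h1 h2 h3; apply/p4.
have := @mean_value_sublinear _ _ p 2 F D (fun=> 0) (fun=> 0) a b p1 p2 p3 ab h1.
rewrite subr0; apply => //.
- by move=> t _; exact: rdR0.
- by move=> t tab; apply/p4; apply: h2.
- by move=> t _; exact: lcR0.
Qed.

(* The factor 2 comes from treating real and imaginary parts apart. *)
Lemma dominated_increment (F G u : R -> E) (c : R -> R[i]) (a b : R) : a <= b ->
  (forall t, a <= t < b -> rdE F t (c t *: u t)) ->
  (forall t, a <= t < b -> normc (c t) <= 1) ->
  (forall t, a < t <= b -> lcE F t) ->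
  (forall t, a <= t < b -> rdE G t (u t)) ->
  (forall t, a < t <= b -> lcE G t) ->
  (forall t, a <= t < b -> cone (u t)) ->
  nrm (F b - F a) <= 2 * nrm (G b - G a).
Proof.
move=> ab F1 c1 F2 G1 G2 u0.
have [re [im [h1 h2 h3]]] := cplx_parts.
have [reD imD reZ imZ] := re_im_add h1 h2 h3.
have part (g : E -> B) (cg : R[i] -> R) :
  (forall z w, g (z + w) = g z + g w) -> (forall (a : R) z, g (a%:C *: z) = a *: g z) ->
  (forall z, `|g z| <= nrm z) -> (forall z, `|cg z| <= normc z) ->
  (forall z v, cone v -> iota (g (z *: v)) = (cg z)%:C *: v) ->
  `|g (F b - F a)| <= nrm (G b - G a).
  move=> gD gZ gb cgb gc.
  have LD z w : iota (g (z + w)) = iota (g z) + iota (g w) by rewrite gD ciotaD.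
  have LZ (r : R) z : iota (g (r%:C *: z)) = r%:C *: iota (g z) by rewrite gZ ciotaZ.
  have gN z : g (- z) = - g z by rewrite -scaleN1r -(rmorph1 (real_complex R)) -rmorphN gZ scaleN1r.
  have LB z w : iota (g (z - w)) = iota (g z) - iota (g w) by rewrite gD gN ciotaB.
  have Lb z : nrm (iota (g z)) <= 1 * nrm z by rewrite mul1r nrm_iota.
  (* The derivative here is [1 + s * cg (c t) >= 0] times the positive [u t]. Taking [s = 1] and
     [s = -1] encloses the chosen part of the increment of [F] between minus and plus that of
     [G]. *)
  have inc (s : R) : `|s| = 1 -> cone (G b - G a + s%:C *: iota (g (F b - F a))).
    move=> s1.
    have -> : G b - G a + s%:C *: iota (g (F b - F a)) =
      (1 *: G b + s%:C *: iota (g (F b))) - (1 *: G a + s%:C *: iota (g (F a))).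
      by rewrite LB scalerBr !scale1r opprD addrACA.
    apply: (cone_increment (F := fun t => 1 *: G t + s%:C *: iota (g (F t)))
      (D := fun t => 1 *: u t + s%:C *: iota (g (c t *: u t)))) => // t tab.
    - apply: rdE_lin; first exact: G1.
      exact: (rdE_comp LD LZ Lb (F1 t tab)).
    - rewrite gc ?scalerA -?scalerDl; last exact: u0.
      rewrite -rmorphM -(rmorph1 (real_complex R)) -rmorphD; apply: coneZ; last exact: u0.
      have := ler_norm (- (s * cg (c t))); rewrite normrN normrM s1 mul1r.
      have := cgb (c t); have := c1 t tab; lra.
    - apply: lcE_lin; first exact: G2.
      exact: (lcE_comp LB Lb (F2 t tab)).
  have [f1 f10 e1] := inc 1 (normr1 _).
  have [f2 f20 e2] := inc (-1) ltac:(by rewrite normrN normr1).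
  rewrite rmorph1 scale1r in e1; rewrite rmorphN rmorph1 scaleN1r in e2.
  set r := g _ in e1 e2 *.
  have eG : G b - G a = iota (f1 - r) by rewrite ciotaB e1 addrK.
  rewrite eG nrm_iota; apply: bnorm_le.
    rewrite -ble_subr (_ : f1 - r - r = f2) //.
    by apply: iota_inj; rewrite !ciotaB e1 e2 addrK.
  by rewrite -ble_subr opprK subrK.
have cone_real v : cone v -> exists f, v = iota f by move=> [f _ <-]; exists f.
have decomp (z : R[i]) f : z *: iota f =
    iota (complex.Re z *: f) + 'i%C *: iota (complex.Im z *: f).
  by rewrite !ciotaZ scalerA -scalerDl -complexE.
have r1 : `|re (F b - F a)| <= nrm (G b - G a).
  apply: (part re (@complex.Re R)) => //.
  - by move=> z; rewrite [X in nrm X]h1 nrm_re_le.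
  - by move=> z; have := normc_ge_Re z; rewrite lecR.
  - by move=> z v /cone_real[f ->]; rewrite (decomp z f) h2 ciotaZ.
have r2 : `|im (F b - F a)| <= nrm (G b - G a).
  apply: (part im (@complex.Im R)) => //.
  - by move=> z; rewrite [X in nrm X]h1 nrm_im_le.
  - move=> [x y] /=; rewrite -sqrtr_sqr ler_wsqrtr // lerDr sqr_ge0 //.
  - by move=> z v /cone_real[f ->]; rewrite (decomp z f) h3 ciotaZ.
rewrite [X in nrm X <= _]h1; apply: le_trans (nrmD _ _) _.
rewrite nrmZ !nrm_iota /= expr0n expr1n add0r sqrtr1 mul1r; lra.
Qed.

End Complexifications.

(** * Eventually positive semigroups *)

Section Resolvents.
Context {R : realType} {E : completeNormedModType R[i]}.
Variables (Q : R -> E -> E) (sQ : semigroup Q).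

Lemma inverts_orbit S y t : inverts Q S -> 0 <= t -> rdE (Q^~ (S y)) t (- Q t y).
Proof.
by move=> [_ _ h _] t0; rewrite -(linN (sg_lin sQ t)); apply: sg_rd.
Qed.

(** [S2 f] lies in the domain, where the generators of the two twists differ by the scalar [l - m];
    apply [S1] to the resulting derivative. *)
Lemma resolvent_identity l m S1 S2 f : inverts (twist l Q) S1 -> inverts (twist m Q) S2 ->
  S2 f = S1 f + (l - m) *: S1 (S2 f).
Proof.
move=> [l1 _ _ h1] [l2 _ h2 _].
have := twist_rd (twist_sg sQ m) (l - m) (h2 f); rewrite twistD subrK => /h1.
by rewrite (linB l1) (linN l1) (linZ l1) -opprD => /oppr_inj.
Qed.

Lemma resolvent_bound l m S1 S2 (C : R) : inverts (twist l Q) S1 ->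
  inverts (twist m Q) S2 -> (forall x, nrm (S1 x) <= C * nrm x) ->
  normc (l - m) * C <= 1 / 2 -> forall x, nrm (S2 x) <= 2 * C * nrm x.
Proof.
move=> i1 i2 hC lm x; have := resolvent_identity x i1 i2.
move=> e; have := nrmD (S1 x) ((l - m) *: S1 (S2 x)); rewrite -e nrmZ.
have h1 := hC x; have h2 := hC (S2 x).
have h3 : normc (l - m) * nrm (S1 (S2 x)) <= 1 / 2 * nrm (S2 x).
  apply: (@le_trans _ _ (normc (l - m) * (C * nrm (S2 x)))).
    by rewrite ler_wpM2l ?normc_ge0.
  by rewrite mulrA ler_wpM2r ?nrm_ge0.
lra.
Qed.

(** A finite sum with an exact remainder; the limit in [n] is taken only afterwards, inside the
    closed cone. *)
Lemma neumann l m S1 S2 f n : inverts (twist l Q) S1 -> inverts (twist m Q) S2 ->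
  S2 f = \sum_(k < n) (l - m) ^+ k *: iter k.+1 S1 f +
    (l - m) ^+ n *: iter n S1 (S2 f).
Proof.
move=> i1 i2; have [l1 _ _ _] := i1.
elim: n => [|n IH]; first by rewrite big_ord0 add0r expr0 scale1r.
rewrite {1}IH big_ord_recr /= -addrA; congr (_ + _).
have iD k x y (c : R[i]) : iter k S1 (x + c *: y) = iter k S1 x + c *: iter k S1 y.
  by elim: k => //= k ->; rewrite (linD l1) (linZ l1).
rewrite {1}(resolvent_identity f i1 i2) iD scalerDr scalerA -exprSr.
by rewrite -!iterSr.
Qed.

Lemma orbit_bounded_from x (t0 C : R) : (forall t, t0 <= t -> nrm (Q t x) <= C) ->
  exists C, forall t, 0 <= t -> nrm (Q t x) <= C.
Proof.
move=> hC; have [M M0 hM] := sg_bd sQ t0.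
exists (Num.max C (M * nrm x)) => t tp; rewrite le_max.
have [h|h] := lerP t0 t; first by rewrite hC.
by rewrite hM ?orbT // tp ltW.
Qed.

End Resolvents.

Section EventuallyPositive.
Context {R : realType} {B : banachLatticeType R} {E : completeNormedModType R[i]}.
Variables (iota : B -> E) (hc : complexification iota).
Local Notation cone := (positive_cone iota).
Variables (Q : R -> E -> E) (sQ : semigroup Q).

Definition pos_from (t0 : R) (g : E) := forall t, t0 <= t -> cone (Q t g).

(** The starting time [t0] is the same for [g] and [S g], so powers of [S] preserve it too, as the
    Neumann series demands. *)
Definition pos_resolvent (S : E -> E) := forall g t0, 0 <= t0 ->
  pos_from t0 g -> pos_from t0 (S g).

Lemma cone_twist (a t : R) x : cone (twist a%:C Q t x) <-> cone (Q t x).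
Proof.
rewrite /twist cexp_real; split=> h; last by apply: coneZ => //; exact: expR_ge0.
have := coneZ hc (a := expR (a * t)) (expR_ge0 _) h.
by rewrite scalerA -rmorphM -expRD subrr expR0 rmorph1 scale1r.
Qed.

Lemma orbit_decreasing (a t0 s t : R) S g : inverts (twist a%:C Q) S -> 0 <= t0 ->
  pos_from t0 g -> t0 <= s -> s <= t ->
  cone (twist a%:C Q s (S g) - twist a%:C Q t (S g)).
Proof.
move=> iS t00 pg t0s st; set P := twist _ _.
have sP : semigroup P by exact: twist_sg.
have -> : P s (S g) - P t (S g) = (-1 *: P t (S g) + 0 *: 0) - (-1 *: P s (S g) + 0 *: 0).
  by rewrite !scaleN1r scaler0 !addr0 opprK addrC.
apply: (cone_increment hc (F := fun t => -1 *: P t (S g) + 0 *: 0)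
  (D := fun t => -1 *: (- P t g) + 0 *: 0)) => // r rst.
- by apply: rdE_lin; [apply: inverts_orbit => //; lra|exact: rdE_const].
- by rewrite scaleN1r opprK scaler0 addr0; apply/cone_twist/pg; lra.
- by apply: lcE_lin; [apply: sg_lc => //; lra|exact: lcE_const].
Qed.

(** As [w < a], the rescaled orbit of [S g] tends to 0. Its value at [t] is thus the limit of its
    differences with later values, which lie in the cone since the orbit decreases. *)
Lemma pos_resolvent_large (w a : R) S : bounded_sg (twist w%:C Q) -> w < a ->
  inverts (twist a%:C Q) S -> pos_resolvent S.
Proof.
move=> [M hM] wa iS g t0 t00 pg t t0t; apply/(cone_twist a).
apply: (cone_closed hc) => e e0.
have [r r0 hr] := exp_small (`|M| * nrm (S g)) (d := a - w) ltac:(lra) e0.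
pose s := t + r.
exists (twist a%:C Q t (S g) - twist a%:C Q s (S g)).
  by apply: (orbit_decreasing iS t00 pg) => //; rewrite /s lerDl.
rewrite opprB addrCA subrr addr0.
have -> : twist a%:C Q s (S g) = (expR (- ((a - w) * s)))%:C *: twist w%:C Q s (S g).
  rewrite /twist !cexp_real scalerA -rmorphM -expRD; congr ((expR _)%:C *: _); ring.
rewrite nrmZr ger0_norm ?expR_ge0 //; apply: le_trans hr.
rewrite mulrC; apply: ler_pM; rewrite ?nrm_ge0 ?expR_ge0 //.
  apply: le_trans (hM s (S g) _) _; first by rewrite /s; lra.
  by rewrite ler_wpM2r ?nrm_ge0 // ler_norm.
rewrite ler_expR lerN2 ler_pM2l ?subr_gt0 // /s; lra.
Qed.

(** Since [b <= a], the Neumann terms are nonnegative multiples of powers of [S1]. The remainder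
    after [n] terms carries the factor [((a - b) * C) ^+ n], at most [2^-n]. *)
Lemma pos_resolvent_step (a b C : R) S1 S2 : inverts (twist a%:C Q) S1 ->
  inverts (twist b%:C Q) S2 -> 0 <= C -> (forall x, nrm (S1 x) <= C * nrm x) ->
  b <= a -> (a - b) * C <= 1 / 2 -> pos_resolvent S1 -> pos_resolvent S2.
Proof.
move=> i1 i2 C0 hC ba abC p1 g t0 t00 pg t t0t.
apply: (cone_closed hc) => e e0.
have [M M0 hM] := sg_bd sQ t.
have lq := sg_lin sQ t.
have itC n x : nrm (iter n S1 x) <= C ^+ n * nrm x.
  elim: n => [|n IH]; first by rewrite expr0 mul1r.
  rewrite iterS exprS -mulrA; apply: le_trans (hC _) _; exact: ler_wpM2l.
have h0 : (2^-1 : R) ^+ n @[n --> \oo] --> (0 : R).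
  by apply: cvg_expr; rewrite ger0_norm ?invr_ge0 // invf_lt1 // ltr1n.
have m0 : 0 < M * nrm (S2 g) + 1.
  by rewrite ltr_wpDl // mulr_ge0 ?nrm_ge0 // ltW.
have /cvgrPdist_lt/(_ (e / (M * nrm (S2 g) + 1))) := h0.
rewrite divr_gt0 // => /(_ isT)[n _ /(_ n (leqnn _))] /=.
rewrite sub0r normrN ger0_norm ?exprn_ge0 ?invr_ge0 // ltr_pdivlMr // => hn.
pose c := a%:C - b%:C : R[i].
have cE k : c ^+ k = ((a - b) ^+ k)%:C by rewrite /c -rmorphB -rmorphXn.
exists (\sum_(k < n) c ^+ k *: Q t (iter k.+1 S1 g)).
  apply: (cone_sum hc) => k; rewrite cE; apply: (coneZ hc); first by rewrite exprn_ge0 // subr_ge0.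
  have : pos_from t0 (iter k.+1 S1 g).
    by elim: (k : nat) => [|j IH]; rewrite iterS; apply: p1.
  by apply.
rewrite {1}(neumann sQ g n i1 i2) (linD lq) (linZ lq) -/c.
have -> : Q t (\sum_(k < n) c ^+ k *: iter k.+1 S1 g) =
    \sum_(k < n) c ^+ k *: Q t (iter k.+1 S1 g).
  rewrite (big_morph (Q t) (linD lq) (lin0 lq)).
  by apply: eq_bigr => k _; rewrite (linZ lq).
rewrite addrAC subrr add0r cE nrmZr ger0_norm ?exprn_ge0 ?subr_ge0 //.
have h1 : nrm (Q t (iter n S1 (S2 g))) <= M * (C ^+ n * nrm (S2 g)).
  by apply: le_trans (hM _ _ _) _; rewrite ?lexx ?andbT ?ler_pM2l //; lra.
have h2 : ((a - b) * C) ^+ n <= (2^-1) ^+ n.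
  rewrite lerXn2r ?nnegrE ?invr_ge0 ?mulr_ge0 ?subr_ge0 //; lra.
have h3 : (a - b) ^+ n * nrm (Q t (iter n S1 (S2 g))) <=
    ((a - b) * C) ^+ n * (M * nrm (S2 g)).
  rewrite exprMn -mulrA; apply: ler_wpM2l; first by rewrite exprn_ge0 // subr_ge0.
  by apply: le_trans h1 _; rewrite mulrCA.
apply: le_trans h3 _; apply: (@le_trans _ _ ((2^-1) ^+ n * (M * nrm (S2 g)))).
  by rewrite ler_wpM2r // mulr_ge0 ?nrm_ge0 // ltW.
have : 0 <= (2^-1 : R) ^+ n by rewrite exprn_ge0 // invr_ge0.
lra.
Qed.

(* Continuity method: the claim holds for large real [a] by the Laplace transform, and
   descends from [a] to [b] by the Neumann series in powers of [a - b >= 0]. *)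
Lemma pos_resolventP (v : R) S :
  (forall a : R, v <= a -> exists S, inverts (twist a%:C Q) S) ->
  inverts (twist v%:C Q) S -> pos_resolvent S.
Proof.
move=> hv iS.
have [w hw] := growth_ex sQ.
pose A := [set a | v <= a /\ forall S, inverts (twist a%:C Q) S -> pos_resolvent S].
have Aa : A (Num.max v (w + 1)).
  split; first by rewrite le_max lexx.
  move=> S'; apply: (pos_resolvent_large hw).
  by rewrite lt_max ltrDl ltr01 orbT.
have hA : has_inf A by split; [exists (Num.max v (w + 1))|exists v => a []].
have vc : v <= inf A by apply: lb_le_inf; [exists (Num.max v (w + 1))|move=> a []].
have [Sc ic] := hv _ vc; have [_ [C C0 hC] _ _] := ic.
(* The bound [C] at [inf A] becomes [2 * C] at a point [a] of [A] within [d] of it. From [a] a step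
   of length at most [2 * d] is allowed, as [2 * d * (2 * C) <= 1 / 2]. It would reach [inf A - d],
   so it must have been stopped by [v]. *)
pose d := (8 * (C + 1))^-1.
have C80 : 0 < 8 * (C + 1) by lra.
have d0 : 0 < d by rewrite invr_gt0.
have dC : d * (8 * C) <= 1 by rewrite /d mulrC ler_pdivrMr // mul1r; lra.
have [a [va Ha] ac] := inf_adherent d0 hA.
have ca : inf A <= a by apply: ge_inf; [exists v => ? []|].
have [Sa ia] := hv _ va.
have bS : forall x, nrm (Sa x) <= 2 * C * nrm x.
  apply: (resolvent_bound sQ ic ia hC).
  rewrite -rmorphB /= expr0n addr0 sqrtr_sqr ler0_norm ?subr_le0 // opprB.
  have : (a - inf A) * C <= d * C by rewrite ler_wpM2r //; lra.
  lra.
pose b := Num.max v (inf A - d).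
have vb : v <= b by rewrite le_max lexx.
have db : inf A - d <= b by rewrite le_max lexx orbT.
have ba : b <= a by rewrite ge_max va /=; lra.
have Ab : A b.
  split => // Sb ib; apply: (pos_resolvent_step ia ib _ bS ba) => //; first lra.
    have : (a - b) * (2 * C) <= (2 * d) * (2 * C) by rewrite ler_wpM2r //; lra.
    lra.
  exact: Ha.
have cb : inf A <= b by apply: ge_inf; [exists v => ? []|].
have bv : b = v.
  by move: cb; rewrite /b; case: (lerP v (inf A - d)) => // *; lra.
by case: Ab; rewrite bv => _; apply.
Qed.

Lemma domain_orbit_norm (a t0 s t : R) S g :
  inverts (twist a%:C Q) S -> pos_resolvent S -> 0 <= t0 ->
  pos_from t0 g -> t0 <= s -> s <= t ->
  nrm (twist a%:C Q t (S g)) <= nrm (twist a%:C Q s (S g)).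
Proof.
move=> iS pS t00 pg t0s st; apply: (cone_nrm_le hc).
  by apply/cone_twist; apply: (pS _ _ t00 pg); lra.
exact: (orbit_decreasing iS t00 pg).
Qed.

Lemma orbits_bounded_cone (P : R -> E -> E) (L : E -> E) : semigroup P ->
  (forall c x y, L (c *: x + y) = c *: L x + L y) ->
  (forall f, cone f -> exists C, forall t, 0 <= t -> nrm (P t (L f)) <= C) ->
  forall x, exists C, forall t, 0 <= t -> nrm (P t (L x)) <= C.
Proof.
move=> sP lL h x.
have [C hC] : exists C, forall t : R, nrm (P `|t| (L x)) <= C.
  apply: (pointwise_bounded_cone hc (f := fun (t : R) x => P `|t| (L x))) => [t c y z|f /h[C hC]].
    by rewrite lL (sg_lin sP).
  by exists C => t; exact: hC.
by exists C => t t0; have := hC t; rewrite ger0_norm.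
Qed.

Hypothesis iep : forall f, cone f -> exists2 t0 : R, 0 <= t0 & pos_from t0 f.

Lemma domain_orbits_bounded (a : R) S : inverts (twist a%:C Q) S -> pos_resolvent S ->
  forall x, exists C, forall t, 0 <= t -> nrm (twist a%:C Q t (S x)) <= C.
Proof.
move=> iS pS; have [lS _ _ _] := iS.
apply: (orbits_bounded_cone (twist_sg sQ _) lS) => f /iep[t0 t00 pf].
apply: (orbit_bounded_from (twist_sg sQ _) (t0 := t0)) => t t0t.
exact: (domain_orbit_norm iS pS t00 pf (lexx _) t0t).
Qed.

(* The orbit of a positive [f] enters the cone at some time [t0], and [Q t0 f] then
   has an orbit that stays there. *)
Lemma bounded_from_positive (m : R) :
  (forall f, pos_from 0 f -> exists C, forall t, 0 <= t -> nrm (twist m%:C Q t f) <= C) ->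
  bounded_sg (twist m%:C Q).
Proof.
move=> h; apply: (bounded_orbits (twist_sg sQ _)).
apply: (orbits_bounded_cone (twist_sg sQ _) (L := id)) => // f /iep[t0 t00 pf].
have [|C hC] := h (Q t0 f).
  by move=> t tp; rewrite -(sgD sQ) //; apply: pf; lra.
apply: (orbit_bounded_from (twist_sg sQ _) (t0 := t0) (C := expR (- (m * t0)) * C)) => t t0t.
have -> : twist m%:C Q t f = cexp m%:C t0 *: twist m%:C Q (t - t0) (Q t0 f).
  rewrite /twist scalerA -cexpD -(sgD sQ) ?subr_ge0 // subrK.
  by congr (cexp _ _ *: _); ring.
by rewrite nrmZ normc_cexp ler_wpM2l ?expR_ge0 // hC // subr_ge0.
Qed.

End EventuallyPositive.

(** * The spaces L^1 and C(K) *)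

Section AdditiveNorm.
Context {R : realType} {B : banachLatticeType R} {E : completeNormedModType R[i]}.
Variables (iota : B -> E) (hc : complexification iota).
Local Notation cone := (positive_cone iota).
Variables (Q : R -> E -> E) (sQ : semigroup Q).
Hypothesis iep : forall f, cone f -> exists2 t0 : R, 0 <= t0 & pos_from iota Q t0 f.
Variables (m : R) (S : E -> E).
Hypotheses (iS : inverts (twist m%:C Q) S) (pS : pos_resolvent iota Q S).

(* On the cone the norm is additive, so that the norm of the integral of an orbit
   over a unit interval is the integral of the norm; the former is bounded. *)
Lemma bounded_additive_norm :
  (forall f g, cone f -> cone g -> nrm (f + g) = nrm f + nrm g) ->
  bounded_sg (twist m%:C Q).
Proof.
move=> nD; apply: (bounded_from_positive hc sQ iep) => f pf.
set P := twist _ _; have sP : semigroup P by exact: twist_sg.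
have [M M0 hM] := sg_bd sP 1.
pose g t := P t (S f).
have dec s t : 0 <= s -> s <= t -> cone (g s - g t).
  by move=> s0 st; apply: (orbit_decreasing hc sQ iS (lexx 0) pf).
have pos t : 0 <= t -> cone (g t).
  by move=> t0; apply/(cone_twist hc); apply: (pS (lexx 0) pf).
apply: (orbit_bounded_from sP (t0 := 1) (C := M * nrm (S f))) => t1 t11.
pose t := t1 - 1; have t0 : 0 <= t by rewrite /t; lra.
pose K := nrm (P t1 f) / M.
have hK s : t <= s <= t1 -> K <= nrm (P s f).
  move=> sb; rewrite ler_pdivrMr // mulrC.
  have -> : t1 = (t1 - s) + s by ring.
  rewrite (sgD sP); [|lra|lra]; apply: hM; rewrite /t in sb; lra.
(* Additivity of the norm on the cone makes [nrm (g t - g s)] grow in [s] at rate at least [K].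
   After unit time it is at least [K], while monotonicity keeps it below [nrm (S f)]. *)
have := @dini_le _ (fun s => - nrm (g t - g s)) t t1 (- K).
rewrite subrr nrm0 oppr0 add0r => h.
have {}h : - nrm (g t - g t1) <= - K * (t1 - t).
  apply: h; first by rewrite /t; lra.
  - move=> s sb e e0.
    have s0 : 0 <= s by lra.
    have [r r0 hr] := inverts_orbit sP f iS s0 (e := e) e0.
    exists r => // h hh; have := hr h hh => {}hr.
    have h0 : 0 < h by case/andP: hh.
    have -> : g t - g (s + h) = (g t - g s) + (g s - g (s + h)) by rewrite addrA subrK.
    rewrite nD; [|apply: dec; lra|apply: dec; lra].
    have h1 : nrm (h%:C *: P s f) = h * nrm (P s f) by rewrite nrmZr gtr0_norm.
    have h2 := nrmBD (h%:C *: P s f) (g s - g (s + h)).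
    have h3 : h%:C *: P s f - (g s - g (s + h)) = g (s + h) - g s - h%:C *: - P s f.
      by rewrite scalerN opprK opprB addrC.
    rewrite h3 h1 in h2.
    have h4 : h * K <= h * nrm (P s f) by rewrite ler_pM2l // hK; lra.
    rewrite -/(g _) -/(g _) in hr; rewrite mulrDl mulNr; lra.
  - move=> s sb e e0.
    have [r r0 hr] := sg_lc sP (S f) (t := s) ltac:(lra) e0.
    exists r => // h /hr hh.
    have := nrmDB (g t) (g s) (g (s - h)); rewrite (nrmB (g s)).
    rewrite -/(g _) -/(g _) in hh; lra.
have tt : t1 - t = 1 by rewrite /t; ring.
rewrite tt mulr1 lerN2 /K ler_pdivrMr // in h.
apply: le_trans h _; rewrite mulrC ler_pM2l //.
have g0 : g 0 = S f by rewrite /g sg0.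
rewrite -g0; apply: (@le_trans _ _ (nrm (g t))).
  apply: (cone_nrm_le hc); first by apply: dec => //; rewrite /t; lra.
  by rewrite opprB addrCA subrr addr0; apply: pos; lra.
by apply: (cone_nrm_le hc); [exact: pos|exact: dec].
Qed.

(** As [u] is in the domain, [u = S (m u - D)] has a bounded rescaled orbit. Eventual positivity of
    [c u - f] makes this orbit, times [c], dominate that of [f] from some time on. *)
Lemma bounded_order_unit (u D : E) : rdE (Q^~ u) 0 D ->
  (forall f, cone f -> exists c : R, cone (c%:C *: u - f)) ->
  bounded_sg (twist m%:C Q).
Proof.
move=> uD hu; apply: (bounded_from_positive hc sQ iep) => f pf.
set P := twist _ _; have sP : semigroup P by exact: twist_sg.
have cf : cone f by have := pf 0 (lexx _); rewrite sg0.
have [c cu] := hu f cf.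
have [t0 t00 pc] := iep cu.
have [lS _ _ h] := iS.
have Su : S (m%:C *: u - D) = u.
  have := h _ _ (twist_rd sQ m%:C uD).
  by rewrite -opprB (linN lS) => /oppr_inj.
have [C hC] := domain_orbits_bounded hc sQ iep iS pS (m%:C *: u - D).
rewrite Su in hC.
apply: (orbit_bounded_from sP (t0 := t0) (C := `|c| * C)) => t tt0.
have tp : 0 <= t by lra.
apply: (@le_trans _ _ (nrm (c%:C *: P t u))).
  apply: (cone_nrm_le hc); first by apply/(cone_twist hc); apply: pf.
  rewrite -(linZ (sg_lin sP t)) -(linB (sg_lin sP t)).
  by apply/(cone_twist hc); apply: pc.
by rewrite nrmZr; apply: ler_wpM2l => //; apply: hC.
Qed.

End AdditiveNorm.

Section L1.
Context {R : realType} {B : banachLatticeType R} {E : completeNormedModType R[i]}.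
Variables (iota : B -> E) (hc : complexification iota).
Variables (d : measure_display) (Omega : measurableType d).
Variables (mu : {measure set Omega -> \bar R}) (cls : (Omega -> R[i]) -> E).
Hypothesis hL : is_L1 iota mu cls.

Lemma measurable_Re_norm (F : Omega -> R[i]) : cintegrable mu F ->
  measurable_fun setT (fun x => (complex.Re `|F x|)%:E).
Proof.
move=> [/measurable_int/measurable_EFinP mr /measurable_int/measurable_EFinP mi].
apply/measurable_EFinP.
have -> : (fun x => complex.Re `|F x|) =
    Num.sqrt \o (fun x => complex.Re (F x) ^+ 2 + complex.Im (F x) ^+ 2).
  by apply/funext => x; rewrite normc_def.
apply: measurableT_comp.
  by apply: continuous_measurable_fun; exact: sqrt_continuous.
by apply: measurable_funD; apply: measurable_funX.
Qed.

(** On the cone modulus and real part agree almost everywhere, so the norm is there the restriction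
    of a linear functional. *)
Lemma nrm_L1_cone (F : Omega -> R[i]) : cintegrable mu F -> positive_cone iota (cls F) ->
  (nrm (cls F))%:E = (\int[mu]_x (complex.Re (F x))%:E)%E.
Proof.
move=> iF pF; rewrite /nrm (L1_norm hL iF).
apply: ae_eq_integral => //; first exact: measurable_Re_norm.
  by case: iF => /measurable_int.
have := (L1_pos hL iF).1 pF; apply: filterS => x Fx _.
by rewrite ger0_norm.
Qed.

Lemma nrm_L1_additive f g : positive_cone iota f -> positive_cone iota g ->
  nrm (f + g) = nrm f + nrm g.
Proof.
have [F iF <-] := L1_surj hL f; have [G iG <-] := L1_surj hL g => pf pg.
have e := L1_linear hL 1 iF iG; rewrite scale1r in e.
have iFG : cintegrable mu (fun x => 1 * F x + G x).
  have [iF1 iF2] := iF; have [iG1 iG2] := iG; split.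
    have -> : (fun x => (complex.Re (1 * F x + G x))%:E) =
      ((fun x => (complex.Re (F x))%:E) \+ (fun x => (complex.Re (G x))%:E))%E.
      by apply/funext => x; rewrite mul1r /= -EFinD; case: (F x); case: (G x).
    exact: integrableD.
  have -> : (fun x => (complex.Im (1 * F x + G x))%:E) =
    ((fun x => (complex.Im (F x))%:E) \+ (fun x => (complex.Im (G x))%:E))%E.
    by apply/funext => x; rewrite mul1r /= -EFinD; case: (F x); case: (G x).
  exact: integrableD.
apply: EFin_inj; rewrite EFinD -e !nrm_L1_cone //; last by rewrite e; exact: coneD.
have [iF1 iF2] := iF; have [iG1 iG2] := iG.
rewrite -integralD //; apply: eq_integral => x _.
by rewrite mul1r -EFinD; case: (F x); case: (G x).
Qed.

End L1.

Section CK.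
Context {R : realType} {B : banachLatticeType R} {E : completeNormedModType R[i]}.
Variables (iota : B -> E) (hc : complexification iota).
Variables (K : topologicalType) (ev : E -> K -> R[i]^o).
Hypotheses (cK : compact [set: K]) (hK : is_CK iota ev).

(** Here compactness enters: [sup] is an upper bound only once the range is known to be bounded. *)
Lemma CK_nrm_ge z k : complex.Re `|ev z k| <= nrm z.
Proof.
pose phi k := complex.Re `|ev z k| : R.
have cev : continuous (ev z) by have : range ev (ev z) by [exists z]; rewrite (CK_range hK).
have phiE j : `|ev z j| = (phi j)%:C by rewrite /phi RRe_real // ger0_real.
have cphi : continuous phi.
  move=> j; apply/cvgrPdist_lt => e e0.
  have /cvgrPdist_lt/(_ e%:C) := cev j; rewrite ltcR => /(_ e0).
  apply: filterS => i hi; rewrite -ltcR; apply: le_lt_trans hi.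
  have := ler_dist_dist (ev z j) (ev z i).
  by rewrite !phiE -rmorphB /= normc_def /= expr0n addr0 sqrtr_sqr.
have cim : compact (phi @` setT).
  by apply: continuous_compact => //; apply: continuous_subspaceT.
have [M [Mreal hM]] := compact_bounded cim.
have ub : has_ubound (range phi).
  exists (M + 1) => _ [j _ <-]; apply: le_trans (ler_norm _) _.
  by apply: hM; [rewrite ltrDl|exists j].
have -> : nrm z = sup (range phi) by rewrite /nrm (CK_norm hK).
by apply: ub_le_sup => //; exists k.
Qed.

Lemma ev0 k : ev 0 k = 0.
Proof.
have := CK_linear hK (-1) 0 0 k; rewrite scaler0 addr0 mulN1r addNr => h; exact: h.
Qed.

Lemma evD y z k : ev (y + z) k = ev y k + ev z k.
Proof. by have := CK_linear hK 1 y z k; rewrite scale1r mul1r. Qed.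

Lemma evZ a y k : ev (a *: y) k = a * ev y k.
Proof. by have := CK_linear hK a y 0 k; rewrite !addr0 ev0 addr0. Qed.

(** [CK_pos] describes the cone; a real vector is a difference of two of its elements. *)
Lemma ev_iota_real x k : complex.Im (ev (iota x) k) = 0.
Proof.
rewrite [x]bpos_neg (ciotaB hc) -scaleN1r evD evZ.
have h1 : 0 <= ev (iota (bpos x)) k.
  by apply: (CK_pos hK _).1; exists (bpos x) => //; exact: ble_sup2.
have h2 : 0 <= ev (iota (bneg x)) k.
  by apply: (CK_pos hK _).1; exists (bneg x) => //; exact: ble_sup2.
move: h1 h2; rewrite !lecE => /andP[/eqP h1 _] /andP[/eqP h2 _].
move: h1 h2; case: (ev _ k) => a b /= ->; case: (ev _ k) => c e /= ->.
ring.
Qed.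

Variables (T : R -> {linear E -> E}) (hT : C0_semigroup T).
Hypothesis rA : real_operator iota (generator T).

(** Some vector of the domain is within 1/4 of the constant 1. Its real part stays in the domain
    because the generator is real, and is at least 3/4 everywhere, so that [2 * nrm f] times it
    exceeds [f]. *)
Lemma CK_order_unit : exists u D, rdE (fun t => T t u) 0 D /\
  forall f, positive_cone iota f -> exists c : R, positive_cone iota (c%:C *: u - f).
Proof.
have [e1 _ he1] : range ev (fun=> 1) by rewrite (CK_range hK) => k; exact: cst_continuous.
have sQ := C0_sg hT; have [U iU] := integrals_ex sQ.
have [y [Dy [/(generator_rd hT)[yD _] y1]]] := integrals_dense sQ iU e1 (e := 1 / 4) ltac:(lra).
have [re [im [h1 h2 h3]]] := cplx_parts hc.
have [rD _] := rA.1 (re y) (im y) ltac:(by rewrite -h1).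
exists (iota (re y)), (op_fun (generator T) (iota (re y))); split.
  exact: (generator_dom hT).
have uk k : 3 / 4 <= complex.Re (ev (iota (re y)) k).
  have := le_trans (CK_nrm_ge (y - e1) k) y1.
  rewrite -scaleN1r evD evZ he1 {1}(h1 y) evD evZ => h.
  have /le_trans/(_ h) : `|complex.Re (ev (iota (re y)) k + 'i%C * ev (iota (im y)) k + -1 * 1)| <=
     complex.Re `|ev (iota (re y)) k + 'i%C * ev (iota (im y)) k + -1 * 1|.
    by have := normc_ge_Re (ev (iota (re y)) k + 'i%C * ev (iota (im y)) k + -1 * 1); rewrite lecE => /andP[].
  have := ev_iota_real (im y) k.
  case: (ev (iota (im y)) k) => a b /= ->; case: (ev (iota (re y)) k) => p q /=.
  rewrite ler_norml => /andP[]; lra.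
move=> f pf; exists (2 * nrm f); apply/(CK_pos hK) => k.
rewrite -scaleN1r evD !evZ.
have fk : 0 <= ev f k by apply: (CK_pos hK _).1.
have fn := CK_nrm_ge f k; rewrite ger0_norm // in fn.
have := uk k; have := ev_iota_real (re y) k; have n0 := nrm_ge0 f.
move: fk fn; rewrite !lecE /=; case: (ev f k) => a b /=.
case: (ev (iota (re y)) k) => p q /= /andP[/eqP -> a0] an -> pk.
apply/andP; split; first by apply/eqP; ring.
have : (2 * nrm f) * (3 / 4) <= 2 * nrm f * p by rewrite ler_wpM2l //; lra.
lra.
Qed.

End CK.

(** * Hilbert spaces *)

Section UniformResolvents.
Context {R : realType} {B : banachLatticeType R} {E : completeNormedModType R[i]}.
Variables (iota : B -> E) (hc : complexification iota).
Local Notation cone := (positive_cone iota).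
Variables (Q : R -> E -> E) (sQ : semigroup Q).
Hypothesis iep : forall f, cone f -> exists2 t0 : R, 0 <= t0 & pos_from iota Q t0 f.

Variables (v m : R) (vm : v < m) (Rs : R[i] -> E -> E).
Hypothesis iR : forall l, v <= complex.Re l -> inverts (twist l Q) (Rs l).

Let pos_Rs (a : R) : v <= a -> pos_resolvent iota Q (Rs a%:C).
Proof.
move=> va; apply: (pos_resolventP hc sQ (v := a)); last exact: iR.
by move=> b ab; exists (Rs b%:C); apply: iR => /=; lra.
Qed.

(** By the resolvent identity [Rs l f] is in the range of [Rs v%:C], so its orbit rescaled at rate
    [v] is bounded; the gap [m - v] supplies the decay. *)
Lemma domain_orbit_vanishes l f (e : R) : m <= complex.Re l -> 0 < e ->
  forall t0, exists2 t, t0 <= t & nrm (twist l Q t (Rs l f)) <= e.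
Proof.
move=> ml e0 t0; have vm' := vm.
have iv := iR (l := v%:C) (lexx v); have il := iR (l := l) (le_trans (ltW vm) ml).
have [lv _ _ _] := iv.
have [C hC] := domain_orbits_bounded hc sQ iep iv (pos_Rs (lexx v)) (f + (v%:C - l) *: Rs l f).
have e1 : Rs v%:C (f + (v%:C - l) *: Rs l f) = Rs l f.
  by rewrite (linD lv) (linZ lv) -(resolvent_identity sQ f iv il).
rewrite e1 in hC.
have C0 : 0 <= C by apply: le_trans (hC 0 (lexx _)); exact: nrm_ge0.
have [t tp ht] := exp_small C (d := m - v) (e := e) ltac:(lra) e0.
exists (Num.max t t0); first by rewrite le_max lexx orbT.
set s := Num.max t t0; have ts : t <= s by rewrite le_max lexx.
have -> : twist l Q s (Rs l f) = cexp (l - v%:C) s *: twist v%:C Q s (Rs l f).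
  by rewrite /twist scalerA -cexpDl subrK.
rewrite nrmZ normc_cexp; apply: le_trans ht; rewrite mulrC.
apply: ler_pM; rewrite ?nrm_ge0 ?expR_ge0 ?hC //; first lra.
rewrite ler_expR lerN2; case: l ml {il e1 hC} => a b /= ml.
by apply: ler_pM => //; lra.
Qed.

(** For [f] positive from [t0] on, the integral representing [Rs l f] is cut at [t0]. The first
    piece has a crude bound; in the second the integrand is dominated by the one at [l = m], whose
    integral is an increment of a bounded orbit. Neither bound depends on [l]. *)
Lemma resolvent_uniform : exists2 M, 0 <= M & forall l, m <= complex.Re l ->
  forall x, nrm (Rs l x) <= M * nrm x.
Proof.
have vm' := vm; pose I := {l : R[i] | m <= complex.Re l}.
have iI (l : I) : inverts (twist (sval l) Q) (Rs (sval l)).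
  by apply: iR; case: l => l /= ml; exact: le_trans (ltW vm) ml.
have [|||M M0 hM] := @uniform_boundedness_linear _ E I (fun l => Rs (sval l)).
- by move=> l; case: (iI l).
- by move=> l; case: (iI l) => _ [C _ hC] _ _; exists C.
- apply: (pointwise_bounded_cone hc) => [l|f cf]; first by case: (iI l).
  have [t0 t00 pf] := iep cf.
  have im := iR (l := m%:C) (ltW vm).
  have [C hC] := domain_orbits_bounded hc sQ iep im (pos_Rs (ltW vm)) f.
  have [N N0 hN] := sg_bd sQ t0.
  (* In turn: the piece on [[0, t0]]; the dominated piece, an increment of [G] of size at most
     [2 * C], doubled by [dominated_increment]; and the value of [F] at the late time [s]. *)
  exists (expR (`|m| * t0) * (N * nrm f) * t0 + 4 * C + 1) => l.
  case: l => l /= ml.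
  have il := iR (l := l) (le_trans (ltW vm) ml); have [ll _ _ _] := il.
  pose F t := twist l Q t (Rs l f); pose G t := twist m%:C Q t (Rs m%:C f).
  have sl := twist_sg sQ l; have sm := twist_sg sQ m%:C.
  have h1 : nrm (F t0 - F 0) <= expR (`|m| * t0) * (N * nrm f) * (t0 - 0).
    apply: (mean_value (D := fun t => - twist l Q t f)) => // t tb.
    - by apply: (inverts_orbit sl) => //; case/andP: tb.
    - rewrite nrmN /twist nrmZ normc_cexp; apply: ler_pM; rewrite ?expR_ge0 ?nrm_ge0 //.
        rewrite ler_expR -mulNr; have h := ler_norm (- m); rewrite normrN in h.
        case/andP: tb => tb1 tb2; apply: (@le_trans _ _ (`|m| * t)).
          by rewrite ler_wpM2r //; lra.
        by rewrite ler_wpM2l // ltW.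
      by apply: hN; lra.
    - by apply: (sg_lc sl); lra.
  have [s ts hs] := domain_orbit_vanishes f ml ltr01 t0.
  have h2 : nrm (F s - F t0) <= 2 * nrm (-1 *: G s - -1 *: G t0).
    have e0 t : -1 *: G t = -1 *: G t + 0 *: (0 : E) by rewrite scaler0 addr0.
    apply: (dominated_increment hc (F := F) (G := fun t => -1 *: G t)
      (u := fun t => twist m%:C Q t f) (c := fun t => - cexp (l - m%:C) t)) => // t tb.
    - have := inverts_orbit sl f (t := t) il ltac:(lra).
      by rewrite /twist scaleNr scalerA -cexpDl subrK.
    - rewrite normcN normc_cexp -expR0 ler_expR oppr_le0 mulr_ge0 //; last lra.
      by case: l ml {il ll sl h1 hs F} => a b /=; lra.
    - by apply: (sg_lc sl); lra.
    - have := rdE_lin (-1) 0 (inverts_orbit sm f (t := t) im ltac:(lra)) (rdE_const 0 t).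
      rewrite scaleN1r opprK scaler0 addr0; apply: rdE_ext => r.
      by rewrite addr0.
    - have := lcE_lin (-1) 0 (sg_lc sm (Rs m%:C f) (t := t) ltac:(lra)) (lcE_const 0 t).
      by apply: lcE_ext => r; rewrite scaler0 addr0.
    - by apply/(cone_twist hc); apply: pf; case/andP: tb.
  have h3 : nrm (-1 *: G s - -1 *: G t0) <= 2 * C.
    rewrite !scaleN1r; apply: le_trans (nrmD _ _) _; rewrite !nrmN.
    have := hC s ltac:(lra); have := hC t0 t00; rewrite -/(G _) -/(G _); lra.
  have F0 : F 0 = Rs l f by rewrite /F (sg0 sl).
  rewrite -F0.
  have := nrmDB (F 0) (F t0) 0; have := nrmDB (F t0) (F s) 0; rewrite !subr0.
  rewrite (nrmB (F 0)) (nrmB (F t0)) -/(F _) in hs *; rewrite subr0 in h1; lra.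
- by exists M => // l ml x; exact: (hM (exist _ l ml)).
Qed.

End UniformResolvents.

(** * From one small operator to a smaller growth rate *)

Section Contractions.
Context {R : realType} {E : completeNormedModType R[i]}.

Lemma contraction_bounded (P : R -> E -> E) (t : R) : semigroup P -> 0 < t ->
  (forall x, nrm (P t x) <= nrm x) -> bounded_sg P.
Proof.
move=> sP t0 hP; have [M M0 hM] := sg_bd sP t; exists M => s x s0.
have hn n : forall s, 0 <= s <= n%:R * t -> nrm (P s x) <= M * nrm x.
  elim: n => [|n IH] r.
    rewrite mulr0n mul0r => /andP[r0 r1]; apply: hM; lra.
  move=> r0; have [rt|rt] := lerP r t.
    by apply: hM; case/andP: r0 => ->.
  have -> : r = t + (r - t) by ring.
  rewrite (sgD sP); [|lra|lra].
  apply: le_trans (hP _) _; apply: IH; move: r0; rewrite -natr1 mulrDl; lra.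
apply: (hn (Num.bound (s / t))); rewrite s0 /=.
rewrite -ler_pdivrMr //; apply: ltW; apply: archi_boundP.
by rewrite divr_ge0 // ltW.
Qed.

(** [ln 2 / t] is the exponential rate that uses up the factor 1/2 at time [t]. *)
Lemma bounded_shift (P : R -> E -> E) (t : R) : semigroup P -> 0 < t ->
  (forall x, nrm (P t x) <= 1 / 2 * nrm x) -> bounded_sg (twist (- (ln 2 / t))%:C P).
Proof.
move=> sP t0 hP; apply: (contraction_bounded (t := t)) => //; first exact: twist_sg.
move=> x; rewrite nrm_twist_real mulNr opprK divfK ?gt_eqF // lnK ?posrE //.
have := hP x; lra.
Qed.

End Contractions.

(** * The Fejer kernel *)

Section FejerKernel.
Context {R : realType}.

Definition freq (n : nat) (p : 'I_n * 'I_n) : R := p.1%:R - p.2%:R.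

(** The squared modulus of the sum of [e^{ijx}] over [j < n], that is, [n] times the usual Fejer
    kernel: a difference [k] comes from [n - |k|] pairs. *)
Definition fejer (n : nat) (x : R) : R := \sum_(p : 'I_n * 'I_n) cos (freq p * x).

Lemma sum_pair (n : nat) (F G : 'I_n -> R) :
  \sum_(p : 'I_n * 'I_n) F p.1 * G p.2 = (\sum_i F i) * (\sum_j G j).
Proof. by rewrite big_distrlr /= pair_bigA. Qed.

Lemma fejer_ge0 n x : 0 <= fejer n x.
Proof.
rewrite /fejer (eq_bigr (fun p : 'I_n * 'I_n => cos (p.1%:R * x) * cos (p.2%:R * x) +
  sin (p.1%:R * x) * sin (p.2%:R * x))); last first.
  by move=> p _; rewrite /freq mulrBl cosB.
rewrite big_split /= (sum_pair (fun i => cos (i%:R * x)) (fun i => cos (i%:R * x))).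
rewrite (sum_pair (fun i => sin (i%:R * x)) (fun i => sin (i%:R * x))).
by rewrite -!expr2 addr_ge0 // sqr_ge0.
Qed.

(** Exchanging the two indices changes the sign. Because of this cancellation the Fejer sums see
    only real parts of inner products. *)
Lemma sum_sin_freq n x : \sum_(p : 'I_n * 'I_n) sin (freq p * x) = 0.
Proof.
rewrite (eq_bigr (fun p : 'I_n * 'I_n => sin (p.1%:R * x) * cos (p.2%:R * x) -
  cos (p.1%:R * x) * sin (p.2%:R * x))); last first.
  by move=> p _; rewrite /freq mulrBl sinB.
rewrite sumrB (sum_pair (fun i => sin (i%:R * x)) (fun i => cos (i%:R * x))).
by rewrite (sum_pair (fun i => cos (i%:R * x)) (fun i => sin (i%:R * x))) mulrC subrr.
Qed.

(** Index differences are at most [n], so every angle lies in [[-1, 1]]. The left side is [n^2]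
    times [cos 1]. *)
Lemma fejer_ge n x : `|x| <= n%:R^-1 -> \sum_(p : 'I_n * 'I_n) cos 1 <= fejer n x.
Proof.
move=> xn; apply: ler_sum => p _.
have n0 : 0 < n%:R :> R by rewrite ltr0n; case: p => -[i ni] _; exact: leq_ltn_trans ni.
have fn : `|freq p| <= n%:R.
  rewrite /freq; have h1 : p.1%:R <= n%:R :> R by rewrite ler_nat ltnW.
  have h2 : p.2%:R <= n%:R :> R by rewrite ler_nat ltnW.
  have h3 : 0 <= p.1%:R :> R by []. have h4 : 0 <= p.2%:R :> R by [].
  by rewrite ler_norml; apply/andP; split; lra.
have h : `|freq p * x| <= 1.
  rewrite normrM -(mulfV (x := n%:R : R)) ?gt_eqF //; apply: ler_pM => //.
rewrite -(cos_norm (freq p * x)).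
have pi1 : 1 <= pi :> R by have := pi_ge2 R; lra.
rewrite le_eqVlt; apply/orP; move: h; rewrite le_eqVlt => /predU1P[->|h].
  by left; rewrite eqxx.
right; rewrite ltr_cos ?in_itv /= ?normr_ge0 ?ler01 //; lra.
Qed.

(** Telescoping in one index: for an integer [x] the increment of [g] from [x] to [x + 1] is at
    least a quarter of [1 / (1 + x^2)]. Since [g] stays in [[-1, 1]], each value of the other index
    contributes at most 4 * 2. *)
Lemma sum_inv_freq n : \sum_(p : 'I_n * 'I_n) (1 + freq p ^+ 2)^-1 <= 8 * n%:R.
Proof.
pose g (x : R) := x / (1 + `|x|).
have g1 x : -1 <= g x <= 1.
  have x1 : 0 < 1 + `|x| by rewrite ltr_pwDl.
  rewrite /g ler_pdivlMr // ler_pdivrMr // mulN1r mul1r.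
  have := ler_norm x; have := ler_norm (- x); rewrite normrN => h1 h2.
  by apply/andP; split; lra.
have inv_le (x z : R) : 0 < z -> z <= 4 * (1 + x ^+ 2) -> (1 + x ^+ 2)^-1 <= 4 * z^-1.
  move=> z0 zx; have x0 : 0 < 1 + x ^+ 2 by have := sqr_ge0 x; lra.
  by rewrite -[X in X <= _]mul1r ler_pdivrMr // mulrAC ler_pdivlMr // mul1r.
have gS (i j : nat) : (1 + ((i%:R - j%:R) : R) ^+ 2)^-1 <=
    4 * (g (i.+1%:R - j%:R) - g (i%:R - j%:R)).
  have [ji|ij] := leqP j i.
    have -> : i.+1%:R - j%:R = (i%:R - j%:R) + 1 :> R by rewrite -natr1; ring.
    have : 0 <= i%:R - j%:R :> R by rewrite subr_ge0 ler_nat.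
    move: (i%:R - j%:R : R) => x x0; rewrite /g !ger0_norm //; last lra.
    have -> : (x + 1) / (1 + (x + 1)) - x / (1 + x) = ((1 + x) * (2 + x))^-1.
      by field; apply/andP; split; lra.
    by apply: inv_le; nra.
  have -> : i.+1%:R - j%:R = 1 - (j%:R - i%:R) :> R by rewrite -natr1; ring.
  have -> : i%:R - j%:R = - (j%:R - i%:R) :> R by ring.
  have : 1 <= j%:R - i%:R :> R by rewrite lerBrDl natr1 ler_nat.
  move: (j%:R - i%:R : R) => x x0; rewrite /g normrN sqrrN (ger0_norm (x := x)); last lra.
  rewrite ler0_norm; last lra.
  have -> : (1 - x) / (1 + - (1 - x)) - - x / (1 + x) = (x * (1 + x))^-1.
    by field; apply/andP; split; lra.
  by apply: inv_le; nra.
rewrite -(pair_bigA _ (fun i j : 'I_n => (1 + ((i%:R - j%:R) : R) ^+ 2)^-1)) exchange_big /=.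
have -> : 8 * n%:R = \sum_(j < n) (8 : R) by rewrite sumr_const card_ord mulr_natr.
apply: ler_sum => j _.
apply: (@le_trans _ _ (\sum_(i < n) 4 * (g (i.+1%:R - j%:R) - g (i%:R - j%:R)))).
  by apply: ler_sum => i _; exact: gS.
rewrite -mulr_sumr -(big_mkord xpredT (fun i => g (i.+1%:R - j%:R) - g (i%:R - j%:R))).
rewrite (telescope_sumr (fun i => g (i%:R - j%:R))) //.
have := g1 (n%:R - j%:R); have := g1 (0%:R - j%:R); lra.
Qed.

End FejerKernel.

(** * The real inner product and the cone *)

Section InnerProducts.
Context {R : realType} {E : completeNormedModType R[i]}.
Variables (dot : {dot E for (@Num.conj R[i])}) (hd : forall x : E, `|x| ^+ 2 = dot x x).

Definition ip (x y : E) : R := complex.Re (dot x y).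
Definition jp (x y : E) : R := complex.Im (dot x y).

Lemma ReD (z w : R[i]) : complex.Re (z + w) = complex.Re z + complex.Re w.
Proof. by case: z; case: w. Qed.

Lemma ipDl x y z : ip (x + y) z = ip x z + ip y z.
Proof. by rewrite /ip linearDl /= ReD. Qed.

Lemma dotZl c x z : dot (c *: x) z = c * dot x z.
Proof. by rewrite linearZl_LR. Qed.

Lemma dotZr c x z : dot x (c *: z) = Num.conj c * dot x z.
Proof. by rewrite linearZr_LR. Qed.

Lemma conjE (a b : R) : Num.conj (a +i* b) = a +i* - b.
Proof. by []. Qed.

Lemma ipZl (a : R) x z : ip (a%:C *: x) z = a * ip x z.
Proof. by rewrite /ip dotZl; case: (dot x z) => p q /=; ring. Qed.

Lemma ipNl x z : ip (- x) z = - ip x z.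
Proof. by rewrite -scaleN1r -(rmorph1 (real_complex R)) -rmorphN ipZl mulN1r. Qed.

Lemma ipBl x y z : ip (x - y) z = ip x z - ip y z.
Proof. by rewrite ipDl ipNl. Qed.

Lemma ipC x y : ip x y = ip y x.
Proof.
have conj_Re (z : R[i]) : complex.Re (Num.conj z) = complex.Re z by case: z.
by rewrite /ip (hermC dot) expr0 mul1r; exact: conj_Re.
Qed.

Lemma ipBr x y z : ip z (x - y) = ip z x - ip z y.
Proof. by rewrite !(ipC z) ipBl. Qed.

Lemma ipDr x y z : ip z (x + y) = ip z x + ip z y.
Proof. by rewrite !(ipC z) ipDl. Qed.

Lemma ipxx x : ip x x = nrm x ^+ 2.
Proof. by rewrite /ip -hd nrmE -rmorphXn. Qed.

Lemma nrmD2 x y : nrm (x + y) ^+ 2 = nrm x ^+ 2 + 2 * ip x y + nrm y ^+ 2.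
Proof. by rewrite -!ipxx ipDl !ipDr (ipC y x); ring. Qed.

Lemma nrmB2 x y : nrm (x - y) ^+ 2 = nrm x ^+ 2 - 2 * ip x y + nrm y ^+ 2.
Proof. by rewrite -!ipxx ipBl !ipBr (ipC y x); ring. Qed.

(** Polarization: [nrm (x + y)] and [nrm (x - y)] differ by at most twice the smaller of the two
    norms and add up to at most four times the larger. The factor 2, lost against Cauchy-Schwarz,
    only enlarges later constants. *)
Lemma ip_bound x y : `|ip x y| <= 2 * nrm y * nrm x.
Proof.
have e : 4 * ip x y = (nrm (x + y) - nrm (x - y)) * (nrm (x + y) + nrm (x - y)).
  by rewrite -subr_sqr nrmD2 nrmB2; ring.
have X0 := nrm_ge0 x; have Y0 := nrm_ge0 y.
have := nrmD x y; have := nrmD x (- y); have := nrmBD x y; have := nrmBD y x.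
have := nrmBD x (- y); have := nrmBD y (- x); rewrite !opprK !nrmN (nrmB y) (addrC y).
move: (nrm x) (nrm y) (nrm (x + y)) (nrm (x - y)) X0 Y0 e => X Y p q X0 Y0 e *.
have pq0 : 0 <= p + q by lra.
have main (Z W : R) : 0 <= Z -> `|p - q| <= 2 * Z -> p + q <= 4 * W -> `|ip x y| <= 2 * Z * W.
  move=> Z0 h1 h2.
  have : `|4 * ip x y| <= (2 * Z) * (4 * W).
    by rewrite e normrM (ger0_norm pq0); apply: ler_pM.
  by rewrite normrM (ger0_norm (x := 4)) //; lra.
have [XY|YX] := lerP X Y.
  rewrite mulrAC; apply: main => //; last lra.
  by rewrite ler_norml; apply/andP; split; lra.
apply: main => //; last lra.
by rewrite ler_norml; apply/andP; split; lra.
Qed.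

Section Cone.
Variables (B : banachLatticeType R) (iota : B -> E) (hc : complexification iota).

(** Both [f - g] and [g - f] are below [f + g], so the lattice norm satisfies
    [nrm (f - g) <= nrm (f + g)]; squaring leaves the sign of the inner product. *)
Lemma ip_cone x y : positive_cone iota x -> positive_cone iota y -> 0 <= ip x y.
Proof.
move=> [f /= f0 <-] [g /= g0 <-].
have : nrm (iota f - iota g) <= nrm (iota f + iota g).
  rewrite -(ciotaB hc) -(ciotaD hc) !(nrm_iota hc).
  have fN := ble_opp f0; have gN := ble_opp g0; rewrite oppr0 in fN gN.
  apply: bnorm_le; first by rewrite ble_add ?blat_le_refl //; exact: blat_le_trans g0.
  rewrite opprB addrC ble_add ?blat_le_refl //; exact: blat_le_trans f0.
move=> h; have : nrm (iota f - iota g) ^+ 2 <= nrm (iota f + iota g) ^+ 2.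
  by rewrite lerXn2r ?nnegrE ?nrm_ge0.
rewrite nrmB2 (nrmD2 (iota f) (iota g)); lra.
Qed.

End Cone.

Lemma ip_cexp (k t s : R) x y :
  ip (cexp (0 +i* k) t *: x) (cexp (0 +i* k) s *: y) =
  cos (k * (t - s)) * ip x y + sin (k * (t - s)) * jp x y.
Proof.
rewrite /ip dotZl dotZr /cexp /= mulrBr cosB sinB.
rewrite !mul0r oppr0 expR0 conjE /jp; case: (dot x y) => p q /=; ring.
Qed.

Lemma ip_fejer n (t s : R) x y :
  \sum_(p : 'I_n * 'I_n) ip (cexp (0 +i* freq p) t *: x) (cexp (0 +i* freq p) s *: y) =
  fejer n (t - s) * ip x y.
Proof.
rewrite (eq_bigr _ (fun p _ => ip_cexp (freq p) t s x y)) big_split /=.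
by rewrite -!mulr_suml sum_sin_freq mul0r addr0.
Qed.

(* Applied with [D i t] an orbit at frequency [i], the sum of the [ip (D i t) (D i s)]
   is the Fejer kernel at [t - s] times the inner product of the unmodulated orbits. *)
Lemma ip_rectangle (I : Type) (r : seq I) (Y1 D1 Y2 D2 : I -> R -> E) (c1 c2 a b a' b' : R) :
  0 <= a -> a <= b -> 0 <= a' -> a' <= b' ->
  (forall i t, 0 <= t -> rdE (Y1 i) t (D1 i t)) -> (forall i t, 0 < t -> lcE (Y1 i) t) ->
  (forall i t, 0 <= t -> rdE (Y2 i) t (D2 i t)) -> (forall i t, 0 < t -> lcE (Y2 i) t) ->
  (forall t s, a <= t < b -> a' <= s < b' ->
     0 <= c1 * (\sum_(i <- r) ip (D1 i t) (D1 i s)) + c2 * (\sum_(i <- r) ip (D2 i t) (D2 i s))) ->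
  0 <= c1 * (\sum_(i <- r) ip (Y1 i b - Y1 i a) (Y1 i b' - Y1 i a')) +
    c2 * (\sum_(i <- r) ip (Y2 i b - Y2 i a) (Y2 i b' - Y2 i a')).
Proof.
move=> a0 ab a'0 ab' d1 l1 d2 l2 h.
have dl (F : R -> E) D v t : rdE F t D -> rdR (fun t => ip (F t) v) t (ip D v).
  apply: (rdR_comp (L := fun x => ip x v) (C := 2 * nrm v)).
  - by move=> x y; exact: ipBl.
  - by move=> c x; exact: ipZl.
  - by move=> x; exact: ip_bound.
have ll (F : R -> E) v t : lcE F t -> lcR (fun t => ip (F t) v) t.
  apply: (lcR_comp (L := fun x => ip x v) (C := 2 * nrm v)).
  - by move=> x y; exact: ipBl.
  - by move=> x; exact: ip_bound.
have dr (F : R -> E) D v t : rdE F t D -> rdR (fun t => ip v (F t)) t (ip v D).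
  by move=> /(dl _ _ v); rewrite ipC; apply: rdR_ext => s; exact: ipC.
have lr (F : R -> E) v t : lcE F t -> lcR (fun t => ip v (F t)) t.
  by move=> /(ll _ v); apply: lcR_ext => s; exact: ipC.
pose phi (F G : I -> R -> E) (t s : R) := \sum_(i <- r) ip (F i t) (G i s).
have := @rectangle_ge0 R
  (fun t s => c1 * phi Y1 Y1 t s + c2 * phi Y2 Y2 t s)
  (fun t s => c1 * phi D1 Y1 t s + c2 * phi D2 Y2 t s)
  (fun t s => c1 * phi D1 D1 t s + c2 * phi D2 D2 t s) a b a' b' ab ab'.
have -> : c1 * (\sum_(i <- r) ip (Y1 i b - Y1 i a) (Y1 i b' - Y1 i a')) +
    c2 * (\sum_(i <- r) ip (Y2 i b - Y2 i a) (Y2 i b' - Y2 i a')) =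
  (c1 * phi Y1 Y1 b b' + c2 * phi Y2 Y2 b b') - (c1 * phi Y1 Y1 b a' + c2 * phi Y2 Y2 b a')
  - (c1 * phi Y1 Y1 a b' + c2 * phi Y2 Y2 a b') + (c1 * phi Y1 Y1 a a' + c2 * phi Y2 Y2 a a').
  have e (F : I -> R -> E) : \sum_(i <- r) ip (F i b - F i a) (F i b' - F i a') =
    phi F F b b' - phi F F b a' - phi F F a b' + phi F F a a'.
    rewrite /phi -!sumrB -big_split /=; apply: eq_bigr => i _.
    by rewrite ipBl !ipBr; ring.
  by rewrite !e; ring.
apply.
- move=> s t sb tb; apply: rdR_lin; apply: rdR_sum => i; apply: dl; [apply: d1|apply: d2]; lra.
- move=> s t sb tb; apply: lcR_lin; apply: lcR_sum => i; apply: ll; [apply: l1|apply: l2]; lra.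
- move=> s t sb tb; apply: rdR_lin; apply: rdR_sum => i; apply: dr; [apply: d1|apply: d2]; lra.
- move=> s t sb tb; apply: lcR_lin; apply: lcR_sum => i; apply: lr; [apply: l1|apply: l2]; lra.
- by move=> s t sb tb; exact: h.
Qed.

End InnerProducts.

(** * Square sums of resolvents and of orbit integrals *)

Section HilbertDecay.
Context {R : realType} {B : banachLatticeType R} {E : completeNormedModType R[i]}.
Variables (iota : B -> E) (hc : complexification iota).
Variables (dot : {dot E for (@Num.conj R[i])}) (hd : forall x : E, `|x| ^+ 2 = dot x x).
Local Notation cone := (positive_cone iota).
Local Notation ip := (ip dot).
Variables (Q : R -> E -> E) (sQ : semigroup Q).
Variables (v : R) (Rs : R[i] -> E -> E).
Hypothesis iR : forall l, v <= complex.Re l -> inverts (twist l Q) (Rs l).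

Lemma rdE_opp (F : R -> E) t D : rdE F t D -> rdE (fun t => - F t) t (- D).
Proof.
move=> h; have := rdE_lin (-1) 0 h (rdE_const 0 t); rewrite scaleN1r scaler0 addr0.
by apply: rdE_ext => s; rewrite scaleN1r addr0.
Qed.

Lemma lcE_opp (F : R -> E) t : lcE F t -> lcE (fun t => - F t) t.
Proof.
move=> h; have := lcE_lin (-1) 0 h (lcE_const 0 t).
by apply: lcE_ext => s; rewrite scaleN1r scaler0 addr0.
Qed.

(** A primitive of the orbit of [f]; the sign is due to the generator of [twist l Q] sending
    [Rs l f] to [- f]. *)
Definition antider (l : R[i]) (f : E) (t : R) : E := - twist l Q t (Rs l f).

Lemma antider_rd l f t : v <= complex.Re l -> 0 <= t ->
  rdE (antider l f) t (twist l Q t f).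
Proof.
move=> vl t0; rewrite -[twist l Q t f]opprK; apply: rdE_opp.
exact: (inverts_orbit (twist_sg sQ l) f (iR vl)).
Qed.

Lemma antider_lc l f t : 0 < t -> lcE (antider l f) t.
Proof. by move=> t0; apply: lcE_opp; apply: (sg_lc (twist_sg sQ l)). Qed.

Lemma antiderB l f t : antider l f t - antider l f 0 = Rs l f - twist l Q t (Rs l f).
Proof. by rewrite /antider (sg0 (twist_sg sQ l)) opprK addrC. Qed.

Definition lam (n : nat) (a : R) (p : 'I_n * 'I_n) : R[i] := (0 +i* freq p) + a%:C.

Lemma Re_lam n a (p : 'I_n * 'I_n) : complex.Re (lam a p) = a.
Proof. by rewrite /lam /= add0r. Qed.

Lemma twist_lam n a (p : 'I_n * 'I_n) t x :
  twist (lam a p) Q t x = cexp (0 +i* freq p) t *: twist a%:C Q t x.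
Proof. by rewrite /lam -twistD. Qed.

Lemma nrm_twist_lam n a (p : 'I_n * 'I_n) t x :
  nrm (twist (lam a p) Q t x) = nrm (twist a%:C Q t x).
Proof. by rewrite twist_lam nrmZ normc_cexp /= mul0r oppr0 expR0 mul1r. Qed.

Lemma fejer_orbits n a t s f :
  \sum_(p : 'I_n * 'I_n) ip (twist (lam a p) Q t f) (twist (lam a p) Q s f) =
  fejer n (t - s) * ip (twist a%:C Q t f) (twist a%:C Q s f).
Proof.
by rewrite -ip_fejer; apply: eq_bigr => p _; rewrite !twist_lam.
Qed.

(* The orbit [expR (- t) f], to which orbits of exponential type below -1 are
   compared, has an explicit antiderivative at each frequency. *)
Lemma scalar_orbit_antider (k : R) (f : E) : exists Z : R -> E,
  [/\ forall t, 0 <= t -> rdE Z t (cexp ((0 +i* k) + 1%:C) t *: f),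
      forall t, 0 < t -> lcE Z t &
      forall t, 0 <= t -> nrm (Z t - Z 0) ^+ 2 <= 4 * nrm f ^+ 2 * (1 + k ^+ 2)^-1].
Proof.
pose l : R[i] := (0 +i* k) + 1%:C.
have sI : semigroup (fun (_ : R) (x : E) => x).
  split=> // [L|x e e0]; first by exists 1 => // t x _; rewrite mul1r.
  by exists 1 => // h _; rewrite subrr nrm0 ltW.
have sl := twist_sg sI l.
have l0 : l != 0 by rewrite /l eq_complex /= add0r oner_eq0.
have nl : normc l ^+ 2 = 1 + k ^+ 2.
  by rewrite /l /= sqr_sqrtr ?addr_ge0 ?sqr_ge0 // add0r addr0 expr1n.
exists (fun t => - (cexp l t *: (l^-1 *: f))); split.
- move=> t t0.
  have h := sg_rd sl t0 (twist_rd sI l (rdE_const (l^-1 *: f) 0)).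
  have := rdE_opp h; rewrite /twist sub0r scalerA mulfV // scale1r scalerN opprK.
  exact.
- by move=> t t0; apply: lcE_opp; apply: (sg_lc sl).
- move=> t t0; rewrite cexp0 scale1r opprK addrC.
  have h1 : nrm (l^-1 *: f - cexp l t *: (l^-1 *: f)) <= 2 * nrm (l^-1 *: f).
    apply: le_trans (nrmD _ _) _; rewrite nrmN [X in _ + X <= _]nrmZ normc_cexp.
    have h : expR (- (complex.Re l * t)) <= 1.
      by rewrite -expR0 ler_expR oppr_le0 mulr_ge0 // /l /= add0r.
    have : expR (- (complex.Re l * t)) * nrm (l^-1 *: f) <= 1 * nrm (l^-1 *: f).
      by rewrite ler_wpM2r ?nrm_ge0.
    lra.
  have h2 : nrm (l^-1 *: f) ^+ 2 = nrm f ^+ 2 * (1 + k ^+ 2)^-1.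
    rewrite nrmZ ComplexField.Normc.normcV exprMn exprVn nl mulrC //.
  rewrite -mulrA -h2 (_ : 4 * _ = (2 * nrm (l^-1 *: f)) ^+ 2); last by ring.
  by rewrite lerXn2r ?nnegrE ?mulr_ge0 ?nrm_ge0.
Qed.

(** The inner products of the orbit are at most [2 * C ^+ 2] times those of [expR (- t) f], and the
    nonnegative Fejer kernel carries this over to square sums of integrals. The constant is 256 = 4
    * 2 * 4 * 8: the passage from integrals to resolvents, [ip_bound], [scalar_orbit_antider] and
    [sum_inv_freq]. *)
Lemma resolvent_sum_upper (a C : R) f n : v <= a -> 0 <= C ->
  (forall t x, 0 <= t -> nrm (twist a%:C Q t x) <= C * expR (- t) * nrm x) ->
  \sum_(p : 'I_n * 'I_n) nrm (Rs (lam a p) f) ^+ 2 <= 256 * (C * nrm f) ^+ 2 * n%:R.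
Proof.
move=> va C0 hC.
have vl (p : 'I_n * 'I_n) : v <= complex.Re (lam a p) by rewrite Re_lam.
(* By this time the operator norm is at most 1/2, so the integral up to [t] has at least half the
   norm of the resolvent. *)
have [t t0 ht] := exp_small C (d := 1) (e := 1 / 2) ltr01 ltac:(lra).
rewrite mul1r in ht.
have /boolp.choice[Z hZ] : forall p : 'I_n * 'I_n, exists Z : R -> E,
  [/\ forall t, 0 <= t -> rdE Z t (cexp ((0 +i* freq p) + 1%:C) t *: f),
      forall t, 0 < t -> lcE Z t &
      forall t, 0 <= t -> nrm (Z t - Z 0) ^+ 2 <= 4 * nrm f ^+ 2 * (1 + freq p ^+ 2)^-1].
  by move=> p; exact: scalar_orbit_antider.
have h : \sum_(p : 'I_n * 'I_n) ip (antider (lam a p) f t - antider (lam a p) f 0)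
      (antider (lam a p) f t - antider (lam a p) f 0) <=
    2 * C ^+ 2 * \sum_(p : 'I_n * 'I_n) ip (Z p t - Z p 0) (Z p t - Z p 0).
  rewrite -subr_ge0 -mulN1r.
  apply: (@ip_rectangle _ _ dot hd _ (index_enum ('I_n * 'I_n)%type) Z
    (fun p t => cexp ((0 +i* freq p) + 1%:C) t *: f)
    (fun p => antider (lam a p) f) (fun p t => twist (lam a p) Q t f)
    (2 * C ^+ 2) (-1) 0 t 0 t (lexx _) t0 (lexx _) t0).
- by move=> p s s0; case: (hZ p) => h _ _; exact: h.
- by move=> p s s0; case: (hZ p) => _ h _; exact: h.
- by move=> p s s0; exact: antider_rd.
- by move=> p s s0; exact: antider_lc.
- move=> r s /andP[r0 _] /andP[s0 _].
  rewrite fejer_orbits.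
  rewrite (eq_bigr (fun p : 'I_n * 'I_n => ip (cexp (0 +i* freq p) r *: ((expR (- r))%:C *: f))
     (cexp (0 +i* freq p) s *: ((expR (- s))%:C *: f)))); last first.
    move=> p _; rewrite !cexpDl !cexp_real !mul1r !scalerA //.
  rewrite ip_fejer mulrCA [_ * (fejer n _ * _)]mulrCA -mulrDr; apply: mulr_ge0.
    exact: fejer_ge0.
  rewrite ipZl ipC ipZl ipxx // mulN1r subr_ge0.
  apply: le_trans (ler_norm _) _; apply: le_trans (ip_bound hd _ _) _.
  have h1 := hC r f r0; have h2 := hC s f s0.
  have : nrm (twist a%:C Q s f) * nrm (twist a%:C Q r f) <=
    (C * expR (- s) * nrm f) * (C * expR (- r) * nrm f).
    by apply: ler_pM; rewrite ?nrm_ge0.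
  lra.
have h2 : \sum_(p : 'I_n * 'I_n) nrm (Z p t - Z p 0) ^+ 2 <= 4 * nrm f ^+ 2 * (8 * n%:R).
  apply: (@le_trans _ _ (\sum_(p : 'I_n * 'I_n) 4 * nrm f ^+ 2 * (1 + freq p ^+ 2)^-1)).
    by apply: ler_sum => p _; case: (hZ p) => _ _ h'; exact: h'.
  by rewrite -mulr_sumr ler_wpM2l ?sum_inv_freq // mulr_ge0 // sqr_ge0.
have h3 (p : 'I_n * 'I_n) : nrm (Rs (lam a p) f) ^+ 2 <=
    4 * ip (antider (lam a p) f t - antider (lam a p) f 0)
      (antider (lam a p) f t - antider (lam a p) f 0).
  rewrite ipxx // (_ : 4 * _ = (2 * nrm (antider (lam a p) f t - antider (lam a p) f 0)) ^+ 2); last by ring.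
  rewrite lerXn2r ?nnegrE ?mulr_ge0 ?nrm_ge0 //.
  rewrite antiderB.
  have := nrmBD (Rs (lam a p) f) (twist (lam a p) Q t (Rs (lam a p) f)).
  have := hC t (Rs (lam a p) f) t0; rewrite -(nrm_twist_lam a p) => h4.
  have : C * expR (- t) * nrm (Rs (lam a p) f) <= 1 / 2 * nrm (Rs (lam a p) f).
    by rewrite ler_wpM2r ?nrm_ge0.
  lra.
apply: le_trans (ler_sum _ (fun p _ => h3 p)) _; rewrite -mulr_sumr.
have h4 : \sum_(p : 'I_n * 'I_n) ip (Z p t - Z p 0) (Z p t - Z p 0) <= 4 * nrm f ^+ 2 * (8 * n%:R).
  by apply: le_trans h2; apply: ler_sum => p _; rewrite ipxx.
have h5 : 2 * C ^+ 2 * (\sum_(p : 'I_n * 'I_n) ip (Z p t - Z p 0) (Z p t - Z p 0)) <=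
  2 * C ^+ 2 * (4 * nrm f ^+ 2 * (8 * n%:R)).
  by rewrite ler_wpM2l // mulr_ge0 // sqr_ge0.
rewrite exprMn; lra.
Qed.

Section PositiveOrbit.
Variables (f : E) (pf : pos_from iota Q 0 f).

Let upos (a t : R) : 0 <= t -> cone (twist a%:C Q t f).
Proof. by move=> t0; apply/(cone_twist hc); apply: pf. Qed.

(** This represents the double integral of [fejer n (x - y)] times the inner product of the orbit at
    [x] and at [y], over the square of side [[s, t]]. *)
Definition energy (n : nat) (a s t : R) :=
  \sum_(p : 'I_n * 'I_n) nrm (antider (lam a p) f t - antider (lam a p) f s) ^+ 2.

(** The square on [[r, t]] consists of those on [[r, s]] and [[s, t]] and two rectangles, where the
    integrand is nonnegative by positivity of the orbit and of the kernel. *)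
Lemma energy_superadditive n a r s t : v <= a -> 0 <= r -> r <= s -> s <= t ->
  energy n a r s + energy n a s t <= energy n a r t.
Proof.
move=> va r0 rs st; rewrite /energy -big_split /=.
have vl (p : 'I_n * 'I_n) : v <= complex.Re (lam a p) by rewrite Re_lam.
pose Y p := antider (@lam n a p) f.
have : 0 <= \sum_(p : 'I_n * 'I_n) ip (Y p s - Y p r) (Y p t - Y p s).
  have := @ip_rectangle _ _ dot hd _ (index_enum ('I_n * 'I_n)%type)
    Y (fun p t => twist (lam a p) Q t f) Y (fun p t => twist (lam a p) Q t f)
    1 0 r s s t r0 rs (le_trans r0 rs) st.
  rewrite mul1r mul0r addr0; apply.
  - by move=> p x x0; exact: antider_rd.
  - by move=> p x x0; exact: antider_lc.
  - by move=> p x x0; exact: antider_rd.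
  - by move=> p x x0; exact: antider_lc.
  - move=> x y xb yb; rewrite mul1r mul0r addr0 fejer_orbits mulr_ge0 ?fejer_ge0 //.
    by apply: (ip_cone hd hc); apply: upos; lra.
move=> h; rewrite -subr_ge0 -sumrB.
have -> : \sum_(p : 'I_n * 'I_n) (nrm (antider (lam a p) f t - antider (lam a p) f r) ^+ 2 -
   (nrm (antider (lam a p) f s - antider (lam a p) f r) ^+ 2 +
    nrm (antider (lam a p) f t - antider (lam a p) f s) ^+ 2)) =
  \sum_(p : 'I_n * 'I_n) 2 * ip (Y p s - Y p r) (Y p t - Y p s).
  apply: eq_bigr => p _.
  have -> : antider (lam a p) f t - antider (lam a p) f r =
    (Y p s - Y p r) + (Y p t - Y p s) by rewrite [RHS]addrC addrA subrK.
  by rewrite (nrmD2 hd) /Y; ring.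
by rewrite -mulr_sumr mulr_ge0.
Qed.

Lemma energy_ge0 n a s t : 0 <= energy n a s t.
Proof. by apply: sumr_ge0 => p _; exact: sqr_ge0. Qed.

(** The whole square lies within [1 / n] of the diagonal, where the kernel is at least
    [n^2 cos 1]. *)
Lemma energy_diagonal n a s t : v <= a -> 0 <= s -> s <= t -> t - s <= n%:R^-1 ->
  cos 1 * n%:R ^+ 2 * nrm (antider a%:C f t - antider a%:C f s) ^+ 2 <= energy n a s t.
Proof.
move=> va s0 st tsn.
have vl (p : 'I_n * 'I_n) : v <= complex.Re (lam a p) by rewrite Re_lam.
pose Y (p : 'I_n * 'I_n) := antider (lam a p) f.
pose X (p : 'I_n * 'I_n) := antider a%:C f.
have e x y : \sum_(p : 'I_n * 'I_n) ip x y = n%:R ^+ 2 * ip x y.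
  by rewrite sumr_const card_prod card_ord expr2 -natrM mulr_natl.
have h : cos 1 * \sum_(p : 'I_n * 'I_n) ip (X p t - X p s) (X p t - X p s) <=
    \sum_(p : 'I_n * 'I_n) ip (Y p t - Y p s) (Y p t - Y p s).
  rewrite -subr_ge0 -mulNr -[X in 0 <= X + _]mul1r.
  apply: (@ip_rectangle _ _ dot hd _ (index_enum ('I_n * 'I_n)%type)
    Y (fun p t => twist (lam a p) Q t f) X (fun p t => twist a%:C Q t f)
    1 (- cos 1) s t s t s0 st s0 st).
- by move=> p x x0; exact: antider_rd.
- by move=> p x x0; exact: antider_lc.
- by move=> p x x0; exact: antider_rd.
- by move=> p x x0; exact: antider_lc.
- move=> x y xb yb; rewrite fejer_orbits e mul1r mulNr subr_ge0 mulrA.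
  rewrite ler_wpM2r //.
    by apply: (ip_cone hd hc); apply: upos; lra.
  have := @fejer_ge R n (x - y); rewrite sumr_const card_prod card_ord.
  rewrite expr2 -natrM mulr_natr; apply.
  by apply: le_trans tsn; rewrite ler_norml; apply/andP; split; lra.
rewrite /X e ipxx // mulrA in h; apply: le_trans h _.
by rewrite /energy; apply: ler_sum => p _; rewrite ipxx.
Qed.

(** Keeps the [N] squares of side [1 / n] strung along the diagonal. *)
Lemma energy_lower n a N : (0 < n)%N -> v <= a ->
  cos 1 * n%:R ^+ 2 * (\sum_(0 <= j < N)
    nrm (antider a%:C f (j.+1%:R / n%:R) - antider a%:C f (j%:R / n%:R)) ^+ 2)
  <= energy n a 0 (N%:R / n%:R).
Proof.
move=> n0 va; have np : 0 < n%:R :> R by rewrite ltr0n.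
elim: N => [|N IH]; first by rewrite big_geq // mulr0 energy_ge0.
rewrite big_nat_recr //= mulrDr.
have hN : N.+1%:R / n%:R - N%:R / n%:R = n%:R^-1 :> R by rewrite -natr1; field; rewrite gt_eqF.
have NN : N%:R / n%:R <= N.+1%:R / n%:R :> R by rewrite -subr_ge0 hN invr_ge0.
have N0 : 0 <= N%:R / n%:R :> R by rewrite divr_ge0.
apply: le_trans (energy_superadditive n va (lexx 0) N0 NN).
by apply: lerD IH _; apply: energy_diagonal; rewrite // hN.
Qed.

(** Superadditivity allows [t] to be replaced by a later time at which the rescaled operator is a
    contraction; there each integral is a resolvent vector minus one of no greater norm. *)
Lemma energy_upper n a t : v <= a -> 0 <= t ->
  (exists2 s, t <= s & forall x, nrm (twist a%:C Q s x) <= nrm x) ->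
  energy n a 0 t <= 4 * \sum_(p : 'I_n * 'I_n) nrm (Rs (lam a p) f) ^+ 2.
Proof.
move=> va t0 [s ts hs].
apply: (@le_trans _ _ (energy n a 0 s)).
  have := energy_superadditive n va (lexx 0) t0 ts; have := energy_ge0 n a t s; lra.
rewrite mulr_sumr; apply: ler_sum => p _.
rewrite (_ : 4 * _ = (2 * nrm (Rs (lam a p) f)) ^+ 2); last by ring.
rewrite lerXn2r ?nnegrE ?mulr_ge0 ?nrm_ge0 // antiderB.
apply: le_trans (nrmD _ _) _; rewrite nrmN nrm_twist_lam.
have := hs (Rs (lam a p) f); lra.
Qed.

End PositiveOrbit.

End HilbertDecay.

(** * Datko's argument, uniformly above the growth bound *)

Section HilbertBound.
Context {R : realType} {B : banachLatticeType R} {E : completeNormedModType R[i]}.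
Variables (iota : B -> E) (hc : complexification iota).
Variables (dot : {dot E for (@Num.conj R[i])}) (hd : forall x : E, `|x| ^+ 2 = dot x x).
Local Notation cone := (positive_cone iota).
Variables (Q : R -> E -> E) (sQ : semigroup Q).
Hypothesis iep : forall f, cone f -> exists2 t0 : R, 0 <= t0 & pos_from iota Q t0 f.

Lemma sqr_le_bound (x C : R) : x ^+ 2 <= C -> x <= C + 1.
Proof. by move=> h; have := sqr_ge0 (x - 1); nra. Qed.

(** Uniform boundedness over all pairs of a rate [a] and a time [n], with weight 1 for boundedness
    and then weight [n] for decay. The growth conditions on [wt] allow [f] to be replaced by
    [Q k f], positive from time 0, at the cost of a factor [k + 1]. *)
Lemma uniform_decay (wt : nat -> R) (A : R -> Prop) (c0 : R) : 0 <= c0 ->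
  (forall a, A a -> `|a| <= c0) ->
  (forall n, 0 <= wt n <= n%:R + 1) ->
  (forall n k, (0 < n)%N -> wt (n + k)%N <= (k%:R + 1) * wt n) ->
  (forall f, pos_from iota Q 0 f -> exists C, forall a n, A a -> (0 < n)%N ->
     wt n * nrm (twist a%:C Q n%:R f) ^+ 2 <= C) ->
  exists2 C, 0 <= C & forall a n x, A a ->
    Num.sqrt (wt n) * nrm (twist a%:C Q n%:R x) <= C * nrm x.
Proof.
move=> c00 hA w1 w2 hw.
pose I := ({a : R | A a} * nat)%type.
have [|||C C0 hC] := @uniform_boundedness_linear _ E I
  (fun i x => (Num.sqrt (wt i.2))%:C *: twist (sval i.1)%:C Q i.2%:R x).
- move=> i c x y; rewrite (sg_lin (twist_sg sQ _)) scalerDr !scalerA.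
  by rewrite [c * _]mulrC.
- move=> i; have [N _ hN] := sg_bd (twist_sg sQ (sval i.1)%:C) i.2%:R.
  exists (`|Num.sqrt (wt i.2)| * N) => x; rewrite nrmZr -mulrA ler_wpM2l //.
  by rewrite hN // ler0n lexx.
- apply: (pointwise_bounded_cone hc) => [i c x y|f cf].
    by rewrite (sg_lin (twist_sg sQ _)) scalerDr !scalerA [c * _]mulrC.
  have [t0 t00 pf] := iep cf.
  pose k := Num.bound t0.
  have tk : t0 <= k%:R by apply: ltW; apply: archi_boundP.
  have pk : pos_from iota Q 0 (Q k%:R f).
    by move=> t tp; rewrite -(sgD sQ) //; apply: pf; lra.
  have [C1 hC1] := hw _ pk.
  have [N N0 hN] := sg_bd sQ k%:R.
  pose b := expR (c0 * k%:R).
  have b0 : 0 < b by exact: expR_gt0.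
  have ba a (r : R) : A a -> 0 <= r <= k%:R -> expR (- (a * r)) <= b.
    move=> /hA ha rk; rewrite ler_expR -mulNr.
    have h := ler_norm (- a); rewrite normrN in h.
    apply: (@le_trans _ _ (c0 * r)); last by apply: ler_wpM2l; lra.
    apply: ler_wpM2r; lra.
  exists ((k%:R + 1) * (b * (N * nrm f)) ^+ 2 + b ^+ 2 * ((k%:R + 1) * `|C1|) + 1).
  move=> [[a Aa] n] /=; rewrite nrmZr ger0_norm ?sqrtr_ge0 //.
  apply: sqr_le_bound; rewrite exprMn sqr_sqrtr; last by case/andP: (w1 n).
  have z1 : 0 <= (k%:R + 1) * (b * (N * nrm f)) ^+ 2 by rewrite mulr_ge0 ?sqr_ge0 // addr_ge0.
  have z2 : 0 <= b ^+ 2 * ((k%:R + 1) * `|C1|).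
    by rewrite mulr_ge0 ?sqr_ge0 // mulr_ge0 // addr_ge0.
  have [nk|kn] := leqP n k.
    suff : wt n * nrm (twist a%:C Q n%:R f) ^+ 2 <= (k%:R + 1) * (b * (N * nrm f)) ^+ 2 by lra.
    have nk' : n%:R <= k%:R :> R by rewrite ler_nat.
    have w10 := w1 n; apply: ler_pM; rewrite ?sqr_ge0 //; try lra.
    rewrite lerXn2r ?nnegrE ?nrm_ge0 //; first by rewrite !mulr_ge0 ?nrm_ge0 // ltW.
    rewrite nrm_twist_real; apply: ler_pM; rewrite ?expR_ge0 ?nrm_ge0 //.
      by apply: ba; rewrite ?ler0n.
    by apply: hN; rewrite ler0n.
  suff : wt n * nrm (twist a%:C Q n%:R f) ^+ 2 <= b ^+ 2 * ((k%:R + 1) * `|C1|) by lra.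
  have nE : n = (n - k + k)%N by rewrite subnK // ltnW.
  have nk0 : (0 < n - k)%N by rewrite subn_gt0.
  have -> : twist a%:C Q n%:R f = cexp a%:C k%:R *: twist a%:C Q (n - k)%:R (Q k%:R f).
    by rewrite /twist scalerA -cexpD -(sgD sQ) // -!natrD subnKC ?subnK // ltnW.
  rewrite nrmZ normc_cexp /= exprMn mulrCA; apply: ler_pM; rewrite ?sqr_ge0 //.
  - by rewrite mulr_ge0 ?sqr_ge0 //; case/andP: (w1 n).
  - rewrite lerXn2r ?nnegrE ?expR_ge0 ?(ltW b0) //.
    by apply: ba; rewrite ?lexx ?ler0n.
  have h1 := hC1 a (n - k)%N Aa nk0; have h2 := w2 (n - k)%N k nk0; rewrite -nE in h2.
  apply: (@le_trans _ _ ((k%:R + 1) * wt (n - k)%N * nrm (twist a%:C Q (n - k)%:R (Q k%:R f)) ^+ 2)).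
    by rewrite ler_wpM2r // sqr_ge0.
  rewrite -mulrA ler_wpM2l ?addr_ge0 //.
  exact: le_trans h1 (ler_norm _).
- exists C => // a n x Aa; have := hC (exist _ a Aa, n) x.
  by rewrite /= nrmZr ger0_norm // sqrtr_ge0.
Qed.

Variables (v m : R) (vm : v < m) (Rs : R[i] -> E -> E).
Hypothesis iR : forall l, v <= complex.Re l -> inverts (twist l Q) (Rs l).

Lemma bounded_upward (a b : R) : a <= b -> bounded_sg (twist a%:C Q) -> bounded_sg (twist b%:C Q).
Proof.
move=> ab [M hM]; exists M => t x t0; apply: le_trans (hM t x t0).
rewrite !nrm_twist_real ler_wpM2r ?nrm_ge0 // ler_expR lerN2.
by rewrite ler_wpM2r.
Qed.

Lemma eventually_contractive (a w : R) : w < a -> bounded_sg (twist w%:C Q) ->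
  forall t, exists2 s, t <= s & forall x, nrm (twist a%:C Q s x) <= nrm x.
Proof.
move=> wa [M hM] t.
have [r r0 hr] := exp_small `|M| (d := a - w) (e := 1) ltac:(lra) ltr01.
exists (Num.max r t); first by rewrite le_max lexx orbT.
set s := Num.max r t; have rs : r <= s by rewrite le_max lexx.
move=> x; have := hM s x (le_trans r0 rs); rewrite !nrm_twist_real => h.
have -> : expR (- (a * s)) = expR (- ((a - w) * s)) * expR (- (w * s)).
  by rewrite -expRD; congr expR; ring.
rewrite -mulrA.
have h1 : `|M| * expR (- ((a - w) * s)) <= 1.
  apply: le_trans hr; rewrite ler_wpM2l // ler_expR lerN2 ler_pM2l ?subr_gt0 //.
apply: (@le_trans _ _ (expR (- ((a - w) * s)) * (`|M| * nrm x))).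
  rewrite ler_wpM2l ?expR_ge0 //; apply: le_trans h _.
  by rewrite ler_wpM2r ?nrm_ge0 // ler_norm.
rewrite mulrA -[X in _ <= X]mul1r ler_wpM2r ?nrm_ge0 // mulrC //.
Qed.

(** The hypothesis with [K] is a discrete bound on the integral of the squared norm of the orbit. On
    [[s, t]] this norm is at least [q]; for [n] fine enough, depending on [f] and [a], each of the
    [n * (t - s)] cells has an increment of at least [q / (2 n)]. Hence [(t - s) * q^2 / 4 <= K],
    free of [n]. *)
Lemma orbit_decay (K a L : R) (s t : nat) f : v <= a -> 0 < L -> (s <= t)%N ->
  (forall n N, (0 < n)%N -> n%:R * (\sum_(0 <= j < N)
    nrm (antider Q Rs a%:C f (j.+1%:R / n%:R) - antider Q Rs a%:C f (j%:R / n%:R)) ^+ 2) <= K) ->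
  (forall r : R, s%:R <= r <= t%:R ->
     nrm (twist a%:C Q t%:R f) <= L * nrm (twist a%:C Q r f)) ->
  (t - s)%:R * nrm (twist a%:C Q t%:R f) ^+ 2 <= 4 * L ^+ 2 * K.
Proof.
move=> va L0 st hK hL; have sa := twist_sg sQ a%:C.
pose u r := twist a%:C Q r f.
pose q := nrm (u t%:R) / L.
have qE : nrm (twist a%:C Q t%:R f) = L * q by rewrite /q mulrCA mulfV ?mulr1 ?gt_eqF.
have K0 : 0 <= K by have := hK 1%N 0%N isT; rewrite big_geq // mulr0.
suff hq : (t - s)%:R * q ^+ 2 <= 4 * K.
  rewrite qE exprMn mulrCA; apply: le_trans (ler_wpM2l (sqr_ge0 L) hq) _.
  by rewrite mulrCA mulrA.
have [q0|q0] := eqVneq q 0; first by rewrite q0 expr0n mulr0 mulr_ge0.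
have {}q0 : 0 < q by rewrite lt_neqAle eq_sym q0 /q divr_ge0 ?nrm_ge0 // ltW.
have [d d0 hdd] := sg_unif sa f t%:R (e := q / 2) ltac:(lra).
pose n := (Num.bound d^-1).+1.
have n0 : 0 < n%:R :> R by rewrite ltr0n.
have nd : n%:R^-1 < d.
  rewrite -[d]invrK ltf_pV2 ?posrE ?invr_gt0 //.
  have := archi_boundP (ltW (x := 0) (y := d^-1) ltac:(by rewrite invr_gt0)).
  by move/lt_le_trans; apply; rewrite ler_nat.
have := hK n (n * t)%N isT.
have st' : (n * s <= n * t)%N by rewrite leq_mul2l st orbT.
rewrite (big_cat_nat (n := (n * s)%N)) //= => h.
have inc j : (n * s <= j < n * t)%N -> (q / (2 * n%:R)) ^+ 2 <=
    nrm (antider Q Rs a%:C f (j.+1%:R / n%:R) - antider Q Rs a%:C f (j%:R / n%:R)) ^+ 2.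
  move=> /andP[sj jt].
  pose r : R := j%:R / n%:R; pose r' : R := j.+1%:R / n%:R.
  have rr : r' = r + n%:R^-1 by rewrite /r' /r -natr1 mulrDl mul1r.
  have ni : 0 < n%:R^-1 :> R by rewrite invr_gt0.
  have r0 : s%:R <= r by rewrite /r ler_pdivlMr // mulrC -natrM ler_nat.
  have rt : r' <= t%:R by rewrite /r' ler_pdivrMr // mulrC -natrM ler_nat.
  have s0 : 0 <= s%:R :> R by [].
  have qn : 0 <= q / (2 * n%:R) by apply: divr_ge0; [exact: ltW|exact: mulr_ge0].
  rewrite lerXn2r ?nnegrE ?nrm_ge0 //.
  rewrite -/r -/r'.
  have h1 : nrm ((1 *: antider Q Rs a%:C f r' + (-1) *: (r'%:C *: u r)) -
      (1 *: antider Q Rs a%:C f r + (-1) *: (r%:C *: u r))) <= q / 2 * (r' - r).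
    apply: (mean_value (F := fun x => 1 *: antider Q Rs a%:C f x + (-1) *: (x%:C *: u r))
      (D := fun x => 1 *: twist a%:C Q x f + (-1) *: (1%:C *: u r))).
    - by rewrite rr lerDl ltW.
    - move=> x xb; apply: rdE_lin.
        by apply: (antider_rd sQ iR) => //; lra.
      apply: rdE_scale; have := rdR_linear 1 x; apply: rdR_ext => y; exact: mul1r.
    - move=> x xb; rewrite scale1r scaleN1r rmorph1 scale1r; apply: hdd.
      + by lra.
      + by lra.
      + move: nd rr xb; rewrite ltr_norml; move: (n%:R^-1) => ni' nd rr xb.
        by apply/andP; split; lra.
    - move=> x xb; apply: lcE_lin; first by apply: (antider_lc sQ); lra.
      apply: lcE_scale; have := lcR_linear 1 x; apply: lcR_ext => y; exact: mul1r.
  have e1 : (1 *: antider Q Rs a%:C f r' + (-1) *: (r'%:C *: u r)) -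
      (1 *: antider Q Rs a%:C f r + (-1) *: (r%:C *: u r)) =
      (antider Q Rs a%:C f r' - antider Q Rs a%:C f r) - (n%:R^-1)%:C *: u r.
    rewrite !scale1r !scaleN1r opprD opprK addrACA; congr (_ + _).
    rewrite opprK.    have -> : - (r'%:C *: u r) + r%:C *: u r = - ((r' - r)%:C *: u r).
      by rewrite rmorphB scalerBl opprB addrC.
    by rewrite rr addrAC subrr add0r.
  rewrite e1 rr [r + _ - r]addrAC subrr add0r -rr in h1.
  have h2 := nrmBD ((n%:R^-1)%:C *: u r) (antider Q Rs a%:C f r' - antider Q Rs a%:C f r).
  rewrite nrmZr gtr0_norm // nrmB in h2.
  have h3 : q <= nrm (u r).
    by rewrite /q ler_pdivrMr // mulrC; apply: hL; lra.
  have h4 : n%:R^-1 * q <= n%:R^-1 * nrm (u r) by rewrite ler_pM2l.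
  have -> : q / (2 * n%:R) = n%:R^-1 * q - q / 2 * n%:R^-1 by field; rewrite gt_eqF.
  lra.
have h1 : 0 <= \sum_(0 <= j < n * s)
    nrm (antider Q Rs a%:C f (j.+1%:R / n%:R) - antider Q Rs a%:C f (j%:R / n%:R)) ^+ 2.
  by apply: sumr_ge0 => j _; exact: sqr_ge0.
have h2 : \sum_(n * s <= j < n * t) (q / (2 * n%:R)) ^+ 2 <= \sum_(n * s <= j < n * t)
    nrm (antider Q Rs a%:C f (j.+1%:R / n%:R) - antider Q Rs a%:C f (j%:R / n%:R)) ^+ 2.
  by apply: ler_sum_nat => j jb; exact: inc.
rewrite sumr_const_nat -mulnBr -[_ *+ (_ * _)]mulr_natl natrM in h2.
have h3 : n%:R * (n%:R * (t - s)%:R * (q / (2 * n%:R)) ^+ 2) = (t - s)%:R * q ^+ 2 / 4.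
  by field; rewrite gt_eqF.
have h4 := le_trans (lerD h1 h2) (lexx _); rewrite add0r in h4.
have h5 : n%:R * (n%:R * (t - s)%:R * (q / (2 * n%:R)) ^+ 2) <= K.
  by apply: le_trans h; rewrite ler_pM2l.
rewrite h3 in h5; lra.
Qed.

Lemma bounded_hilbert : bounded_sg (twist m%:C Q).
Proof.
have vm' := vm; apply: contrapT => nb.
have [M M0 hM] := resolvent_uniform hc sQ iep vm iR.
pose G := [set w : R | bounded_sg (twist w%:C Q)].
have Gm w : G w -> m < w.
  by move=> Gw; rewrite ltNge; apply/negP => wm; exact: nb (bounded_upward wm Gw).
have [w1 Gw1] := growth_ex sQ.
have hG : has_inf G by split; [exists w1|exists m => w /Gm/ltW].
have mG : m <= inf G by apply: lb_le_inf; [exists w1|move=> w /Gm/ltW].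
pose a' := w1 + 1.
have G1 : inf G <= w1 by apply: ge_inf; [exists m => w /Gm/ltW|].
(* [inf G] itself may fail to be in [G]; the constants below are therefore made uniform over this
   half-open interval of rates. *)
pose A (a : R) := inf G < a /\ a <= a'.
have cA a : A a -> forall t, exists2 s, t <= s & forall x, nrm (twist a%:C Q s x) <= nrm x.
  move=> [Ga aa']; have [w Gw wa] := inf_adherent (eps := a - inf G) ltac:(lra) hG.
  by apply: (eventually_contractive (w := w)) => //; lra.
have [C C0 hC] : exists2 C, 0 <= C & forall t x, 0 <= t ->
    nrm (twist a'%:C Q t x) <= C * expR (- t) * nrm x.
  have [C hC] := Gw1; exists `|C| => // t x t0.
  have := hC t x t0; rewrite !nrm_twist_real => h.
  have -> : expR (- (a' * t)) = expR (- t) * expR (- (w1 * t)).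
    by rewrite -expRD; congr expR; rewrite /a'; ring.
  rewrite -mulrA [`|C| * _]mulrC -mulrA ler_wpM2l ?expR_ge0 //; apply: le_trans h _.
  by rewrite ler_wpM2r ?nrm_ge0 // ler_norm.
(* From [R(a) = R(a') + (a' - a) R(a) R(a')] with [R(a)] bounded by [M]: the comparison factor
   depends neither on [a] nor on the frequency. *)
pose b := 1 + (a' - m) * M.
have b0 : 0 <= b by rewrite addr_ge0 // mulr_ge0 // /a'; lra.
have Rab n a (p : 'I_n * 'I_n) f : A a ->
    nrm (Rs (lam a p) f) <= b * nrm (Rs (lam a' p) f).
  move=> [Ga aa'].
  have i1 := iR (l := lam a p) ltac:(rewrite Re_lam; lra).
  have i2 := iR (l := lam a' p) ltac:(rewrite Re_lam /a'; lra).
  have e := resolvent_identity sQ f i1 i2.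
  have e2 : lam a p - lam a' p = (a - a')%:C.
    by rewrite /lam opprD addrACA subrr add0r rmorphB.
  rewrite e2 in e.
  have := nrmBD (Rs (lam a p) f) (Rs (lam a' p) f).
  rewrite {1}e opprD addrA subrr add0r nrmN nrmZr ler0_norm ?subr_le0 // opprB => h1.
  have h2 := hM (lam a p) ltac:(rewrite Re_lam; lra) (Rs (lam a' p) f).
  have h3 : (a' - a) * nrm (Rs (lam a p) (Rs (lam a' p) f)) <=
     (a' - m) * (M * nrm (Rs (lam a' p) f)).
    apply: ler_pM => //; rewrite ?nrm_ge0 //; lra.
  rewrite /b; lra.
have cos1 := @cos1_gt0 R.
(* Quotient of the two energy estimates: a multiple of [n] from above against [cos 1 * n^2] from
   below, which leaves the factor [n] on the left of [hK]. *)
pose K := 4 * (b ^+ 2 * (256 * C ^+ 2)) / cos 1.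
have hK a f : A a -> pos_from iota Q 0 f -> forall n N, (0 < n)%N ->
    n%:R * (\sum_(0 <= j < N) nrm (antider Q Rs a%:C f (j.+1%:R / n%:R) -
      antider Q Rs a%:C f (j%:R / n%:R)) ^+ 2) <= K * nrm f ^+ 2.
  move=> Aa pf n N n0; have np : 0 < n%:R :> R by rewrite ltr0n.
  have va : v <= a by case: Aa; lra.
  have h1 := energy_lower hc hd sQ iR pf N n0 va.
  have h2 := energy_upper hc hd sQ iR pf n va
    (divr_ge0 (ler0n _ N) (ltW np)) (cA a Aa _).
  have h3 := resolvent_sum_upper hd sQ iR f n (a := a') ltac:(rewrite /a'; lra) C0 hC.
  have h4 : \sum_(p : 'I_n * 'I_n) nrm (Rs (lam a p) f) ^+ 2 <=
      b ^+ 2 * \sum_(p : 'I_n * 'I_n) nrm (Rs (lam a' p) f) ^+ 2.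
    rewrite mulr_sumr; apply: ler_sum => p _; rewrite -exprMn.
    by rewrite lerXn2r ?nnegrE ?nrm_ge0 ?mulr_ge0 ?nrm_ge0 // Rab.
  have h5 : b ^+ 2 * (\sum_(p : 'I_n * 'I_n) nrm (Rs (lam a' p) f) ^+ 2) <=
      b ^+ 2 * (256 * (C * nrm f) ^+ 2 * n%:R) by rewrite ler_wpM2l // sqr_ge0.
  rewrite -(ler_pM2l cos1) -(ler_pM2l np).
  have -> : n%:R * (cos 1 * (K * nrm f ^+ 2)) = 4 * (b ^+ 2 * (256 * (C * nrm f) ^+ 2 * n%:R)).
    by rewrite /K; field; rewrite gt_eqF.
  rewrite expr2 in h1; lra.
pose c0 := `|inf G| + `|a'|.
have hA a : A a -> `|a| <= c0.
  move=> [Ga aa']; rewrite /c0.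
  have h1 := ler_norm a'; have h2 := ler_norm (- inf G); rewrite normrN in h2.
  by have := normr_ge0 a'; have := normr_ge0 (inf G); rewrite ler_norml; move=> *;
     apply/andP; split; lra.
have c00 : 0 <= c0 by rewrite addr_ge0.
have [N1 N10 hN1] := sg_bd sQ 1.
pose L := expR c0 * N1; have L0 : 0 < L by rewrite mulr_gt0 // expR_gt0.
have hL a t x : A a -> 0 <= t <= 1 -> nrm (twist a%:C Q t x) <= L * nrm x.
  move=> Aa t1; rewrite nrm_twist_real /L -mulrA; apply: ler_pM; rewrite ?expR_ge0 ?nrm_ge0 ?hN1 //.
  rewrite ler_expR -mulNr; have h := hA a Aa.
  have h1 := ler_norm (- a); rewrite normrN in h1.
  apply: (@le_trans _ _ (c0 * t)); first by apply: ler_wpM2r; lra.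
  by rewrite -[X in _ <= X]mulr1; apply: ler_wpM2l; lra.
have va a : A a -> v <= a by case=> *; lra.
(* First stage: going back by at most one unit of time changes the norm by a factor of at most [L],
   so the square integral over the last unit interval bounds the orbit at integers. *)
have dec1 f : pos_from iota Q 0 f -> exists C, forall a (n : nat), A a -> (0 < n)%N ->
    1 * nrm (twist a%:C Q n%:R f) ^+ 2 <= C.
  move=> pf; exists (4 * L ^+ 2 * (K * nrm f ^+ 2)) => a [//|n] Aa _.
  have := @orbit_decay (K * nrm f ^+ 2) a L n n.+1 f (va a Aa) L0 (leqnSn n) (hK a f Aa pf).
  rewrite subSnn; apply => r; rewrite -natr1 => rb.
  have n0 : (0 : R) <= n%:R by [].
  have -> : n%:R + 1 = (n%:R + 1 - r) + r by ring.
  rewrite (sgD (twist_sg sQ _)); [|lra|lra].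
  apply: hL => //; lra.
have [C1 C10 hC1] := @uniform_decay (fun=> 1) A c0 c00 hA
  ltac:(by move=> n; rewrite ler01 lerDr ler0n)
  ltac:(by move=> n k _; rewrite mulr1 lerDr ler0n) dec1.
rewrite sqrtr1 in hC1.
have hL2 a (t : R) x : A a -> 0 <= t -> nrm (twist a%:C Q t x) <= (L * C1 + 1) * nrm x.
  move=> Aa t0; have /andP[tr1 tr2] := Num.Theory.truncn_itv t0.
  set n := Num.truncn t in tr1 tr2.
  have -> : t = (t - n%:R) + n%:R by ring.
  rewrite (sgD (twist_sg sQ _)) ?subr_ge0 //.
  have h1 := hL a (t - n%:R) (twist a%:C Q n%:R x) Aa ltac:(move: tr2; rewrite -natr1; lra).
  have h2 := hC1 a n x Aa; rewrite mul1r in h2.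
  have h3 : L * nrm (twist a%:C Q n%:R x) <= L * (C1 * nrm x) by rewrite ler_pM2l.
  have := nrm_ge0 x; lra.
have L20 : 0 < L * C1 + 1 by rewrite ltr_wpDl // mulr_ge0 // ltW.
(* Second stage: the uniform bound [L * C1 + 1] now allows comparison over all of [[0, n]], and the
   same square integral gives decay like [n^(-1/2)]. *)
have dec2 f : pos_from iota Q 0 f -> exists C, forall a (n : nat), A a -> (0 < n)%N ->
    n%:R * nrm (twist a%:C Q n%:R f) ^+ 2 <= C.
  move=> pf; exists (4 * (L * C1 + 1) ^+ 2 * (K * nrm f ^+ 2)) => a n Aa _.
  have := @orbit_decay (K * nrm f ^+ 2) a (L * C1 + 1) 0 n f (va a Aa) L20 (leq0n n) (hK a f Aa pf).
  rewrite subn0; apply => r; rewrite mulr0n => rb.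
  have -> : n%:R = (n%:R - r) + r by ring.
  rewrite (sgD (twist_sg sQ _)); [|lra|lra].
  apply: hL2 => //; lra.
have [C2 C20 hC2] := @uniform_decay (fun n => n%:R) A c0 c00 hA
  ltac:(by move=> n; rewrite ler0n lerDl ler01)
  ltac:(by move=> n k n0 /=; rewrite natrD mulrDl mul1r addrC lerD2r
    -[X in X <= _]mulr1 ler_wpM2l // ler1n) dec2.
pose n := (Num.bound ((2 * C2) ^+ 2)).+1.
have n0 : 0 < n%:R :> R by rewrite ltr0n.
have sn : 2 * C2 <= Num.sqrt n%:R.
  rewrite -(ger0_norm (x := 2 * C2)); last lra.
  rewrite -sqrtr_sqr ler_wsqrtr //; apply: ltW.
  apply: lt_le_trans (archi_boundP (sqr_ge0 _)) _; by rewrite ler_nat.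
have half a x : A a -> nrm (twist a%:C Q n%:R x) <= 1 / 2 * nrm x.
  move=> Aa; have := hC2 a n x Aa => h.
  have s0 : 0 < Num.sqrt n%:R :> R by rewrite sqrtr_gt0.
  rewrite -(ler_pM2l s0); apply: le_trans h _.
  have : C2 * nrm x <= (Num.sqrt n%:R / 2) * nrm x by rewrite ler_wpM2r ?nrm_ge0 //; lra.
  lra.
have ln2 : 0 < ln 2 / n%:R :> R by rewrite divr_gt0 // ln_gt0 // ltr1n.
(* Half of [ln 2 / n] ensures that lowering [a] by [ln 2 / n] ends below [inf G]; the other entry
   keeps [a] in [A]. *)
pose e := Num.min (ln 2 / n%:R / 2) (a' - inf G).
have e0 : 0 < e by rewrite lt_min /a'; apply/andP; split; lra.
have e1 : e <= ln 2 / n%:R / 2 by rewrite ge_min lexx.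
have e2 : e <= a' - inf G by rewrite ge_min lexx orbT.
pose a := inf G + e.
have Aa : A a by split; rewrite /a; lra.
have Ga : G (- (ln 2 / n%:R) + a).
  rewrite /G /= rmorphD -twistD; apply: bounded_shift => //; first exact: twist_sg.
  by move=> x; exact: half.
have : inf G <= - (ln 2 / n%:R) + a by apply: ge_inf; [exists m => w /Gm/ltW|].
rewrite /a; lra.
Qed.

End HilbertBound.

Theorem theorem7p8 (R : realType) (B : banachLatticeType R)
    (E : completeNormedModType R[i]) (iota : B -> E)
    (T : R -> {linear E -> E}) :
  complexification iota ->
  C0_semigroup T ->
  individually_eventually_positive iota T ->
  (is_hilbert E ->
     spectral_bound (generator T) = growth_bound T) /\
  (forall (d : measure_display) (Omega : measurableType d)
     (mu : {measure set Omega -> \bar R}) (cls : (Omega -> R[i]) -> E),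
     is_L1 iota mu cls ->
     spectral_bound (generator T) = growth_bound T) /\
  (forall (K : topologicalType) (ev : E -> K -> R[i]^o),
     compact [set: K] -> hausdorff_space K ->
     is_CK iota ev ->
     real_operator iota (generator T) ->
     spectral_bound (generator T) = growth_bound T).
Proof.
move=> hc hT hp; pose Q (t : R) (x : E) := T t x.
have sQ : semigroup Q := C0_sg hT.
have iep f : positive_cone iota f -> exists2 t0 : R, 0 <= t0 & pos_from iota Q t0 f.
  by move=> /hp[t0 t00 h]; exists t0.
pose halfplane v := forall l, v <= complex.Re l -> exists S, inverts (twist l Q) S.
have main : (forall v m : R, v < m -> halfplane v -> bounded_sg (twist m%:C Q)) ->
    spectral_bound (generator T) = growth_bound T.
  move=> h; apply/le_anti; rewrite (spectral_bound_le_growth_bound hT) /=.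
  exact: (growth_bound_le_spectral_bound hT h).
have res (v m : R) : v < m -> halfplane v -> exists S,
    inverts (twist m%:C Q) S /\ pos_resolvent iota Q S.
  move=> vm hv; have [S iS] := hv m%:C (ltW vm); exists S; split => //.
  apply: (pos_resolventP hc sQ _ iS) => a ma; apply: hv; exact: le_trans (ltW vm) ma.
split; last split.
- move=> [dot hd]; apply: main => v m vm hv.
  have /boolp.choice[Rs iR] : forall l, exists S, v <= complex.Re l -> inverts (twist l Q) S.
    move=> l; have [/hv[S iS]|h] := boolP (v <= complex.Re l); first by exists S.
    by exists id.
  exact: (bounded_hilbert hc hd sQ iep vm iR).
- move=> d Omega mu cls hL; apply: main => v m vm /(res v m vm)[S [iS pS]].
  apply: (bounded_additive_norm hc sQ iep iS pS) => f g.
  exact: (nrm_L1_additive hc hL).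
- move=> K ev cK _ hK rA; apply: main => v m vm /(res v m vm)[S [iS pS]].
  have [u [D [uD hu]]] := CK_order_unit hc cK hK hT rA.
  exact: (bounded_order_unit hc sQ iep iS pS uD hu).
Qed.
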